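(* Let $\tau=(\tau_1,\dots,\tau_m)$ with $\tau_k\ge0$ be fixed (with $\tau_k>0$ and $\nu_k\ne0$ for at least one $k$), and let $t\in\mathfrak h_{\mathbb R}$ be regular and lie in the dominant Weyl chamber. Let $\eta=\sum_a\eta_a\alpha_a$ be the Legendre image of $t$, i.e. $\sum_bB_{ab}\eta_b=\frac{\partial f}{\partial t_a}(\tau,t)$ for $a=1,\dots,r$, and let $K=BD^{-1}B$ with $D_{ab}=\frac{\partial^2 f(\tau,y)}{\partial y_a\partial y_b}\big|_{y=t}$. Then under the rescaling $\xi_l=\epsilon\lambda_l=\eta_l+\sqrt{\epsilon}\,a_l$ the character measure converges weakly, as $\epsilon\to0$, to the Gaussian probability measure $p(a,t)\,da_1\cdots da_r$ on $\mathbb R^r$ with density $$p(a,t)=\frac{\sqrt{\det K}}{(2\pi)^{r/2}}\,e^{-\frac12\sum_{b,c}a_bK_{bc}a_c}.$$ That is, for every bounded continuous function $h:\mathbb R^r\to\mathbb R$ and every sequence $\epsilon_n>0$, $\epsilon_n\to0$, such that $N_k=\tau_k/\epsilon_n$ are integers for all $k,n$, $$\sum_{\lambda\in D}h\Big(\sqrt{\epsilon_n}\big(\lambda-\tfrac{\eta}{\epsilon_n}\big)\Big)\,p^{(N)}_\lambda(t)\ \longrightarrow\ \int_{\mathbb R^r}h(a)\,p(a,t)\,da_1\cdots da_r\qquad(n\to\infty),$$ where $D$ is the set of highest weights $\lambda$ of irreducible components of $\bigotimes_kV_{\nu_k}^{\otimes N_k}$.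
   Context: $\mathfrak g$ is a simple (complex, finite-dimensional) Lie algebra of rank $r$; $\mathfrak h_{\mathbb R}$ is the Cartan subalgebra of its split real form; $(\cdot,\cdot)$ is the Killing form, used to identify $\mathfrak h_{\mathbb R}$ with $\mathfrak h_{\mathbb R}^*$. $\alpha_1,\dots,\alpha_r$ are the simple roots and $W$ the Weyl group. Elements of $\mathfrak h_{\mathbb R}\simeq\mathfrak h_{\mathbb R}^*$ are identified with vectors in $\mathbb R^r$ by their coordinates in the basis of simple roots, $y=\sum_ay_a\alpha_a$; $B_{ab}=(\alpha_a,\alpha_b)$. An element is regular if its stabilizer in $W$ is trivial. $V_\lambda$ is the irreducible finite-dimensional module with highest weight $\lambda$, $\chi_\lambda(e^y)=\mathrm{tr}_{V_\lambda}(e^y)=\sum_\mu\dim V_\lambda(\mu)\,e^{(\mu,y)}$. $\nu_1,\dots,\nu_m$ are fixed dominant integral weights and $f(\tau,y)=\sum_k\tau_k\ln\chi_{\nu_k}(e^y)$. For nonnegative integers $N_1,\dots,N_m$, let $m_\lambda(\{V_{\nu_k}\},\{N_k\})$ be the multiplicity of $V_\lambda$ in $\bigotimes_{k=1}^mV_{\nu_k}^{\otimes N_k}$. The character measure is the probability measure on the set of irreducible components $$p^{(N)}_\lambda(t)=\frac{m_\lambda(\{V_{\nu_k}\},\{N_k\})\,\chi_\lambda(e^t)}{\prod_k\chi_{\nu_k}(e^t)^{N_k}}.$$ *)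

(* Defs.v *)
From HB Require Import structures.
From mathcomp Require Import all_boot all_order all_algebra.
From mathcomp Require Import complex mxtens.
From mathcomp Require Import ring.
From mathcomp Require Import all_classical all_reals all_analysis.

Set Implicit Arguments.
Unset Strict Implicit.
Unset Printing Implicit Defensive.

Import Order.TTheory GRing.Theory Num.Theory.
Import numFieldNormedType.Exports.

Local Open Scope classical_set_scope.
Local Open Scope ring_scope.
Local Open Scope complex_scope.

Record lieAlgebra (K : fieldType) := LieAlgebra {
  lie_sort :> vectType K;
  lie_br : lie_sort -> lie_sort -> lie_sort;
  lie_linearl : forall a x y z,
    lie_br (a *: x + y) z = a *: lie_br x z + lie_br y z;
  lie_linearr : forall a x y z,
    lie_br z (a *: x + y) = a *: lie_br z x + lie_br z y;
  lie_alternating : forall x, lie_br x x = 0;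
  lie_jacobi : forall x y z,
    lie_br x (lie_br y z) + lie_br y (lie_br z x) + lie_br z (lie_br x y) = 0 }.

(* The Killing form tr (ad x o ad y). *)
Definition killing (K : fieldType) (g : lieAlgebra K) (x y : g) : K :=
  let e := vbasis {: g} in
  \sum_(i < \dim {: g}) coord e i (lie_br x (lie_br y e`_i)).

Definition is_simple (K : fieldType) (g : lieAlgebra K) : Prop :=
  (exists x y : g, lie_br x y <> 0) /\
  (forall I : {vspace g}, (forall x y : g, y \in I -> lie_br x y \in I) ->
     I = 0%VS \/ I = fullv).

(* Finite-dimensional modules: matrices act on column vectors from the left. *)
Record lieModule (K : fieldType) (g : lieAlgebra K) := LieModule {
  mdim : nat;
  mact : g -> 'M[K]_mdim;
  mact_linear : forall a x y, mact (a *: x + y) = a *: mact x + mact y;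
  mact_br : forall x y,
    mact (lie_br x y) = mact x *m mact y - mact y *m mact x }.
Arguments mdim {K g} l.
Arguments mact {K g} l x.

Section Modules.
Variables (K : fieldType) (g : lieAlgebra K).
Implicit Types (U V : lieModule g) (n : nat).

Definition const_module_act n (x : g) : 'M[K]_n := 0.

Lemma const_module_linear n a (x y : g) :
  const_module_act n (a *: x + y)
  = a *: const_module_act n x + const_module_act n y.
Proof. by rewrite /const_module_act scaler0 addr0. Qed.

Lemma const_module_br n (x y : g) :
  const_module_act n (lie_br x y)
  = const_module_act n x *m const_module_act n y
    - const_module_act n y *m const_module_act n x.
Proof. by rewrite /const_module_act mulmx0 subrr. Qed.

Definition const_module n : lieModule g :=
  LieModule (@const_module_linear n) (@const_module_br n).

Definition zero_module : lieModule g := const_module 0.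
Definition trivial_module : lieModule g := const_module 1.

Definition dsum_act U V (x : g) : 'M[K]_(mdim U + mdim V) :=
  block_mx (mact U x) 0 0 (mact V x).

Lemma dsum_linear U V a (x y : g) :
  dsum_act U V (a *: x + y) = a *: dsum_act U V x + dsum_act U V y.
Proof.
by rewrite /dsum_act !mact_linear scale_block_mx add_block_mx !scaler0 !addr0.
Qed.

Lemma dsum_br U V (x y : g) :
  dsum_act U V (lie_br x y)
  = dsum_act U V x *m dsum_act U V y - dsum_act U V y *m dsum_act U V x.
Proof.
rewrite /dsum_act !mact_br !mulmx_block opp_block_mx add_block_mx.
by rewrite !mul0mx !mulmx0 !addr0 !add0r ?oppr0 ?addr0.
Qed.

Definition dsum_module U V : lieModule g :=
  LieModule (@dsum_linear U V) (@dsum_br U V).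

Definition tensor_act U V (x : g) : 'M[K]_(mdim U * mdim V) :=
  mact U x *t 1%:M + 1%:M *t mact V x.

Lemma tensor_linear U V a (x y : g) :
  tensor_act U V (a *: x + y) = a *: tensor_act U V x + tensor_act U V y.
Proof.
rewrite /tensor_act !mact_linear; apply/matrixP => i j; rewrite !mxE.
set A := mact U x; set B := mact U y; set C := mact V x; set D := mact V y.
by ring.
Qed.

Lemma tensor_br U V (x y : g) :
  tensor_act U V (lie_br x y)
  = tensor_act U V x *m tensor_act U V y - tensor_act U V y *m tensor_act U V x.
Proof.
rewrite /tensor_act !mulmxDl !mulmxDr !tensmx_mul !mul1mx !mulmx1 !mact_br.
set A := mact U x; set B := mact U y; set C := mact V x; set D := mact V y.
have -> : (A *m B - B *m A) *t (1%:M : 'M[K]_(mdim V))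
    = (A *m B) *t 1%:M - (B *m A) *t 1%:M.
  by apply/matrixP => i j; rewrite !mxE mulrBl.
have -> : (1%:M : 'M[K]_(mdim U)) *t (C *m D - D *m C)
    = 1%:M *t (C *m D) - 1%:M *t (D *m C).
  by apply/matrixP => i j; rewrite !mxE mulrBr.
move: (_ *t 1%:M) (_ *t 1%:M) (1%:M *t _) (1%:M *t _) (A *t D) (B *t C).
by move=> a b c d e f; apply/matrixP => i j; rewrite !mxE; ring.
Qed.

Definition tensor_module U V : lieModule g :=
  LieModule (@tensor_linear U V) (@tensor_br U V).

Definition tensor_pow V n : lieModule g :=
  iter n (tensor_module V) trivial_module.

Definition module_iso U V : Prop :=
  exists (A : 'M[K]_(mdim V, mdim U)) (B : 'M[K]_(mdim U, mdim V)),
    [/\ A *m B = 1%:M, B *m A = 1%:M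
      & forall x : g, A *m mact U x = mact V x *m A].

Definition irreducible V : Prop :=
  (0 < mdim V)%N /\
  forall S : {vspace 'cV[K]_(mdim V)},
    (forall (x : g) v, v \in S -> mact V x *m v \in S) ->
    S = 0%VS \/ S = fullv.

End Modules.

(* gR is a split real form of g and hR a Cartan subalgebra of gR such that ad h
   is diagonalizable on gR, over the reals, for every h in hR. *)
Section SplitRealForm.
Variables (R : realType) (g : lieAlgebra R[i]).
Implicit Types S gR hR : set g.

Definition real_subalgebra S : Prop :=
  [/\ S 0, forall (a : R) x y, S x -> S y -> S (a%:C *: x + y)
    & forall x y, S x -> S y -> S (lie_br x y)].

Definition is_real_form gR : Prop :=
  real_subalgebra gR /\
  forall z : g, exists! p : g * g, [/\ gR p.1, gR p.2 & z = p.1 + 'i *: p.2].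

(* Lower central series: [y_1, [y_2, .., [y_n, x]]] = 0 for some n. *)
Definition is_nilpotent S : Prop :=
  exists n : nat, forall (x : g) (s : seq g), S x -> size s = n ->
    (forall y, y \in s -> S y) -> foldr (@lie_br _ g) x s = 0.

Definition is_cartan gR hR : Prop :=
  [/\ hR `<=` gR, real_subalgebra hR, is_nilpotent hR
    & forall x, gR x -> (forall h, hR h -> hR (lie_br x h)) -> hR x].

(* A complex basis of g contained in the real form gR is a real basis of gR. *)
Definition is_split gR hR : Prop :=
  forall h, hR h -> exists X : (\dim {: g}).-tuple g,
    [/\ basis_of fullv X, forall i, gR X`_i
      & forall i, exists c : R, lie_br h X`_i = c%:C *: X`_i].

Definition split_real_form gR hR : Prop :=
  [/\ is_real_form gR, is_cartan gR hR & is_split gR hR].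

End SplitRealForm.

(* The Killing form identifies hR with its dual, so roots and weights are
   elements of hR; those are represented by their coordinates y in the family
   alpha of simple roots, cvec y being the element itself. *)
Section RootsAndWeights.
Variables (R : realType) (r : nat) (g : lieAlgebra R[i]) (alpha : 'I_r -> g).
Implicit Types (x y t beta lambda mu : 'rV[R]_r) (V T : lieModule g).

Definition cvec y : g := \sum_a (y 0 a)%:C *: alpha a.

(* 'e_a : coordinates of the simple root alpha a. *)
Local Notation "''e_' a" := (delta_mx 0 a : 'rV[R]_r)
  (at level 8, a at level 2).

Definition root_vector beta (u : g) : Prop :=
  forall y, lie_br (cvec y) u = killing (cvec beta) (cvec y) *: u.

Definition is_root beta : Prop :=
  beta <> 0 /\ exists2 u : g, u <> 0 & root_vector beta u.

Definition is_positive_root beta : Prop :=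
  is_root beta /\ forall a, 0 <= beta 0 a.

Definition simple_roots (hR : set g) : Prop :=
  [/\ forall y, hR (cvec y),
      forall h, hR h -> exists! y, h = cvec y,
      forall a, is_root 'e_a
    & forall beta, is_root beta -> exists n : 'I_r -> nat,
        (forall a, beta 0 a = (n a)%:R) \/ (forall a, beta 0 a = - (n a)%:R)].

(* The Killing form is real on hR, so taking real parts loses nothing. *)
Definition gram : 'M[R]_r := \matrix_(a, b) complex.Re (killing (alpha a) (alpha b)).

Definition pairing x y : R := \sum_a \sum_b x 0 a * gram a b * y 0 b.

Definition reflection beta y : 'rV[R]_r :=
  y - (2 * pairing y beta / pairing beta beta) *: beta.

Inductive weyl_group : ('rV[R]_r -> 'rV[R]_r) -> Prop :=
| weyl_id : weyl_group id
| weyl_reflection beta w :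
    is_root beta -> weyl_group w -> weyl_group (reflection beta \o w).

Definition regular y : Prop :=
  forall w, weyl_group w -> w y = y -> w =1 id.

Definition dominant_chamber y : Prop := forall a, 0 <= pairing 'e_a y.

Definition dominant_integral lambda : Prop :=
  forall a, exists k : nat,
    2 * pairing lambda 'e_a / pairing 'e_a 'e_a = k%:R.

(* V(mu); it suffices to test h on the spanning family alpha of hR. *)
Definition weight_space V mu : {vspace 'cV[R[i]]_(mdim V)} :=
  (\bigcap_(a < r) lker (linfun (fun v : 'cV[R[i]]_(mdim V) =>
     mact V (alpha a) *m v - killing (cvec mu) (alpha a) *: v)))%VS.

Definition has_highest_weight V lambda : Prop :=
  exists v : 'cV[R[i]]_(mdim V),
    [/\ v <> 0, v \in weight_space V lambda
      & forall beta u, is_positive_root beta -> root_vector beta u ->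
          mact V u *m v = 0].

(* chi_V(e^y); the sum is over the finitely many weights of V. *)
Definition character V y : R :=
  \sum_(mu \in [set: 'rV[R]_r])
    (\dim (weight_space V mu))%:R * expR (pairing mu y).

(* VV is a choice, for every dominant integral lambda, of an irreducible module
   of highest weight lambda. *)
Definition highest_weight_modules (VV : 'rV[R]_r -> lieModule g) : Prop :=
  forall lambda, dominant_integral lambda ->
    irreducible (VV lambda) /\ has_highest_weight (VV lambda) lambda.

Section FixedModules.
Variable VV : 'rV[R]_r -> lieModule g.

(* T is isomorphic to the direct sum of the VV lambda, lambda ranging over s
   with repetitions. *)
Definition decomposition T (s : seq 'rV[R]_r) : Prop :=
  (forall lambda, lambda \in s -> dominant_integral lambda) /\
  module_iso T (\big[@dsum_module _ g/@zero_module _ g]_(lambda <- s) VV lambda).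

(* The highest weights of the irreducible components of T, with repetitions;
   unique up to the order. *)
Definition components T : seq 'rV[R]_r := xget [::] [set s | decomposition T s].

Definition multiplicity T lambda : nat := count_mem lambda (components T).

Section FixedWeights.
Variables (m : nat) (nu : 'I_m -> 'rV[R]_r).

Definition big_tensor (N : 'I_m -> nat) : lieModule g :=
  \big[@tensor_module _ g/@trivial_module _ g]_(k < m)
    tensor_pow (VV (nu k)) (N k).

Definition free_energy (tau : 'I_m -> R) y : R :=
  \sum_(k < m) tau k * ln (character (VV (nu k)) y).

Definition character_measure (N : 'I_m -> nat) t lambda : R :=
  (multiplicity (big_tensor N) lambda)%:R * character (VV lambda) t
  / \prod_(k < m) character (VV (nu k)) t ^+ N k.

(* The set D of highest weights of the irreducible components of the tensor
   product, without repetitions. *)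
Definition highest_weights (N : 'I_m -> nat) : seq 'rV[R]_r :=
  undup (components (big_tensor N)).

End FixedWeights.
End FixedModules.
End RootsAndWeights.

Section Analysis.
Variables (R : realType) (r : nat).
Implicit Types (f : 'rV[R]_r -> R) (K : 'M[R]_r) (t a : 'rV[R]_r).

Definition partial (i : 'I_r) f t : R := 'D_(delta_mx 0 i : 'rV[R]_r) f t.

Definition hessian f t : 'M[R]_r :=
  \matrix_(i, j) partial i (partial j f) t.

Definition gaussian_density K a : R :=
  Num.sqrt (\det K) / (2 * pi) `^ (r%:R / 2)
  * expR (- (1 / 2) * \sum_i \sum_j a 0 i * K i j * a 0 j).

End Analysis.

(* The integral over R^n with respect to da_1 .. da_n, as the iterated Lebesgue
   integral. *)
Fixpoint integral_rV (R : realType) (n : nat) : ('rV[R]_n -> R) -> R :=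
  match n with
  | 0 => fun F => F 0
  | n'.+1 => fun F =>
      Rintegral (@lebesgue_measure R) setT
        (fun x : R => integral_rV (fun v : 'rV[R]_n' =>
           F (row_mx (const_mx x : 'rV[R]_1) v)))
  end.

(* Main.v *)
(* Draw an irreducible component lambda of the tensor product according to the
   character measure, and then a weight mu of V_lambda with probability
   proportional to e^(mu, t).  Characters being multiplicative, mu is distributed
   as a sum of independent random weights, N_k of them weights of V_(nu_k) taken
   with probabilities e^(mu, t) / chi_(nu_k)(e^t).  The characteristic functions
   of the rescaled mu therefore converge to that of the centred Gaussian with
   covariance S = sum_k tau_k Cov_k.  Differentiating f gives
   eta = sum_k tau_k (mean)_k and D = B S B, hence K = S^-1.

   It remains to replace mu by lambda.  By Poincare-Birkhoff-Witt the vectors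
   obtained from a highest weight vector by ordered products of negative root
   vectors span V_lambda, so the sum of the e^(mu - lambda, t/2) over the weights
   mu of V_lambda is bounded by a product of geometric series independent of
   lambda (t is in the open chamber); so lambda - mu is tight, and negligible
   after rescaling.

   Convergence of characteristic functions together with bounded second moments
   gives weak convergence: a Bernstein polynomial in the sin(x_j / 2L) is a
   trigonometric polynomial which approximates a given bounded continuous
   function up to an error e + C |x|^2 / L^2. *)
Require Import Defs.
From HB Require Import structures.
From mathcomp Require Import all_boot all_order all_algebra.
From mathcomp Require Import complex mxtens.
From mathcomp Require Import ring lra zify.
From mathcomp Require Import all_classical all_reals all_analysis measurable_realfun.

Set Implicit Arguments.
Unset Strict Implicit.
Unset Printing Implicit Defensive.

Import Order.TTheory GRing.Theory Num.Theory.
Import numFieldNormedType.Exports.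

Local Open Scope classical_set_scope.
Local Open Scope ring_scope.

(** * The Killing form and the roots *)

(** The measure is built on [components], a chosen decomposition, so complete reducibility has to be
    proved first: without it the choice could be a default value. The submodule generated by a
    highest weight vector is irreducible because the Casimir value (lambda, lambda + 2 rho)
    separates comparable dominant weights; the input about rho is (2 rho, alpha_a) >= 0, obtained
    from a trace. Complements come from the same statement for the dual module, read with the
    opposite simple roots so that weights keep their coordinates. Afterwards only sums over all
    weights of all components enter, and these are sums over the weights of the tensor product.

    The passage from mu to lambda hinges on splitting t into halves. Given lambda, mu has
    probability e^(mu, t) / chi_lambda(e^t) <= e^(mu - lambda, t). Half of this decay pays for the
    factor e^(lambda - mu, t/2), which dominates the coordinates of lambda - mu and their squares;
    the other half keeps the sum over mu bounded uniformly in lambda. The same factor controls the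
    second moment of lambda. *)

Lemma vspace_comprehension (K : fieldType) (vT : vectType K) (P : vT -> Prop) :
  P 0 -> (forall a x y, P x -> P y -> P (a *: x + y)) ->
  exists U : {vspace vT}, forall x, x \in U <-> P x.
Proof.
move=> P0 PD.
(* [U] will be a subspace of maximal dimension inside [P]; a vector of [P] outside [U] could be
   added to it. *)
pose good k := `[< exists U : {vspace vT}, (forall x, x \in U -> P x) /\ \dim U = k >].
have ex0 : exists k, good k.
  exists 0%N; apply/asboolP; exists 0%VS; split; last by rewrite dimv0.
  by move=> x; rewrite memv0 => /eqP ->.
have ub k : good k -> (k <= \dim {: vT})%N.
  by move=> /asboolP[U [_ <-]]; rewrite dimvS ?subvf.
case: (ex_maxnP ex0 ub) => k /asboolP[U [UP dimU]] kmax.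
exists U => x; split; first exact: UP.
move=> Px; apply/negPn/negP => xU.
have /kmax : good (\dim (<[x]> + U)).
  apply/asboolP; exists (<[x]> + U)%VS; split=> // y /memv_addP[u /vlineP[a ->]] [v vU ->].
  by apply: PD => //; exact: UP.
rewrite -dimU => dimle.
have := dimv_leqif_eq (addvSr <[x]> U).
case=> _; rewrite eqn_leq dimle dimvS ?addvSr //= => /esym/eqP UE.
by move/negP: xU; apply; rewrite UE (subvP (addvSl _ _)) // memv_line.
Qed.

Section LieBasics.
Variables (K : fieldType) (g : lieAlgebra K).
Implicit Types x y z : g.

HB.instance Definition _ x :=
  GRing.isLinear.Build K g g *:%R (lie_br x) (fun a y z => lie_linearr a y z x).

Lemma lie_brN x y : lie_br x y = - lie_br y x.
Proof.
have brD u v w : lie_br (u + v) w = lie_br u w + lie_br v w.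
  by rewrite -{1}(scale1r u) lie_linearl scale1r.
have := lie_alternating (x + y).
rewrite linearD /= !brD !lie_alternating add0r addr0 => /eqP.
by rewrite addrC addr_eq0 => /eqP.
Qed.

Lemma lie_brDl x y z : lie_br (x + y) z = lie_br x z + lie_br y z.
Proof. by rewrite -{1}(scale1r x) lie_linearl scale1r. Qed.

Lemma lie_br0l z : lie_br 0 z = 0.
Proof. by rewrite lie_brN linear0 oppr0. Qed.

Lemma lie_brZl a x z : lie_br (a *: x) z = a *: lie_br x z.
Proof. by rewrite -(addr0 (a *: x)) lie_linearl lie_br0l addr0. Qed.

Lemma lie_br_suml I (s : seq I) (P : pred I) (F : I -> g) z :
  lie_br (\sum_(i <- s | P i) F i) z = \sum_(i <- s | P i) lie_br (F i) z.
Proof.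
elim/big_rec2: _ => [|i u v _ <-]; first by rewrite lie_br0l.
by rewrite lie_brDl.
Qed.

Lemma lie_br_der x y z :
  lie_br x (lie_br y z) = lie_br (lie_br x y) z + lie_br y (lie_br x z).
Proof.
have := lie_jacobi x y z; rewrite (lie_brN z (lie_br x y)) (lie_brN z x) linearN.
by move/eqP; rewrite subr_eq0 subr_eq => /eqP.
Qed.

Let n := \dim {: g}.
Let e : n.-tuple g := vbasis {: g}.

Lemma e_basis : basis_of {: g} e. Proof. exact: vbasisP. Qed.

(* Coordinates are row vectors, so that [adm] reverses products. *)
Definition adm x : 'M[K]_n := \matrix_(i, j) coord e j (lie_br x e`_i).

Lemma coord_br x y j : coord e j (lie_br x y) = \sum_i coord e i y * adm x i j.
Proof.
rewrite {1}(coord_basis e_basis (memvf y)) linear_sum linear_sum.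
by apply: eq_bigr => i _; rewrite linearZ /= linearZ /= mxE.
Qed.

Lemma adm_br x y : adm (lie_br x y) = adm y *m adm x - adm x *m adm y.
Proof.
apply/matrixP => i j; rewrite !mxE.
have -> : lie_br (lie_br x y) e`_i
    = lie_br x (lie_br y e`_i) - lie_br y (lie_br x e`_i).
  by rewrite (lie_br_der x y) addrK.
rewrite linearB /= !coord_br.
by congr (_ - _); apply: eq_bigr => k _; rewrite !mxE.
Qed.

Lemma adm_linear a x y : adm (a *: x + y) = a *: adm x + adm y.
Proof. by apply/matrixP => i j; rewrite !mxE lie_linearl linearP. Qed.

Lemma killingE x y : killing x y = \tr (adm y *m adm x).
Proof.
apply: eq_bigr => i _; rewrite coord_br mxE; apply: eq_bigr => j _.
by rewrite !mxE.
Qed.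

Lemma killingC x y : killing x y = killing y x.
Proof. by rewrite !killingE mxtrace_mulC. Qed.

Lemma killing_linearr a x y z :
  killing z (a *: x + y) = a * killing z x + killing z y.
Proof. by rewrite !killingE adm_linear mulmxDl -scalemxAl linearP. Qed.

HB.instance Definition _ z :=
  GRing.isLinear.Build K g K *%R (killing z)
    (fun a x y => killing_linearr a x y z).

Lemma killing_linearl a x y z :
  killing (a *: x + y) z = a * killing x z + killing y z.
Proof. by rewrite !(killingC _ z) killing_linearr. Qed.

Lemma killingZl a x z : killing (a *: x) z = a * killing x z.
Proof. by rewrite !(killingC _ z) linearZ. Qed.

Lemma killingNl x z : killing (- x) z = - killing x z.
Proof. by rewrite !(killingC _ z) linearN. Qed.

Lemma killingDl x y z : killing (x + y) z = killing x z + killing y z.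
Proof. by rewrite !(killingC _ z) linearD. Qed.

Lemma killing_suml I (s : seq I) (P : pred I) (F : I -> g) z :
  killing (\sum_(i <- s | P i) F i) z = \sum_(i <- s | P i) killing (F i) z.
Proof. by rewrite killingC linear_sum; apply: eq_bigr => i _; rewrite killingC. Qed.

Lemma killing_inv x y z : killing (lie_br x y) z = killing x (lie_br y z).
Proof.
rewrite !killingE !adm_br mulmxBl mulmxBr !raddfB /= !mulmxA; congr (_ - _).
by rewrite mxtrace_mulC mulmxA.
Qed.

Lemma eq_on_coord u v : (forall j, coord e j u = coord e j v) -> u = v.
Proof.
move=> uv; rewrite (coord_basis e_basis (memvf u)) (coord_basis e_basis (memvf v)).
by apply: eq_bigr => j _; rewrite uv.
Qed.

Definition basis_mx (X : n.-tuple g) : 'M[K]_n := \matrix_(i, j) coord e j X`_i.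

Lemma basis_mx_unit (X : n.-tuple g) : basis_of {: g} X -> basis_mx X \in unitmx.
Proof.
move=> bX; pose Q := \matrix_(i < n, j < n) coord X j e`_i.
suff /mulmx1_unit[] : basis_mx X *m Q = 1%:M by [].
apply/matrixP => i k; rewrite !mxE -(coord_free i k (basis_free bX)).
rewrite [in RHS](coord_basis e_basis (memvf X`_i)) linear_sum.
by apply: eq_bigr => j _; rewrite linearZ /= !mxE.
Qed.

Lemma unit_basis_mx (P : 'M[K]_n) : P \in unitmx ->
  exists2 X : n.-tuple g, basis_of {: g} X & basis_mx X = P.
Proof.
move=> Pu; pose X := [tuple \sum_j P i j *: e`_j | i < n].
have XE (i : 'I_n) : X`_i = \sum_j P i j *: e`_j.
  by rewrite -tnth_nth tnth_mktuple.
have bXP : basis_mx X = P.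
  by apply/matrixP => i j; rewrite mxE XE coord_sum_free // (basis_free e_basis).
exists X => //; rewrite basisEfree size_tuple leqnn andbT subvf andbT.
apply/freeP => k k0 i.
have kP0 : (\row_i k i) *m P = 0.
  apply/rowP => j; rewrite !mxE -[RHS](linear0 (coord e j)) -k0 linear_sum.
  apply: eq_bigr => l _; rewrite mxE [RHS]linearZ /= XE coord_sum_free //.
  exact: basis_free e_basis.
have /rowP/(_ i) : \row_i k i = 0 by rewrite -(mulmxK Pu (\row_i k i)) kP0 mul0mx.
by rewrite !mxE.
Qed.

Lemma eigen_basis_mx (X : n.-tuple g) h (d : 'rV_n) :
  (forall i : 'I_n, lie_br h X`_i = d 0 i *: X`_i) <->
  basis_mx X *m adm h = diag_mx d *m basis_mx X.
Proof.
have dX i j : (diag_mx d *m basis_mx X) i j = coord e j (d 0 i *: X`_i).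
  by rewrite mul_diag_mx !mxE [RHS]linearZ.
have Xh i j : (basis_mx X *m adm h) i j = coord e j (lie_br h X`_i).
  by rewrite coord_br mxE; apply: eq_bigr => k _; rewrite mxE.
split=> [hX|/matrixP hX i]; first by apply/matrixP => i j; rewrite dX Xh hX.
by apply: eq_on_coord => j; rewrite -dX -Xh hX.
Qed.

(** Conjugation by the basis matrix makes ad x and ad y diagonal at once, so the trace of their
    product is read off the eigenvalues. *)
Lemma killing_eigen (X : n.-tuple g) x y (c d : 'rV_n) : basis_of {: g} X ->
  (forall i : 'I_n, lie_br x X`_i = c 0 i *: X`_i) ->
  (forall i : 'I_n, lie_br y X`_i = d 0 i *: X`_i) ->
  killing x y = \sum_i c 0 i * d 0 i.
Proof.
move=> /basis_mx_unit Pu /eigen_basis_mx cX /eigen_basis_mx dX.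
rewrite killingE; set P := basis_mx X in Pu cX dX *.
have conjP (A : 'M[K]_n) (f : 'rV[K]_n) : P *m A = diag_mx f *m P -> A = invmx P *m (diag_mx f *m P).
  by move=> <-; rewrite mulKmx.
rewrite (conjP _ _ cX) (conjP _ _ dX) mxtrace_mulC -!mulmxA mxtrace_mulC !mulmxA mulmxK //.
rewrite mulmxK // mul_diag_mx; apply: eq_bigr => i _.
by rewrite !mxE eqxx mulr1n.
Qed.

Lemma simultaneous_eigenbasis r (h : 'I_r -> g) :
  (forall a, exists2 X : n.-tuple g, basis_of {: g} X &
     forall i : 'I_n, exists c, lie_br (h a) X`_i = c *: X`_i) ->
  (forall a b, lie_br (h a) (h b) = 0) ->
  exists2 X : n.-tuple g, basis_of {: g} X &
     forall (i : 'I_n) a, exists c, lie_br (h a) X`_i = c *: X`_i.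
Proof.
move=> hD hC.
have [cd _] := codiagonalizableP [seq adm (h a) | a <- enum 'I_r].
case: cd => [|P Pu /allP PA].
  split=> [_ _ /mapP[a _ ->] /mapP[b _ ->]|_ /mapP[a _ ->]].
    apply/eqP; rewrite -subr_eq0 -adm_br hC.
    by apply/eqP/matrixP => i j; rewrite !mxE lie_br0l linear0.
  have [X bX /boolp.choice[c cX]] := hD a; exists (basis_mx X); first exact: basis_mx_unit.
  apply/(diagonalizable_forPex); exists (\row_i c i); apply/simmxP.
    exact: basis_mx_unit.
  by apply/eigen_basis_mx => i; rewrite mxE.
have [X bX XP] := unit_basis_mx Pu; exists X => // i a.
have /PA/diagonalizable_forPex[d] : adm (h a) \in [seq adm (h a) | a <- enum 'I_r].
  by apply: map_f; rewrite mem_enum.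
by move=> /(simmxP Pu); rewrite -XP => /eigen_basis_mx/(_ i) ->; exists (d 0 i).
Qed.

End LieBasics.
Lemma coord_eigen (K : fieldType) (g : lieAlgebra K) (X : (\dim {: g}).-tuple g) h
    (d : 'I_(\dim {: g}) -> K) x j : basis_of {: g} X ->
  (forall i : 'I_(\dim {: g}), lie_br h X`_i = d i *: X`_i) ->
  coord X j (lie_br h x) = d j * coord X j x.
Proof.
move=> bX dX; rewrite {1}(coord_basis bX (memvf x)) linear_sum.
rewrite (eq_bigr (fun i => (coord X i x * d i) *: X`_i)).
  by rewrite coord_sum_free ?(basis_free bX) // mulrC.
by move=> i _; rewrite linearZ /= dX scalerA.
Qed.

Lemma coord_neq0 (K : fieldType) (vT : vectType K) (X : (\dim {: vT}).-tuple vT) x :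
  basis_of {: vT} X -> x <> 0 -> exists j, coord X j x != 0.
Proof.
move=> bX x0; apply: contrapT => /forallNP xj; apply: x0.
rewrite (coord_basis bX (memvf x)) big1 // => j _.
by have /negP := xj j; rewrite negbK => /eqP ->; rewrite scale0r.
Qed.

Lemma realC_inj (R : realType) : injective (fun x : R => x%:C%C).
Proof. by move=> x y []. Qed.

(** * The bilinear form on coordinate vectors *)

Section Pairing.
Variables (R : realType) (r : nat) (g : lieAlgebra R[i]) (alpha : 'I_r -> g).
Implicit Types x y z : 'rV[R]_r.

Local Notation "<| x , y |>" := (pairing alpha x y).

Lemma gram_sym a b : gram alpha a b = gram alpha b a.
Proof. by rewrite !mxE killingC. Qed.

Lemma pairingC x y : <|x, y|> = <|y, x|>.
Proof.
rewrite /pairing exchange_big; apply: eq_bigr => a _; apply: eq_bigr => b _.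
by rewrite gram_sym mulrAC mulrC mulrA [RHS]mulrAC mulrAC mulrC mulrA.
Qed.

Lemma pairing_linear z c x y : <|z, c *: x + y|> = c * <|z, x|> + <|z, y|>.
Proof.
rewrite /pairing mulr_sumr -big_split; apply: eq_bigr => a _ /=.
rewrite mulr_sumr -big_split; apply: eq_bigr => b _ /=.
by rewrite !mxE mulrDr !mulrA [c * _ * _ * _]mulrC !mulrA; congr (_ + _); ring.
Qed.

HB.instance Definition _ z :=
  GRing.isLinear.Build R 'rV[R]_r R *%R (pairing alpha z)
    (fun c x y => pairing_linear z c x y).

Lemma pairingDl x y z : <|x + y, z|> = <|x, z|> + <|y, z|>.
Proof. by rewrite !(pairingC _ z) linearD. Qed.

Lemma pairingZl c x z : <|c *: x, z|> = c * <|x, z|>.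
Proof. by rewrite !(pairingC _ z) linearZ. Qed.

Lemma pairingNl x z : <|- x, z|> = - <|x, z|>.
Proof. by rewrite !(pairingC _ z) linearN. Qed.

Lemma pairingBl x y z : <|x - y, z|> = <|x, z|> - <|y, z|>.
Proof. by rewrite pairingDl pairingNl. Qed.

Lemma pairing0l z : <|0, z|> = 0.
Proof. by rewrite pairingC linear0. Qed.

Lemma pairing_suml I (s : seq I) (P : pred I) (F : I -> 'rV[R]_r) z :
  <|\sum_(i <- s | P i) F i, z|> = \sum_(i <- s | P i) <|F i, z|>.
Proof. by rewrite pairingC linear_sum; apply: eq_bigr => i _; rewrite pairingC. Qed.

Lemma pairing_deltar x a : <|x, delta_mx 0 a|> = (x *m gram alpha) 0 a.
Proof.
rewrite mxE; apply: eq_bigr => b _; rewrite (bigD1 a) //= !mxE !eqxx mulr1.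
by rewrite big1 ?addr0 // => c /negPf ca; rewrite !mxE ca andbF mulr0.
Qed.

Lemma cvec_linear c x y : cvec alpha (c *: x + y) = c%:C%C *: cvec alpha x + cvec alpha y.
Proof.
rewrite /cvec scaler_sumr -big_split; apply: eq_bigr => a _ /=.
by rewrite !mxE rmorphD rmorphM /= scalerDl scalerA.
Qed.

Lemma cvec0 : cvec alpha 0 = 0.
Proof. by rewrite /cvec big1 // => a _; rewrite mxE scale0r. Qed.

Lemma cvecZ c x : cvec alpha (c *: x) = c%:C%C *: cvec alpha x.
Proof. by rewrite -[c *: x]addr0 cvec_linear cvec0 addr0. Qed.

Lemma cvecN x : cvec alpha (- x) = - cvec alpha x.
Proof. by rewrite -scaleN1r cvecZ rmorphN1 scaleN1r. Qed.

Lemma cvec_delta a : cvec alpha (delta_mx 0 a) = alpha a.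
Proof.
rewrite /cvec (bigD1 a) //= mxE !eqxx scale1r big1 ?addr0 // => b /negPf ba.
by rewrite mxE ba andbF scale0r.
Qed.

End Pairing.

(** * Root space decomposition *)

Section RootBasis.
Variables (R : realType) (r : nat) (g : lieAlgebra R[i]) (gR hR : set g).
Variable alpha : 'I_r -> g.
Hypothesis simple_g : is_simple g.
Hypothesis split_g : split_real_form gR hR.
Hypothesis simple_alpha : simple_roots alpha hR.
Hypothesis r_gt0 : exists x : 'rV[R]_r, x <> 0.

Local Notation "<| x , y |>" := (pairing alpha x y).
Local Notation n := (\dim {: g}).
Local Notation cv := (cvec alpha).

Lemma hR_cvec y : hR (cv y). Proof. by case: simple_alpha. Qed.
Lemma hR_alpha a : hR (alpha a). Proof. by rewrite -cvec_delta; exact: hR_cvec. Qed.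
Lemma cvec_inj : injective cv.
Proof.
move=> x y xy; have [_ u _ _] := simple_alpha.
have [z [_ zu]] := u _ (hR_cvec x); rewrite -(zu x erefl).
exact: zu.
Qed.

Lemma real_eigenbasis h : hR h -> exists2 X : n.-tuple g, basis_of {: g} X &
  exists c : 'I_n -> R, forall i : 'I_n, lie_br h X`_i = (c i)%:C%C *: X`_i.
Proof.
case: split_g => _ _ sp /sp[X [bX _ /boolp.choice[c cX]]].
by exists X => //; exists (fun i : 'I_n => c i).
Qed.

Lemma real_eigenvalue h x k : hR h -> x <> 0 -> lie_br h x = k *: x ->
  exists c : R, k = c%:C%C.
Proof.
move=> /real_eigenbasis[X bX [c cX]] x0 hx.
have [j xj] := coord_neq0 bX x0.
exists (c j); apply: (mulIf xj); rewrite -(coord_eigen _ _ bX cX) hx.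
by rewrite [RHS]linearZ.
Qed.

(** Nilpotency gives (ad h)^p k = 0. In an eigenbasis of ad h each coordinate x of k satisfies c^p x
    = 0, hence already c x = 0. *)
Lemma hR_abelian h k : hR h -> hR k -> lie_br h k = 0.
Proof.
move=> hh hk; have [X bX [c cX]] := real_eigenbasis hh.
case: split_g => _ [_ _ [p nil] _] _.
have nilX : foldr (@lie_br _ g) k (nseq p h) = 0.
  by apply: nil; rewrite ?size_nseq // => y /nseqP[->].
rewrite (coord_basis bX (memvf (lie_br h k))) big1 // => j _.
rewrite (coord_eigen _ _ bX cX).
have -> : (c j)%:C%C * coord X j k = 0; last by rewrite scale0r.
have := congr1 (coord X j) nilX; rewrite linear0.
have -> : coord X j (foldr (@lie_br _ g) k (nseq p h)) = (c j)%:C%C ^+ p * coord X j k.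
  elim: (p) => [|q IH]; first by rewrite expr0 mul1r.
  by rewrite /= (coord_eigen _ _ bX cX) IH exprS mulrA.
move/eqP; rewrite mulf_eq0 expf_eq0 => /orP[/andP[_ /eqP ->]|/eqP ->].
  by rewrite mul0r.
by rewrite mulr0.
Qed.

Definition cvecC (c : 'rV[R[i]]_r) : g := \sum_a c 0 a *: alpha a.

(* A Cartan subalgebra is its own centralizer. *)
Lemma zero_weight_cvecC x : (forall a, lie_br (alpha a) x = 0) ->
  exists c, x = cvecC c.
Proof.
move=> ax; case: split_g => -[[g0 glin gbr] gC] [hg [h0 hlin hbr] _ self] _.
have [_ surj _ _] := simple_alpha.
(* Split x into real and imaginary parts with respect to [gR]: brackets with the real elements alpha
   a respect the splitting, so both parts centralize [hR]. *)
have [[p q] [[/= gp gq xE] _]] := gC x.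
have zero u v : gR u -> gR v -> u + 'i%C *: v = 0 -> u = 0 /\ v = 0.
  move=> gu gv uv0; have [z [_ zu]] := gC 0.
  have e1 : z = (u, v) by apply: zu; split.
  have e2 : z = (0, 0) by apply: zu; split=> //=; rewrite scaler0 addr0.
  by move: e1; rewrite e2 => -[<- <-].
have br0 a : lie_br (alpha a) p = 0 /\ lie_br (alpha a) q = 0.
  apply: zero; [exact: gbr (hg _ (hR_alpha a)) gp|exact: gbr (hg _ (hR_alpha a)) gq|].
  by rewrite -(ax a) xE linearD /= linearZ.
have inh u : gR u -> (forall a, lie_br (alpha a) u = 0) -> exists y, u = cv y.
  move=> gu au0; suff /surj[y [-> _]] : hR u by exists y.
  apply: self => // h /surj[y [-> _]].
  rewrite lie_brN /cvec lie_br_suml big1 ?oppr0 // => a _.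
  by rewrite lie_brZl au0 scaler0.
have [y py] := inh p gp (fun a => (br0 a).1).
have [z qz] := inh q gq (fun a => (br0 a).2).
exists (\row_a ((y 0 a)%:C%C + 'i%C * (z 0 a)%:C%C)).
rewrite xE py qz /cvecC /cvec scaler_sumr -big_split; apply: eq_bigr => a _ /=.
by rewrite mxE scalerDl scalerA.
Qed.

Lemma center_trivial (x : g) : (forall y : g, lie_br x y = 0) -> x = 0.
Proof.
move=> x0.
have [||U UP] := @vspace_comprehension _ g (fun z => forall y : g, lie_br z y = 0).
- exact: lie_br0l.
- by move=> a u v hu hv y; rewrite lie_linearl hu hv scaler0 addr0.
have [[u [v uv]] simpl] := simple_g.
have [y z /UP zU|U0|UF] := simpl U.
- apply/UP => w; rewrite lie_brN (lie_brN y z) zU oppr0 linear0 oppr0 //.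
- have : x \in U by apply/UP.
  by rewrite U0 memv0 => /eqP.
- by case: uv; have /UP : u \in U by rewrite UF memvf.
Qed.

Lemma common_eigenbasis : exists X : n.-tuple g, basis_of {: g} X /\
  exists phi : 'M[R]_(n, r), forall (i : 'I_n) a, lie_br (alpha a) X`_i = (phi i a)%:C%C *: X`_i.
Proof.
have [a||X bX XE] := @simultaneous_eigenbasis _ g r alpha.
- have [X bX [c cX]] := real_eigenbasis (hR_alpha a); exists X => // i.
  by exists (c i)%:C%C.
- by move=> a b; apply: hR_abelian; exact: hR_alpha.
exists X; split => //.
have phiE (i : 'I_n) a : exists c : R, lie_br (alpha a) X`_i = c%:C%C *: X`_i.
  have [k kE] := XE i a; have [|c kc] := real_eigenvalue (hR_alpha a) _ kE.
    by apply/eqP/(basis_not0 bX)/mem_nth; rewrite size_tuple.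
  by exists c; rewrite -kc.

exists (\matrix_(i, a) projT1 (boolp.choice (phiE i)) a) => i a.
by rewrite mxE; case: (boolp.choice _).
Qed.

(** [phi] collects the real eigenvalues of the ad (alpha a) in a common eigenbasis. This yields at
    once that the Killing form is real on [hR] and that it is a sum of squares there. *)
Lemma pairing_sqr : exists phi : 'M[R]_(n, r),
  (forall x y, killing (cv x) (cv y) = (<|x, y|>)%:C%C) /\
  (forall x y, <|x, y|> = \sum_i (phi *m x^T) i 0 * (phi *m y^T) i 0) /\
  exists2 X : n.-tuple g, basis_of {: g} X &
    forall x (i : 'I_n), lie_br (cv x) X`_i = ((phi *m x^T) i 0)%:C%C *: X`_i.
Proof.
have [X [bX [phi phiE]]] := common_eigenbasis; exists phi.
have kE a b : killing (alpha a) (alpha b) = (\sum_i phi i a * phi i b)%:C%C.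
  rewrite (@killing_eigen _ _ X _ _ (\row_i (phi i a)%:C%C) (\row_i (phi i b)%:C%C)) //.
  - by rewrite raddf_sum /=; apply: eq_bigr => i _; rewrite !mxE rmorphM.
  - by move=> i; rewrite mxE phiE.
  - by move=> i; rewrite mxE phiE.
have gE a b : gram alpha a b = \sum_i phi i a * phi i b by rewrite mxE kE.
split=> [x y|].
  rewrite killing_suml /pairing raddf_sum /=; apply: eq_bigr => a _.
  rewrite killingZl linear_sum raddf_sum mulr_sumr; apply: eq_bigr => b _.
  by rewrite linearZ /= kE -gE !rmorphM mulrA mulrAC.
split=> [x y|].
  rewrite /pairing; under eq_bigr do under eq_bigr do rewrite gE.
  under [RHS]eq_bigr do rewrite !mxE big_distrlr /=.
  rewrite [RHS]exchange_big; apply: eq_bigr => a _.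
  rewrite [RHS]exchange_big; apply: eq_bigr => b _.
  rewrite mulr_sumr mulr_suml; apply: eq_bigr => i _.
  by rewrite !mxE; ring.
exists X => // x i; rewrite lie_br_suml mxE rmorph_sum scaler_suml.
by apply: eq_bigr => a _; rewrite lie_brZl phiE scalerA -rmorphM !mxE mulrC.
Qed.

Lemma killing_cvec x y : killing (cv x) (cv y) = (<|x, y|>)%:C%C.
Proof. by have [phi []] := pairing_sqr. Qed.

Lemma pairing_ge0 x : 0 <= <|x, x|>.
Proof.
by have [phi [_ [-> _]]] := pairing_sqr; apply: sumr_ge0 => i _; exact: sqr_ge0.
Qed.

(** A vanishing sum of squares makes all eigenvalues of ad x vanish, so x is central, and the centre
    of a simple algebra is 0. *)
Lemma pairing_eq0 x : <|x, x|> = 0 -> x = 0.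
Proof.
have [phi [_ [-> [X bX XE]]]] := pairing_sqr => /eqP.
rewrite psumr_eq0 => [/allP x0|i _]; last exact: sqr_ge0.
apply: cvec_inj; rewrite cvec0; apply: center_trivial => y.
rewrite (coord_basis bX (memvf y)) linear_sum big1 // => i _.
rewrite linearZ /= XE; have := x0 i (mem_index_enum i).
by rewrite mulf_eq0 orbb => /eqP ->; rewrite scale0r scaler0.
Qed.

Lemma pairing_gt0 x : x <> 0 -> 0 < <|x, x|>.
Proof.
by move=> x0; rewrite lt0r pairing_ge0 andbT; apply/eqP => /pairing_eq0.
Qed.

Lemma pairing_inj x y : (forall z, <|x, z|> = <|y, z|>) -> x = y.
Proof.
move=> xy; apply/eqP; rewrite -subr_eq0; apply/eqP/pairing_eq0.
by rewrite pairingBl xy subrr.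
Qed.

Lemma gram_unit : gram alpha \in unitmx.
Proof.
rewrite -row_free_unit -kermx_eq0; apply/eqP/row_matrixP => i; rewrite row0.
apply: pairing_inj => z; rewrite pairing0l (row_sum_delta z) linear_sum.
rewrite big1 // => a _; rewrite linearZ /= pairing_deltar.
have /sub_kermxP -> : (row i (kermx (gram alpha)) <= kermx (gram alpha))%MS by exact: row_sub.
by rewrite mxE mulr0.
Qed.

Lemma pairing_repr (f : 'rV[R]_r) : exists y, forall a, <|y, delta_mx 0 a|> = f 0 a.
Proof.
by exists (f *m invmx (gram alpha)) => a; rewrite pairing_deltar mulmxKV ?gram_unit.
Qed.

Lemma root_vectorP (beta : 'rV[R]_r) (u : g) :
  (forall a, lie_br (alpha a) u = (<|beta, delta_mx 0 a|>)%:C%C *: u) <->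
  root_vector alpha beta u.
Proof.
split=> [au y|bu a]; last by rewrite -cvec_delta bu killing_cvec.
rewrite killing_cvec lie_br_suml {2}(row_sum_delta y) linear_sum rmorph_sum scaler_suml /=.
by apply: eq_bigr => a _; rewrite lie_brZl au scalerA linearZ rmorphM.
Qed.

(** The radical is an ideal by invariance. It cannot be all of g, since the form is positive on a
    nonzero element of [hR]; positive rank enters here. *)
Lemma killing_nondeg (x : g) : (forall y, killing x y = 0) -> x = 0.
Proof.
move=> x0.
have [||U UP] := @vspace_comprehension _ g (fun z => forall y : g, killing z y = 0).
- by move=> y; rewrite killingC linear0.
- by move=> a u v hu hv y; rewrite killing_linearl hu hv mulr0 addr0.
have [_ simpl] := simple_g.
have [y z /UP zU|U0|UF] := simpl U.
- by apply/UP => w; rewrite lie_brN killingC linearN /= killingC killing_inv zU oppr0.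
- have : x \in U by apply/UP.
  by rewrite U0 memv0 => /eqP.
- have [y y0] := r_gt0; case: y0; apply: pairing_eq0; apply: (@realC_inj R).
  by rewrite -killing_cvec; have /UP -> : cv y \in U by rewrite UF memvf.
Qed.

Lemma killing_inj (x y : g) : (forall z, killing x z = killing y z) -> x = y.
Proof.
move=> xy; apply/eqP; rewrite -subr_eq0; apply/eqP/killing_nondeg => z.
by rewrite killingC linearB /= !(killingC z) xy subrr.
Qed.

(** A decidable condition on coordinates alone, without being a root; [root_cases] gives the
    trichotomy for weights of g. *)
Definition positive (beta : 'rV[R]_r) : bool :=
  (beta != 0) && [forall a, 0 <= beta 0 a].

Lemma positiveP (beta : 'rV[R]_r) : reflect (beta <> 0 /\ forall a, 0 <= beta 0 a) (positive beta).
Proof.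
by apply: (iffP andP) => -[/eqP b0 /forallP].
Qed.

Lemma root_cases beta u : root_vector alpha beta u -> u <> 0 ->
  [\/ beta = 0, positive beta | positive (- beta)].
Proof.
move=> bu u0; have [->|/eqP b0] := eqVneq beta 0; first by constructor 1.
have [_ _ _ /(_ beta)[|k [kE|kE]]] := simple_alpha.
- by split=> //; exists u.
- by constructor 2; apply/positiveP; split=> // a; rewrite kE ler0n.
- constructor 3; apply/positiveP; split=> [/eqP|a]; first by rewrite oppr_eq0 => /eqP.
  by rewrite mxE kE opprK ler0n.
Qed.

Lemma positive_asym (beta : 'rV[R]_r) : positive beta -> positive (- beta) = false.
Proof.
move=> /positiveP[b0 bge]; apply/positiveP => -[_ ble]; apply: b0; apply/rowP => a; apply/eqP.
by rewrite mxE eq_le bge andbT -oppr_ge0; have := ble a; rewrite mxE.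
Qed.

Lemma root_vector_br beta gamma u v :
  root_vector alpha beta u -> root_vector alpha gamma v ->
  root_vector alpha (beta + gamma) (lie_br u v).
Proof.
move=> bu gv y; rewrite lie_br_der bu gv lie_brZl linearZ -scalerDl.
by rewrite !killing_cvec -rmorphD -pairingDl.
Qed.

Lemma root_vector_linear beta c u v :
  root_vector alpha beta u -> root_vector alpha beta v ->
  root_vector alpha beta (c *: u + v).
Proof.
by move=> bu bv y; rewrite linearP /= bu bv scalerDr !scalerA mulrC.
Qed.

Lemma root_vector_cvec y : root_vector alpha 0 (cv y).
Proof.
move=> z; rewrite cvec0 killingC linear0 scale0r; apply: hR_abelian; exact: hR_cvec.
Qed.

Lemma root_vector0 u : root_vector alpha 0 u -> exists c, u = cvecC c.
Proof.
move=> u0; apply: zero_weight_cvecC => a; rewrite -cvec_delta u0.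
by rewrite cvec0 killingC linear0 scale0r.
Qed.

(** Invariance under d = beta + gamma multiplies killing u v by (d, d), which is nonzero. *)
Lemma killing_orth beta gamma u v :
  root_vector alpha beta u -> root_vector alpha gamma v ->
  beta + gamma <> 0 -> killing u v = 0.
Proof.
move=> bu gv /pairing_gt0 /lt0r_neq0; set d := beta + gamma => d0.
have : killing (lie_br (cv d) u) v + killing u (lie_br (cv d) v) = 0.
  by rewrite lie_brN killingNl killing_inv addNr.
rewrite bu gv killingZl linearZ /= -mulrDl !killing_cvec -rmorphD -pairingDl.
rewrite -/d => /eqP; rewrite mulf_eq0 => /orP[/eqP/realC_inj/eqP|/eqP //].
by rewrite (negPf d0).
Qed.

(** Killing-dual bases of g made of weight vectors. The weights [w i] may repeat and may be 0, so
    the Cartan directions are among the [X i]. *)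
Definition root_basis (X Y : 'I_n -> g) (w : 'I_n -> 'rV[R]_r) : Prop :=
  [/\ forall i j, killing (X i) (Y j) = (i == j)%:R,
      forall x, x = \sum_i killing x (Y i) *: X i,
      forall x, x = \sum_i killing x (X i) *: Y i,
      forall i, root_vector alpha (w i) (X i)
    & forall i, root_vector alpha (- w i) (Y i)].

(** [X] is a common eigenbasis and [w] represents its eigenvalues through the pairing. [Y] comes
    from the inverse Gram matrix of [X], and duality with invariance forces the weight of [Y i] to
    be - w i. *)
Lemma root_basis_exists : exists X Y w, root_basis X Y w.
Proof.
have [X [bX [phi phiE]]] := common_eigenbasis.
have /boolp.choice[w wE] (i : 'I_n) : exists y, forall a, <|y, delta_mx 0 a|> = phi i a.
  by have [y yE] := pairing_repr (row i phi); exists y => a; rewrite yE mxE.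
pose x_ (i : 'I_n) := X`_i.
have xw i : root_vector alpha (w i) (x_ i).
  by apply/root_vectorP => a; rewrite wE phiE.
pose G : 'M[R[i]]_n := \matrix_(i, j) killing (x_ i) (x_ j).
have Gu : G \in unitmx.
  rewrite -row_free_unit -kermx_eq0; apply/eqP/row_matrixP => i; rewrite row0.
  set c := row i _; have cG : c *m G = 0.
    by apply/sub_kermxP; exact: row_sub.
  have cX0 : \sum_i c 0 i *: x_ i = 0.
    apply: killing_nondeg => y; rewrite (coord_basis bX (memvf y)) linear_sum.
    apply: big1 => j _; rewrite linearZ /= killing_suml.
    have /rowP/(_ j) := cG; rewrite !mxE => cG0.
    rewrite (eq_bigr (fun k => c 0 k * G k j)) ?cG0 ?mulr0 // => k _.
    by rewrite killingZl [G k j]mxE.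
  apply/rowP => j; rewrite [RHS]mxE -(linear0 (coord X j)) -cX0.
  by symmetry; exact: (coord_sum_free (c 0) j (basis_free bX)).
pose y_ j := \sum_k invmx G k j *: x_ k.
have xy i j : killing (x_ i) (y_ j) = (i == j)%:R.
  have /matrixP/(_ i j) := mulmxV Gu; rewrite !mxE => <-; rewrite linear_sum.
  by apply: eq_bigr => k _; rewrite linearZ /= mxE mulrC.
have e1 x : x = \sum_i killing x (y_ i) *: x_ i.
  rewrite {1}(coord_basis bX (memvf x)); apply: eq_bigr => i _; congr (_ *: _).
  rewrite [in RHS](coord_basis bX (memvf x)) killing_suml (bigD1 i) //= big1 ?addr0.
    by rewrite killingZl xy eqxx mulr1.
  by move=> j /negPf ji; rewrite killingZl xy ji mulr0.
have e2 x : x = \sum_i killing x (x_ i) *: y_ i.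
  apply: killing_inj => z; rewrite {1}(e1 z) linear_sum killing_suml.
  by apply: eq_bigr => i _; rewrite linearZ /= killingZl mulrC (killingC z).
exists x_, y_, w; split=> // i; apply/root_vectorP => a.
have yx j : killing (lie_br (alpha a) (y_ i)) (x_ j)
    = - (<|w j, delta_mx 0 a|>)%:C%C * (j == i)%:R.
  rewrite lie_brN killingNl killing_inv -(cvec_delta alpha) xw linearZ /= killing_cvec.
  by rewrite killingC xy mulNr.
rewrite [LHS]e2 (bigD1 i) //= big1 ?addr0.
  by rewrite yx eqxx mulr1 pairingNl rmorphN.
by move=> j /negPf ji; rewrite yx ji mulr0 scale0r.
Qed.

(** The difference of the two sides has weight 0, is orthogonal to the Cartan subalgebra by
    invariance and to the other weight vectors by [killing_orth]; nondegeneracy concludes. *)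
Lemma lie_br_opp beta u v : root_vector alpha beta u -> root_vector alpha (- beta) v ->
  lie_br u v = killing u v *: cv beta.
Proof.
move=> bu bv; have [X [Y [w [_ e1 _ xw _]]]] := root_basis_exists.
apply/eqP; rewrite -subr_eq0; apply/eqP; set z := _ - _.
have z0 : root_vector alpha 0 z.
  rewrite /z addrC -scaleNr; apply: root_vector_linear; first exact: root_vector_cvec.
  by rewrite -(subrr beta); exact: root_vector_br.
have za a : killing z (alpha a) = 0.
  rewrite /z killingC linearB linearZ /= !(killingC (alpha a)) killing_inv.
  rewrite -(cvec_delta alpha a) lie_brN bv linearN linearZ /= !killing_cvec pairingNl.
  by rewrite rmorphN mulNr opprK mulrC subrr.
apply: killing_nondeg => y; rewrite (e1 y) linear_sum; apply: big1 => i _.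
rewrite linearZ /=; have [wi0|/eqP wi0] := eqVneq (w i) 0.
  have [|c ->] := @root_vector0 (X i); first by rewrite -wi0.
  rewrite linear_sum big1 ?mulr0 // => a _; by rewrite linearZ /= za mulr0.
by rewrite (killing_orth z0 (xw i)) ?mulr0 // add0r.
Qed.

(** Some [X i] pairs nontrivially with u, and orthogonality forces its weight to be - beta. With the
    normalization killing u v = 1 the bracket [u, v] is beta itself rather than the coroot. *)
Lemma root_partner beta u : root_vector alpha beta u -> u <> 0 ->
  exists2 v, root_vector alpha (- beta) v & killing u v = 1.
Proof.
move=> bu u0; have [X [Y [w [_ e1 _ xw _]]]] := root_basis_exists.
have [i ui] : exists i, killing u (X i) != 0.
  apply: contrapT => /forallNP ui; apply: u0; apply: killing_nondeg => y.
  rewrite (e1 y) linear_sum; apply: big1 => i _; rewrite linearZ /=.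
  by have /negP := ui i; rewrite negbK => /eqP ->; rewrite mulr0.
have wi : w i = - beta.
  apply/eqP; rewrite -subr_eq0 opprK addrC; apply/eqP; apply: contrapT.
  by move/(killing_orth bu (xw i))/eqP; rewrite (negPf ui).
exists ((killing u (X i))^-1 *: X i); last by rewrite linearZ /= mulVf.
rewrite -[_ *: _]addr0 -wi; apply: root_vector_linear => // y.
by rewrite linear0 scaler0.
Qed.

(** * Nonnegativity of 2 rho on the simple roots *)

Section RhoPositivity.
Variables (X Y : 'I_n -> g) (w : 'I_n -> 'rV[R]_r).
Hypothesis XY : root_basis X Y w.

Lemma root_basis_neq0 i : X i <> 0.
Proof.
case: XY => xy _ _ _ _ Xi0; have /eqP := xy i i.
by rewrite Xi0 killingC linear0 eqxx eq_sym oner_eq0.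
Qed.

(** The positive weight vectors whose weight involves a simple root other than alpha_a span a space
    stable under the root vectors u and v of alpha_a and - alpha_a. There alpha_a = [u, v] has trace
    0, so these weights contribute nothing; the remaining ones are nonnegative multiples of
    alpha_a. *)
Lemma rho_simple a : 0 <= \sum_(i | positive (w i)) <|w i, delta_mx 0 a|>.
Proof.
have [xy e1 _ xw yw] := XY; have [_ _ /(_ a)[ea0 [u u0 ua]] _] := simple_alpha.
have [v va uv1] := root_partner ua u0.
(* Adding or subtracting alpha_a leaves the coordinates away from a unchanged, so a weight in [I]
   keeps a positive coordinate and, by the trichotomy, stays positive. *)
pose I := [pred i | positive (w i) && [exists b, (b != a) && (0 < w i 0 b)]].
pose E z i j := killing (lie_br z (X i)) (Y j).
have EI z s i j : root_vector alpha s z -> (forall b, b != a -> s 0 b = 0) ->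
    i \in I -> j \notin I -> E z i j = 0.
  move=> zs s0 /andP[wi /existsP[b /andP[ba wib]]] jI.
  apply: (killing_orth (root_vector_br zs (xw i)) (yw j)) => /eqP.
  rewrite subr_eq0 => /eqP wj.
  have wjb : 0 < w j 0 b by rewrite -wj mxE s0 // add0r.
  move/negP: jI; apply; apply/andP; split; last by apply/existsP; exists b; rewrite ba.
  have [wj0|//|/positiveP[_ /(_ b)]] := root_cases (xw j) (@root_basis_neq0 j).
    by move: wjb; rewrite wj0 mxE ltxx.
  by rewrite mxE oppr_ge0 leNgt wjb.
have u_I i j : i \in I -> j \notin I -> E u i j = 0.
  by apply: EI ua _ => b /negPf ba; rewrite mxE eqxx ba.
have v_I i j : i \in I -> j \notin I -> E v i j = 0.
  by apply: EI va _ => b /negPf ba; rewrite !mxE eqxx ba oppr0.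
have brE z z' i : killing (lie_br z (lie_br z' (X i))) (Y i) = \sum_j E z' i j * E z j i.
  rewrite (e1 (lie_br z' (X i))) linear_sum killing_suml; apply: eq_bigr => j _.
  by rewrite linearZ /= killingZl.
(* Diagonal entries of the commutator of ad u and ad v. Summed over the stable set [I], the two
   double sums cancel. *)
have wE i : (<|w i, delta_mx 0 a|>)%:C%C = \sum_j E v i j * E u j i - \sum_j E u i j * E v j i.
  have uvX : lie_br u (lie_br v (X i)) = lie_br (alpha a) (X i) + lie_br v (lie_br u (X i)).
    by rewrite lie_br_der (lie_br_opp ua va) uv1 scale1r cvec_delta.
  rewrite -!brE uvX killingDl addrK -(cvec_delta alpha) xw killingZl xy eqxx mulr1.
  by rewrite killing_cvec.
rewrite (bigID [pred i | i \in I]) /=.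
have -> : \sum_(i | positive (w i) && (i \in I)) <|w i, delta_mx 0 a|> = 0.
  rewrite (eq_bigl (mem I)) => [|i]; last by rewrite !inE andbA andbb.
  apply: (@realC_inj R); rewrite rmorph_sum /= (eq_bigr _ (fun i _ => wE i)) sumrB.
  have IE F G : (forall i j, i \in I -> j \notin I -> F i j = 0 :> R[i]) ->
      \sum_(i in I) \sum_j F i j * G j i = \sum_(i in I) \sum_(j in I) F i j * G j i.
    move=> F0; apply: eq_bigr => i iI; rewrite (bigID [pred j | j \in I]) /=.
    by rewrite [X in _ + X]big1 ?addr0 // => j jI; rewrite F0 // mul0r.
  rewrite (IE (E v) (E u)) // (IE (E u) (E v)) // [X in _ - X]exchange_big /=.
  apply/eqP; rewrite subr_eq0; apply/eqP; apply: eq_bigr => i _.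
  by apply: eq_bigr => j _; rewrite mulrC.
rewrite add0r; apply: sumr_ge0 => i /andP[wi]; rewrite inE wi /= negb_exists.
move=> /forallP w0.
have -> : w i = w i 0 a *: delta_mx 0 a.
  apply/rowP => b; rewrite !mxE eqxx /=; have [->|ba] := eqVneq b a; first by rewrite mulr1.
  have := w0 b; rewrite ba /= -leNgt mulr0 => wb; apply/eqP; rewrite eq_le wb.
  by case/positiveP: wi => _ ->.
rewrite pairingZl mulr_ge0 ?pairing_ge0 //.
by case/positiveP: wi.
Qed.

Lemma rho_ge0 (x : 'rV[R]_r) : (forall a, 0 <= x 0 a) -> 0 <= \sum_(i | positive (w i)) <|w i, x|>.
Proof.
move=> x0.
rewrite (eq_bigr (fun i => \sum_a x 0 a * <|w i, delta_mx 0 a|>)); last first.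
  move=> i _; rewrite {1}(row_sum_delta x) linear_sum; apply: eq_bigr => a _.
  by rewrite linearZ.
rewrite exchange_big; apply: sumr_ge0 => a _; rewrite -mulr_sumr.
by rewrite mulr_ge0 // rho_simple.
Qed.

End RhoPositivity.

Section Module.
Variable V : lieModule g.
Local Notation vec := 'cV[R[i]]_(mdim V).
Implicit Types (v : 'cV[R[i]]_(mdim V)) (S : {vspace 'cV[R[i]]_(mdim V)}).

HB.instance Definition _ := GRing.isLinear.Build R[i] g 'M[R[i]]_(mdim V) *:%R
  (mact V) (@mact_linear _ _ V).

Definition weight_vector (mu : 'rV[R]_r) v : Prop :=
  forall y, mact V (cv y) *m v = (<|mu, y|>)%:C%C *: v.

(** A highest weight vector. The raising condition ranges over every [positive] beta; where beta is
    not a root it only concerns u = 0 and is trivial, which [highest_weightP] uses to match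
    [has_highest_weight]. *)
Definition singular (lambda : 'rV[R]_r) v : Prop :=
  [/\ v <> 0, weight_vector lambda v
    & forall beta u, positive beta -> root_vector alpha beta u -> mact V u *m v = 0].

Lemma mact_comm x y v :
  mact V x *m (mact V y *m v) = mact V (lie_br x y) *m v + mact V y *m (mact V x *m v).
Proof. by rewrite mact_br mulmxBl !mulmxA subrK. Qed.

Lemma weight_vector_root mu beta u v : weight_vector mu v -> root_vector alpha beta u ->
  weight_vector (mu + beta) (mact V u *m v).
Proof.
move=> mv bu y; rewrite mact_comm bu mv killing_cvec linearZ /= -scalemxAl -scalemxAr.
by rewrite -scalerDl -rmorphD -pairingDl [mu + _]addrC.
Qed.

Lemma weight_vector_cvecC mu v c : weight_vector mu v ->
  mact V (cvecC c) *m v = killing (cv mu) (cvecC c) *: v.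
Proof.
move=> mv; rewrite /cvecC !linear_sum mulmx_suml scaler_suml; apply: eq_bigr => a _.
by rewrite !linearZ /= -scalemxAl -(cvec_delta alpha) mv killing_cvec scalerA.
Qed.

Lemma weight_vector_zero mu v z : weight_vector mu v -> root_vector alpha 0 z ->
  mact V z *m v = killing (cv mu) z *: v.
Proof. by move=> mv /root_vector0[c ->]; exact: weight_vector_cvecC. Qed.

(* The weights mu - k beta are eigenvalues of the coroot, so only finitely many
   of the vectors v^k x are nonzero. *)
Lemma lowering_nilpotent mu beta (v : g) x : beta <> 0 -> weight_vector mu x ->
  root_vector alpha (- beta) v ->
  exists k, iter k (fun u => mact V v *m u) x = 0.
Proof.
move=> b0 mx bv; apply: contrapT => /forallNP xk.
pose c k : R[i] := (<|mu, beta|> - k%:R * <|beta, beta|>)%:C%C.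
pose x_ k := iter k (fun u => mact V v *m u) x.
have wx k : weight_vector (mu - k%:R *: beta) (x_ k).
  elim: k => [|k IH]; first by rewrite scale0r subr0.
  rewrite -natr1 scalerDl scale1r opprD addrA; exact: weight_vector_root.
have c_inj : injective c.
  move=> k l /realC_inj/eqP; rewrite (inj_eq (addrI _)) eqr_opp.
  by rewrite (inj_eq (mulIf (lt0r_neq0 (pairing_gt0 b0)))) eqr_nat => /eqP.
pose p := char_poly (mact V (cv beta))^T.
have cp k : root p (c k).
  rewrite -eigenvalue_root_char; apply/eigenvalueP; exists (x_ k)^T.
    rewrite -trmx_mul wx linearZ /=; congr (_%:C%C *: _).
    by rewrite pairingBl pairingZl.
  by apply/eqP => /(congr1 trmx); rewrite trmxK trmx0; exact: xk.
have p0 : p != 0 by rewrite monic_neq0 // char_poly_monic.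
have := @max_poly_roots _ p [seq c k | k <- iota 0 (mdim V).+1] p0.
rewrite all_map map_inj_uniq // iota_uniq size_map size_iota size_char_poly ltnn.
by move=> le; suff : false by []; apply: le => //; apply/allP => k _; exact: cp.
Qed.

(** The sl2 computation on the string x, v x, v^2 x, ...: u maps v^(l+1) x to c (l+1) times v^l x.
    If v^k x is the last nonzero vector, then c (k+1) = 0, which is the claimed equality. *)
Lemma sl2_weight mu beta (u : g) x : beta <> 0 -> x <> 0 -> weight_vector mu x ->
  root_vector alpha beta u -> u <> 0 -> mact V u *m x = 0 ->
  exists k : nat, 2 * <|mu, beta|> / <|beta, beta|> = k%:R.
Proof.
move=> b0 x0 mx bu u0 ux; have [v bv uv1] := root_partner bu u0.
have bb0 : <|beta, beta|> != 0 by rewrite lt0r_neq0 // pairing_gt0.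
have hk : exists k, iter k (fun y => mact V v *m y) x == 0.
  by have [k /eqP kE] := lowering_nilpotent b0 mx bv; exists k.
case: (ex_minnP hk) => -[/eqP //|k] /eqP /= xk1 kmin.
pose x_ k := iter k (fun u => mact V v *m u) x.
have wx l : weight_vector (mu - l%:R *: beta) (x_ l).
  elim: l => [|l IH]; first by rewrite scale0r subr0.
  rewrite -natr1 scalerDl scale1r opprD addrA; exact: weight_vector_root.
(* Since [u, v] = beta, c l is the sum of (mu - i beta, beta) over i < l. *)
pose c l : R := l%:R * <|mu, beta|> - l%:R * (l%:R - 1) / 2 * <|beta, beta|>.
have ux_ l : mact V u *m x_ l.+1 = (c l.+1)%:C%C *: x_ l.
  elim: l => [|l IH].
    rewrite /x_ /= mact_comm ux mulmx0 addr0 (lie_br_opp bu bv) uv1 scale1r mx.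
    by congr (_%:C%C *: _); rewrite /c; field.
  rewrite /x_ -[iter l.+2 _ _]/(mact V v *m x_ l.+1) mact_comm IH.
  rewrite (lie_br_opp bu bv) uv1 scale1r wx -scalemxAr -scalerDl -rmorphD.
  congr (_%:C%C *: _); rewrite pairingBl pairingZl /c -[l.+2%:R]natr1 -[l.+1%:R]natr1.
  by field.
have : (c k.+1)%:C%C *: x_ k = 0 by rewrite -ux_ /x_ /= xk1 mulmx0.
move/eqP; rewrite scaler_eq0 => /orP[/eqP/realC_inj|xk0]; last first.
  by have := kmin k xk0; rewrite ltnn.
rewrite /c -natr1 addrK => /eqP; rewrite -mulrA -mulrA -mulrBr mulf_eq0 natr1 pnatr_eq0 /=.
rewrite subr_eq0 => /eqP ck; exists k; rewrite ck.
by rewrite mulrA; field.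
Qed.

(** * The Casimir element *)

Section Casimir.
Variables (X Y : 'I_n -> g) (w : 'I_n -> 'rV[R]_r).
Hypothesis XY : root_basis X Y w.

Definition casimir : 'M[R[i]]_(mdim V) := \sum_i mact V (X i) *m mact V (Y i).

(** By invariance the matrices of ad x in the dual bases [X] and [Y] are negative transposes of each
    other, so the two parts of the commutator cancel. *)
Lemma casimir_comm x : mact V x *m casimir = casimir *m mact V x.
Proof.
have [xy e1 e2 _ _] := XY.
apply/eqP; rewrite -subr_eq0 mulmx_sumr mulmx_suml -sumrB; apply/eqP.
pose a i j := killing (lie_br x (X i)) (Y j).
rewrite (eq_bigr (fun i => \sum_j a i j *: (mact V (X j) *m mact V (Y i))
   - \sum_j a j i *: (mact V (X i) *m mact V (Y j)))) => [|i _].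
  by rewrite sumrB [X in _ - X]exchange_big /= subrr.
have -> : \sum_j a i j *: (mact V (X j) *m mact V (Y i)) = mact V (lie_br x (X i)) *m mact V (Y i).
  rewrite {1}(e1 (lie_br x (X i))) linear_sum mulmx_suml; apply: eq_bigr => j _.
  by rewrite linearZ /= scalemxAl.
have -> : \sum_j a j i *: (mact V (X i) *m mact V (Y j)) = - (mact V (X i) *m mact V (lie_br x (Y i))).
  rewrite {1}(e2 (lie_br x (Y i))) linear_sum mulmx_sumr -sumrN; apply: eq_bigr => j _.
  rewrite linearZ /= -scalemxAr -scaleNr; congr (_ *: _).
  by rewrite /a lie_brN killingNl killing_inv killingC.
rewrite !mact_br mulmxBl mulmxBr opprK !mulmxA.
by rewrite addrA subrK.
Qed.

(** This is (lambda, lambda + 2 rho), with 2 rho the sum of the positive [w i] counted with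
    multiplicity. *)
Definition casimir_value lambda : R :=
  <|lambda, lambda|> + \sum_(i | positive (w i)) <|w i, lambda|>.

Lemma casimir_singular lambda v : singular lambda v ->
  casimir *m v = (casimir_value lambda)%:C%C *: v.
Proof.
move=> [v0 lv sv]; have [xy e1 e2 xw yw] := XY.
rewrite /casimir mulmx_suml /casimir_value rmorphD scalerDl /=.
(* Expand (lambda, lambda) in the dual bases. Only indices with w i = 0 contribute, and these are
   the Cartan part of the Casimir; a positive w i gives X Y v = [X, Y] v, and for a negative one Y
   kills v. *)
have <- : \sum_i killing (cv lambda) (X i) * killing (cv lambda) (Y i) = (<|lambda, lambda|>)%:C%C.
  rewrite -killing_cvec.
  transitivity (killing (\sum_i killing (cv lambda) (X i) *: Y i) (cv lambda)).
    by rewrite killing_suml; apply: eq_bigr => i _; rewrite killingZl (killingC (Y i)).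
  by rewrite -e2.
rewrite rmorph_sum !scaler_suml [X in _ = _ + X]big_mkcond -big_split; apply: eq_bigr => i _ /=.
have [wi0|wi|wi] := root_cases (xw i) (@root_basis_neq0 _ _ _ XY i).
- rewrite wi0 /positive eqxx /= addr0 -mulmxA.
  have x0 : root_vector alpha 0 (X i) by rewrite -wi0.
  have y0 : root_vector alpha 0 (Y i) by rewrite -oppr0 -wi0.
  by rewrite (weight_vector_zero lv y0) -scalemxAr (weight_vector_zero lv x0) scalerA mulrC.
- rewrite wi -mulmxA mact_comm (sv _ _ wi (xw i)) mulmx0 addr0.
  rewrite (lie_br_opp (xw i) (yw i)) xy eqxx scale1r lv pairingC.
  rewrite (killing_orth (root_vector_cvec lambda) (xw i)) ?mul0r ?scale0r ?add0r //.
  by case/positiveP: wi.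
- rewrite -mulmxA (sv _ _ wi (yw i)) mulmx0.
  have -> : positive (w i) = false by rewrite -[w i]opprK positive_asym.
  rewrite (killing_orth (root_vector_cvec lambda) (xw i)) ?mul0r ?scale0r ?add0r //.
  by move=> wi0; move: wi; rewrite wi0 oppr0 /positive eqxx.
Qed.

End Casimir.

End Module.

Section CasimirInjective.
Variables (X Y : 'I_n -> g) (w : 'I_n -> 'rV[R]_r).
Hypothesis XY : root_basis X Y w.

(** With d = lambda - mu the difference of the values is (lambda, d) + (mu, d) + (2 rho, d), three
    nonnegative terms. If it vanishes, so does (d, d) = (lambda, d) - (mu, d). *)
Lemma casimir_value_inj (lambda mu : 'rV[R]_r) :
  (forall a, 0 <= (lambda - mu) 0 a) ->
  (forall a, 0 <= <|lambda, delta_mx 0 a|>) -> (forall a, 0 <= <|mu, delta_mx 0 a|>) ->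
  casimir_value w lambda = casimir_value w mu -> lambda = mu.
Proof.
move=> lm l0 m0; have pos x : (forall a, 0 <= <|x, delta_mx 0 a|>) -> 0 <= <|x, lambda - mu|>.
  move=> x0; rewrite [lambda - mu]row_sum_delta linear_sum; apply: sumr_ge0 => a _.
  by rewrite linearZ /= mulr_ge0.
have rho : \sum_(i | positive (w i)) <|w i, lambda|> - \sum_(i | positive (w i)) <|w i, mu|>
    = \sum_(i | positive (w i)) <|w i, lambda - mu|>.
  by rewrite -sumrB; apply: eq_bigr => i _; rewrite linearB.
have sqr : <|lambda, lambda|> - <|mu, mu|> = <|lambda, lambda - mu|> + <|mu, lambda - mu|>.
  by rewrite !linearB /= (pairingC _ mu lambda) addrA subrK.
rewrite /casimir_value => eq_lm; have := rho_ge0 XY lm; have := pos _ l0; have := pos _ m0.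
move=> p1 p2 p3; apply/eqP; rewrite -subr_eq0; apply/eqP/pairing_eq0.
by rewrite pairingBl; lra.
Qed.

End CasimirInjective.

(** * Modules generated by a highest weight vector *)

Section WeightModules.
Variable V : lieModule g.
Implicit Types (v : 'cV[R[i]]_(mdim V)) (S : {vspace 'cV[R[i]]_(mdim V)}).

Definition stable S : Prop := forall x v, v \in S -> mact V x *m v \in S.

(** The columns of [P] are the basis and [Q] gives coordinates. The size d is kept apart from
    [mdim V], so the index types of sums and products of modules can be used directly. *)
Definition weight_basis d (w : 'I_d -> 'rV[R]_r) : Prop :=
  exists (P : 'M[R[i]]_(mdim V, d)) (Q : 'M[R[i]]_(d, mdim V)),
    [/\ P *m Q = 1%:M, Q *m P = 1%:M & forall i, weight_vector (w i) (col i P)].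

Lemma mulmx_lpreim p q (A : 'M[R[i]]_(p, q)) (S : {vspace 'cV[R[i]]_p}) :
  exists U : {vspace 'cV[R[i]]_q}, forall v : 'cV_q, (v \in U) = (A *m v \in S).
Proof.
exists (linfun (mulmx A) @^-1: S)%VS => v.
by rewrite -memv_preim lfunE.
Qed.

(** A basis is extracted from a spanning family of weight vectors as a full-rank set of rows. Since
    the selection [f] is injective, sums over the weights of the basis are bounded by sums over the
    family. *)
Lemma weight_basis_of_span k (L : 'I_k -> 'cV[R[i]]_(mdim V)) (wt : 'I_k -> 'rV[R]_r) :
  (forall j, weight_vector (wt j) (L j)) ->
  (forall S, (forall j, L j \in S) -> S = fullv) ->
  exists2 f : 'I_(mdim V) -> 'I_k, injective f & weight_basis (wt \o f).
Proof.
move=> Lw Lspan; pose A : 'M[R[i]]_(k, mdim V) := \matrix_(j, i) L j i 0.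
have LA j : L j = (row j A)^T by apply/colP => i; rewrite !mxE.
have fA : row_full A.
  rewrite -cokermx_eq0; apply/eqP/trmx_inj.
  have [U UE] := mulmx_lpreim (cokermx A)^T 0%VS.
  have UF : U = fullv.
    by apply: Lspan => j; rewrite UE memv0 LA -trmx_mul -row_mul mulmx_coker row0 trmx0.
  rewrite trmx0 -[LHS]mulmx1; apply/matrixP => i j.
  have := memvf (delta_mx j 0 : 'cV[R[i]]_(mdim V)); rewrite -UF UE memv0 -colE => /eqP.
  by move/colP/(_ i); rewrite mulmx1 !mxE.
have Bu := fullrowsub_unit fA; set f := fullrankfun fA in Bu.
exists f; first exact: fullrankfun_inj.
exists (rowsub f A)^T, (invmx (rowsub f A)^T); split.
- by rewrite mulmxV ?unitmx_tr.
- by rewrite mulVmx ?unitmx_tr.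
- move=> i; have -> : col i (rowsub f A)^T = L (f i) by apply/colP => l; rewrite !mxE.
  exact: Lw.
Qed.

Section Projections.
Variables (d : nat) (w : 'I_d -> 'rV[R]_r).
Variables (P : 'M[R[i]]_(mdim V, d)) (Q : 'M[R[i]]_(d, mdim V)).
Hypotheses (PQ : P *m Q = 1%:M) (QP : Q *m P = 1%:M).
Hypothesis Pw : forall i, weight_vector (w i) (col i P).

Lemma weight_basis_expand v : v = \sum_i (Q *m v) i 0 *: col i P.
Proof.
rewrite -[LHS]mul1mx -PQ -mulmxA; apply/colP => k; rewrite mxE summxE.
by apply: eq_bigr => i _; rewrite !mxE mulrC.
Qed.

Lemma weight_coord y v i : (Q *m (mact V (cv y) *m v)) i 0 = (<|w i, y|>)%:C%C * (Q *m v) i 0.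
Proof.
have mP : mact V (cv y) *m P = P *m diag_mx (\row_j (<|w j, y|>)%:C%C).
  apply/matrixP => k j; rewrite mul_mx_diag !mxE mulrC.
  have /colP/(_ k) := Pw j y; rewrite !mxE => <-.
  by apply: eq_bigr => l _; rewrite !mxE.
rewrite -[v in LHS]mul1mx -PQ !mulmxA -[Q *m _ *m P]mulmxA mP !mulmxA QP mul1mx -mulmxA.
by rewrite mul_diag_mx !mxE.
Qed.

Definition weight_proj mu : 'M[R[i]]_(mdim V) :=
  P *m diag_mx (\row_j (w j == mu)%:R) *m Q.

Lemma weight_proj_coord mu v i : (Q *m (weight_proj mu *m v)) i 0 = (w i == mu)%:R * (Q *m v) i 0.
Proof. by rewrite /weight_proj !mulmxA QP mul1mx -mulmxA mul_diag_mx !mxE. Qed.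

Lemma eq_coord u v : (forall i, (Q *m u) i 0 = (Q *m v) i 0) -> u = v.
Proof.
move=> uv; rewrite (weight_basis_expand u) (weight_basis_expand v).
by apply: eq_bigr => i _; rewrite uv.
Qed.

Lemma weight_vectorP mu v :
  weight_vector mu v <-> (forall i, w i != mu -> (Q *m v) i 0 = 0).
Proof.
split=> [mv i wi|v0 y]; last first.
  apply: eq_coord => i; rewrite weight_coord -scalemxAr [RHS]mxE.
  by have [->//|/v0 ->] := eqVneq (w i) mu; rewrite !mulr0.
apply/eqP/negPn/negP => q0; move/eqP: wi; apply; apply: pairing_inj => y.
have := weight_coord y v i; rewrite mv -scalemxAr [LHS]mxE => /(mulIf q0)/realC_inj.
by [].
Qed.

Lemma weight_proj_weight mu v : weight_vector mu (weight_proj mu *m v).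
Proof.
by apply/weight_vectorP => i /negPf wi; rewrite weight_proj_coord wi mul0r.
Qed.

Lemma weight_proj_id mu v : weight_vector mu v -> weight_proj mu *m v = v.
Proof.
move=> /weight_vectorP v0; apply: eq_coord => i; rewrite weight_proj_coord.
by have [_|/v0 ->] := eqVneq (w i) mu; rewrite ?mul1r ?mulr0.
Qed.

Lemma weight_proj0 mu nu v : weight_vector nu v -> nu != mu -> weight_proj mu *m v = 0.
Proof.
move=> /weight_vectorP v0 nm; apply: eq_coord => i; rewrite weight_proj_coord mulmx0 [RHS]mxE.
have [wi|_] := eqVneq (w i) mu; last by rewrite mul0r.
by rewrite v0 ?mulr0 // wi eq_sym.
Qed.

Lemma weight_proj_sum v : v = \sum_(mu <- undup (codom w)) weight_proj mu *m v.
Proof.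
apply: eq_coord => i; rewrite mulmx_sumr summxE.
have wi : w i \in undup (codom w) by rewrite mem_undup codom_f.
rewrite (bigD1_seq (w i) wi (undup_uniq _)).
rewrite big1 => [|mu /negPf wm] /=; last first.
  by rewrite (weight_proj_coord mu v i) eq_sym wm mul0r.
by rewrite (weight_proj_coord (w i) v i) eqxx mul1r addr0.
Qed.

(* The projection onto a weight space is a polynomial in the action of the
   Cartan subalgebra. *)
Lemma weight_proj_stable S mu v : stable S -> v \in S -> weight_proj mu *m v \in S.
Proof.
move=> stS vS.
(* A Lagrange factor: on weight x it acts by (x - nu, mu - nu) / (mu - nu, mu - nu), which is 0 at x
   = nu and 1 at x = mu. *)
pose op nu (x : 'cV[R[i]]_(mdim V)) := (<|mu - nu, mu - nu|>)%:C%C^-1 *: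
   (mact V (cv (mu - nu)) *m x - (<|nu, mu - nu|>)%:C%C *: x).
pose l := [seq nu <- codom w | nu != mu].
have <- : foldr op v l = weight_proj mu *m v; last first.
  elim: l => //= nu l IH; rewrite memvZ // memvB //; first exact: stS.
  exact: memvZ.
pose c i nu : R[i] := (<|mu - nu, mu - nu|>)%:C%C^-1 * (<|w i - nu, mu - nu|>)%:C%C.
have opE nu x i : (Q *m op nu x) i 0 = c i nu * (Q *m x) i 0.
  have mxB (a b : 'cV[R[i]]_d) k : (a - b) k 0 = a k 0 - b k 0 by rewrite !mxE.
  have mxZ e (a : 'cV[R[i]]_d) k : (e *: a) k 0 = e * a k 0 by rewrite !mxE.
  rewrite /op -scalemxAr mulmxBr -scalemxAr mxZ mxB weight_coord mxZ.
  by rewrite -mulrBl /c (pairingBl _ (w i)) rmorphB mulrA.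
have foldE i : (Q *m foldr op v l) i 0 = \prod_(nu <- l) c i nu * (Q *m v) i 0.
  elim: l => [|nu l IH]; first by rewrite big_nil mul1r.
  by rewrite /= opE IH big_cons mulrA.
apply: eq_coord => i; rewrite foldE weight_proj_coord; congr (_ * _).
have [wi|wi] := eqVneq (w i) mu.
  rewrite big_seq big1 // => nu; rewrite mem_filter => /andP[nm _].
  rewrite /c wi mulVf // -(rmorph0 (real_complex R)) (inj_eq (@realC_inj R)).
  by rewrite lt0r_neq0 // pairing_gt0 //; apply/eqP; rewrite subr_eq0 eq_sym.
apply/eqP; rewrite prodf_seq_eq0; apply/hasP; exists (w i).
  by rewrite mem_filter wi codom_f.
by rewrite /= /c subrr pairing0l mulr0.
Qed.

End Projections.

(** A nonzero vector of S is the sum of its weight projections, which stay in S, so one of them is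
    nonzero. *)
Lemma stable_weight_vector d (w : 'I_d -> 'rV[R]_r) S : weight_basis w -> stable S ->
  S <> 0%VS -> exists i x, [/\ x \in S, x <> 0 & weight_vector (w i) x].
Proof.
move=> [P [Q [PQ QP Pw]]] stS S0; pose x := vpick S.
have x0 : x != 0 by rewrite vpick0; apply/eqP.
apply: contrapT => /forallNP none; move/eqP: x0; apply.
rewrite (weight_proj_sum w PQ QP x) big_seq; apply: big1 => mu.
rewrite mem_undup => /codomP[i ->]; apply: contrapT => nz.
have := none i; move/forallNP/(_ (weight_proj w P Q (w i) *m x)); apply; split=> //.
  by apply: (weight_proj_stable PQ QP Pw) => //; exact: memv_pick.
exact: weight_proj_weight.
Qed.

Lemma weight_mem d (w : 'I_d -> 'rV[R]_r) mu v : weight_basis w -> v <> 0 ->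
  weight_vector mu v -> exists i, w i = mu.
Proof.
move=> [P [Q [PQ QP Pw]]] v0 mv; apply: contrapT => /forallNP wi; apply: v0.
rewrite (weight_basis_expand PQ v); apply: big1 => i _.
by have /(weight_vectorP PQ QP Pw)-> := mv; rewrite ?scale0r //; apply/eqP/wi.
Qed.

Definition height (x : 'rV[R]_r) : R := \sum_a x 0 a.

Lemma heightD (x y : 'rV[R]_r) : height (x + y) = height x + height y.
Proof. by rewrite /height -big_split; apply: eq_bigr => a _; rewrite mxE. Qed.

Lemma height_gt0 (x : 'rV[R]_r) : positive x -> 0 < height x.
Proof.
move=> /positiveP[x0 xge]; rewrite lt0r sumr_ge0 // andbT.
apply/eqP => /eqP; rewrite psumr_eq0 // => /allP xz; apply: x0; apply/rowP => a.
by rewrite mxE; apply/eqP; exact: xz (mem_index_enum a).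
Qed.

(** Among the weights occurring in S take one of maximal height: a positive root vector would
    produce a weight of larger height. *)
Lemma stable_singular d (w : 'I_d -> 'rV[R]_r) S : weight_basis w -> stable S ->
  S <> 0%VS -> exists i x, x \in S /\ singular (w i) x.
Proof.
move=> bw stS S0; have [i0 [x0 Hx0]] := stable_weight_vector bw stS S0.
pose good i := `[< exists x, [/\ x \in S, x <> 0 & weight_vector (w i) x] >].
have g0 : good i0 by apply/asboolP; exists x0.
case: (arg_maxP (fun i => height (w i)) g0) => i /asboolP[x [xS xn wx]] imax.
exists i, x; split=> //; split=> // beta u b0 bu.
apply: contrapT => ux; have wux := weight_vector_root wx bu.
have [j wj] := weight_mem bw ux wux.
have good_j : good j.
  by apply/asboolP; exists (mact V u *m x); split=> //; [exact: stS|rewrite wj].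
have : height (w j) <= height (w i) := imax j good_j.
by rewrite wj heightD leNgt ltrDl height_gt0.
Qed.

End WeightModules.

Lemma key_arith (b1 c1 b2 c2 : bool) N i j : (i < N)%N -> (j < N)%N ->
  (if b1 then i else if c1 then N + i else N + N + i)%N =
  (if b2 then j else if c2 then N + j else N + N + j)%N -> i = j.
Proof. by case: b1 c1 b2 c2 => [] [] [] []; lia. Qed.

Lemma singular_dominant (V : lieModule g) lambda (v : 'cV_(mdim V)) :
  singular lambda v -> dominant_integral alpha lambda.
Proof.
move=> [v0 lv sv] a; have [_ _ /(_ a)[ea [z z0 za]] _] := simple_alpha.
have pa : positive (delta_mx 0 a).
  by apply/positiveP; split=> // b; rewrite mxE; case: (_ && _).
exact: sl2_weight ea v0 lv za z0 (sv _ _ pa za).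
Qed.

Lemma dominant_pairing_ge0 lambda a : dominant_integral alpha lambda ->
  0 <= <|lambda, delta_mx 0 a|>.
Proof.
have [_ _ /(_ a)[/pairing_gt0 e_gt0 _] _] := simple_alpha.
move=> /(_ a)[k kE].
have -> : <|lambda, delta_mx 0 a|> = k%:R * <|delta_mx 0 a, delta_mx 0 a|> / 2.
  by rewrite -kE; field; exact: lt0r_neq0.
by rewrite divr_ge0 // mulr_ge0 // ltW.
Qed.

(** * Ordered words in root vectors *)

Section PBW.
Variables (X Y : 'I_n -> g) (w : 'I_n -> 'rV[R]_r).
Hypothesis XY : root_basis X Y w.

Definition negative (i : 'I_n) := positive (- w i).

(* Sorting by [key] puts negative roots first and positive roots last. *)
Definition key (i : 'I_n) : nat :=
  (if negative i then val i else if w i == 0%R then n + val i else n + n + val i)%N.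

Definition key_le : rel 'I_n := [rel i j | key i <= key j]%N.

Lemma key_le_trans : transitive key_le.
Proof. by move=> i j k; exact: leq_trans. Qed.

Lemma key_le_total : total key_le.
Proof. by move=> i j; exact: leq_total. Qed.

Lemma key_inj : injective key.
Proof.
move=> i j ij; apply/val_inj; exact: key_arith (ltn_ord i) (ltn_ord j) ij.
Qed.

Lemma key_le_anti : antisymmetric key_le.
Proof. by move=> i j; rewrite /key_le /= -eqn_leq => /eqP/key_inj. Qed.

Lemma key_le_negative i j : key_le i j -> negative j -> negative i.
Proof.
rewrite /key_le /= /key => + nj; rewrite nj; case: ifP => // _ le_ij.
have : (n <= val j)%N.
  apply: leq_trans le_ij; case: ifP => _; first exact: leq_addr.
  by rewrite -addnA leq_addr.
by rewrite leqNgt ltn_ord.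
Qed.

Variable V : lieModule g.
Implicit Types (v : 'cV[R[i]]_(mdim V)) (S : {vspace 'cV[R[i]]_(mdim V)}).

Definition word (s : seq 'I_n) v := foldr (fun i u => mact V (X i) *m u) v s.

Definition word_weight (s : seq 'I_n) : 'rV[R]_r := \sum_(i <- s) w i.

Lemma word_weightP mu s v : weight_vector mu v -> weight_vector (mu + word_weight s) (word s v).
Proof.
move=> mv; elim: s => [|i s IH]; first by rewrite /word_weight big_nil addr0.
rewrite /word_weight big_cons addrCA addrC; apply: weight_vector_root => //.
by case: XY.
Qed.

Lemma word_linear s c u v : word s (c *: u + v) = c *: word s u + word s v.
Proof. by elim: s => //= i s ->; rewrite mulmxDr scalemxAr. Qed.

Lemma word_mem S s v : stable S -> v \in S -> word s v \in S.
Proof. by move=> stS vS; elim: s => //= i s IH; exact: stS. Qed.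

Definition words k : seq (seq 'I_n) :=
  [seq s <- undup (flatten [seq [seq val t | t <- enum {: l.-tuple 'I_n}] | l <- iota 0 k.+1])
     | sorted key_le s].

Lemma mem_words k s : (s \in words k) = (size s <= k)%N && sorted key_le s.
Proof.
rewrite mem_filter mem_undup andbC; congr (_ && _); apply/flattenP/idP => [[l]|sk].
  move=> /mapP[m]; rewrite mem_iota add0n ltnS => mk -> /mapP[t _ ->].
  by rewrite size_tuple.
exists [seq val t | t <- enum {: (size s).-tuple 'I_n}].
  by apply/mapP; exists (size s) => //; rewrite mem_iota add0n ltnS.
by apply/mapP; exists (in_tuple s) => //; rewrite mem_enum.
Qed.

Lemma words_uniq k : uniq (words k).
Proof. by rewrite filter_uniq // undup_uniq. Qed.

Definition word_span k v : {vspace 'cV[R[i]]_(mdim V)} :=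
  <<[seq word s v | s <- words k]>>%VS.

Lemma mem_word_span k v s : (size s <= k)%N -> sorted key_le s -> word s v \in word_span k v.
Proof.
by move=> sk ss; apply/memv_span/map_f; rewrite mem_words sk.
Qed.

Lemma word_span_sub k v S : (forall s, (size s <= k)%N -> sorted key_le s -> word s v \in S) ->
  (word_span k v <= S)%VS.
Proof.
move=> sS; apply/span_subvP => z /mapP[s]; rewrite mem_words => /andP[sk ss] ->.
exact: sS.
Qed.

Lemma word_spanS k l v : (k <= l)%N -> (word_span k v <= word_span l v)%VS.
Proof.
move=> kl; apply: word_span_sub => s sk ss; apply: mem_word_span => //.
exact: leq_trans kl.
Qed.

(** The insertion step: exchanging [X i] with a smaller head costs a bracket acting on a shorter
    word. Strong induction on the length absorbs all such errors in the span of words of length at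
    most k. *)
Lemma straighten v k i s : sorted key_le s -> size s = k ->
  (exists s', [/\ sorted key_le s', perm_eq s' (i :: s) &
    mact V (X i) *m word s v - word s' v \in word_span k v]).
Proof.
elim/ltn_ind: k i s => k IH i s ss sk.
(* The induction hypothesis in linear form: any x in g maps the span of words of length at most l <
   k into that of length l + 1. *)
have up l x u : (l < k)%N -> u \in word_span l v -> mact V x *m u \in word_span l.+1 v.
  move=> lk ul; have [U UE] := mulmx_lpreim (mact V x) (word_span l.+1 v).
  rewrite -UE; move: u ul; apply/subvP/word_span_sub => q sl sq; rewrite UE.
  have [_ e1 _ _ _] := XY; rewrite (e1 x) linear_sum mulmx_suml memv_suml // => j _.
  rewrite linearZ /= -scalemxAl memvZ //.
  have [s' [ss' ps' d]] := IH _ (leq_ltn_trans sl lk) j q sq erefl.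
  rewrite -[_ *m _](subrK (word s' v)) memvD //.
    by apply: (subvP (word_spanS v _)) d; rewrite (leq_trans sl).
  by apply: mem_word_span => //; rewrite (perm_size ps').
case: s ss sk => [|j s] ss sk.
  by exists [:: i]; split=> //; rewrite subrr mem0v.
have [ij|ji] := boolP (key_le i j).
  by exists [:: i, j & s]; split=> //=; rewrite ?ij //= subrr mem0v.
have {}ji : key_le j i by have := key_le_total i j; rewrite (negPf ji).
have sS : sorted key_le s by exact: path_sorted ss.
have sk1 : (size s < k)%N by rewrite -sk.
have [t [st pt d]] := IH _ sk1 i s sS erefl.
exists (j :: t); split.
- rewrite /= path_min_sorted // (perm_all _ pt) /= ji.
  exact: order_path_min key_le_trans ss.
- by rewrite -(perm_cons j) in pt; apply: perm_trans pt _; rewrite (perm_catCA [:: j] [:: i]).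
rewrite /= mact_comm -addrA -mulmxBr -sk /= memvD //; last exact: up.
by apply: up => //; exact: mem_word_span.
Qed.

(** The spans of sorted words grow with k and have bounded dimension. At a k of maximal dimension
    one more letter, straightened, leads nowhere new. *)
Lemma pbw v : exists k, stable (word_span k v).
Proof.
have ex0 : exists d, `[< exists k, \dim (word_span k v) = d >].
  by exists (\dim (word_span 0 v)); apply/asboolP; exists 0%N.
have ub d : `[< exists k, \dim (word_span k v) = d >] -> (d <= \dim {: 'cV[R[i]]_(mdim V)})%N.
  by move=> /asboolP[k <-]; rewrite dimvS ?subvf.
case: (ex_maxnP ex0 ub) => d /asboolP[k kd] kmax; exists k => x u uk.
have eqk : word_span k v = word_span k.+1 v.
  apply/eqP; rewrite eqEdim word_spanS //= kd; apply: kmax.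
  by apply/asboolP; exists k.+1.
rewrite eqk; have [U UE] := mulmx_lpreim (mact V x) (word_span k.+1 v).
rewrite -UE; move: u uk; apply/subvP/word_span_sub => s sk ss; rewrite UE.
have [_ e1 _ _ _] := XY; rewrite (e1 x) linear_sum mulmx_suml memv_suml // => j _.
rewrite linearZ /= -scalemxAl memvZ //.
have [s' [ss' ps' d']] := straighten v j ss erefl.
rewrite -[_ *m _](subrK (word s' v)) memvD //.
  by apply: (subvP (word_spanS v _)) d'; rewrite (leq_trans sk).
by apply: mem_word_span => //; rewrite (perm_size ps').
Qed.

Definition neg_words k := [seq s <- words k | all negative s].

(** The last letter acts first. If it is not negative, it acts on v by a scalar (0 for a positive
    root) and is dropped; once the last letter is negative, the order makes all letters negative. *)
Lemma singular_word lambda v s : singular lambda v -> sorted key_le s ->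
  exists c s', [/\ word s v = c *: word s' v, sorted key_le s', all negative s' &
    (size s' <= size s)%N].
Proof.
move=> [v0 lv sv]; elim/last_ind: s => [|s i IH] ss.
  by exists 1, [::]; rewrite scale1r.
have [si sS] : all (key_le^~ i) s /\ sorted key_le s.
  by move: ss; rewrite !(sorted_pairwise key_le_trans) pairwise_rcons => /andP.
have [ni|ni] := boolP (negative i).
  exists 1, (rcons s i); rewrite scale1r; split=> //.
  by rewrite all_rcons ni; apply: sub_all si => j ji; exact: key_le_negative ni.
have [c ci] : exists c, mact V (X i) *m v = c *: v.
  have [_ _ _ xw _] := XY; have [wi|wi|wi] := root_cases (xw i) (@root_basis_neq0 _ _ _ XY i).
  - by exists (killing (cv lambda) (X i)); apply: (weight_vector_zero lv); rewrite -wi.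
  - by exists 0; rewrite scale0r (sv _ _ wi (xw i)).
  - by rewrite /negative wi in ni.
have [c' [s' [sE ss' ns' sz]]] := IH sS; exists (c * c'), s'; split=> //.
  rewrite /word foldr_rcons ci -/(word s _) -[c *: v]addr0 word_linear sE scalerA.
  suff -> : word s 0 = 0 by rewrite addr0.
  by elim: (s) => //= j t ->; rewrite mulmx0.
by rewrite size_rcons (leq_trans sz).
Qed.

Lemma singular_span lambda v : singular lambda v -> exists k S,
  [/\ stable S, v \in S, S = <<[seq word s v | s <- neg_words k]>>%VS &
      forall S', stable S' -> v \in S' -> (S <= S')%VS].
Proof.
move=> sv; have [k st] := pbw v; exists k, (word_span k v); split=> //.
- by rewrite -[v]/(word [::] v) mem_word_span.
- apply/eqP; rewrite eqEsubv; apply/andP; split.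
    apply: word_span_sub => s sk ss; have [c [s' [-> ss' ns' sz]]] := singular_word sv ss.
    apply/memvZ/memv_span/map_f; rewrite mem_filter ns' mem_words ss' andbT.
    exact: leq_trans sz sk.
  apply/span_subvP => z /mapP[s]; rewrite mem_filter mem_words => /and3P[_ sk ss] ->.
  exact: mem_word_span.
- by move=> S' st' vS'; apply: word_span_sub => s _ _; exact: word_mem.
Qed.

Lemma word_weight_le0 s a : all negative s -> word_weight s 0 a <= 0.
Proof.
rewrite /word_weight summxE; elim: s => [|i s IH] /=; first by rewrite big_nil.
move=> /andP[/positiveP[_ /(_ a)]]; rewrite mxE oppr_ge0 => wi /IH le0.
by rewrite big_cons; apply: (le_trans (lerD wi le0)); rewrite addr0.
Qed.

Lemma word_weight_neq0 i s : all negative (i :: s) -> word_weight (i :: s) <> 0.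
Proof.
move=> /= /andP[ni ns] /(congr1 (fun x => height (- x))); apply/eqP.
have -> : height (- 0) = 0 by rewrite /height big1 // => a _; rewrite oppr0 mxE.
rewrite /word_weight big_cons opprD heightD.
rewrite lt0r_neq0 // ltr_wpDr ?height_gt0 //; apply: sumr_ge0 => a _.
by rewrite mxE oppr_ge0; exact: word_weight_le0.
Qed.

(* The Casimir element is a scalar on the submodule generated by a singular
   vector and separates comparable dominant weights. *)
Lemma singular_irreducible d (m : 'I_d -> 'rV[R]_r) lambda v :
  weight_basis V m -> singular lambda v -> exists S,
  [/\ stable S, v \in S, (forall S', stable S' -> v \in S' -> (S <= S')%VS) &
      forall S', stable S' -> (S' <= S)%VS -> S' <> 0%VS -> S' = S].
Proof.
move=> bm sv; have [k [S [st vS SE gen]]] := singular_span sv.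
exists S; split=> // S' st' S'S S'0; apply/eqP; rewrite eqEsubv S'S /=.
have [i [u [uS' su]]] := stable_singular bm st' S'0; move: (m i) su => mu {i} su.
have [P [Q [PQ QP Pm]]] := bm.
have lv : weight_vector lambda v by case: sv.
have [u0 mu_u _] := su; have [v0 _ _] := sv.
have cas_eq : casimir_value w lambda = casimir_value w mu.
  have [U UE] := mulmx_lpreim (casimir V X Y - (casimir_value w lambda)%:C%C%:M) 0%VS.
  have UP x : x \in U <-> casimir V X Y *m x = (casimir_value w lambda)%:C%C *: x.
    by rewrite UE memv0 mulmxBl mul_scalar_mx subr_eq0; split=> /eqP.
  have stU : stable U.
    move=> y x /UP xU.
    by apply/UP; rewrite mulmxA -(casimir_comm _ XY) -mulmxA xU scalemxAr.
  have vU : v \in U by apply/UP; exact: casimir_singular.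
  have /UP := subvP (gen U stU vU) _ (subvP S'S _ uS').
  rewrite (casimir_singular XY su) => /eqP; rewrite -subr_eq0 -scalerBl scaler_eq0.
  by rewrite subr_eq0 => /orP[/eqP/realC_inj -> //|/eqP //].
(* If no word had weight mu, the projection onto weight mu would kill the whole span S, hence also
   u. *)
have ml : exists2 s, s \in neg_words k & mu = lambda + word_weight s.
  apply: contrapT => no; apply: u0; rewrite -(weight_proj_id PQ QP Pm mu_u).
  have [U UE] := mulmx_lpreim (weight_proj m P Q mu) 0%VS.
  have /subvP/(_ u (subvP S'S _ uS')) : (S <= U)%VS; last by rewrite UE memv0 => /eqP.
  rewrite SE; apply/span_subvP => z /mapP[s sk ->]; rewrite UE memv0; apply/eqP.
  apply: (weight_proj0 PQ QP Pm (word_weightP s lv)); apply/eqP => sm; apply: no.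
  by exists s.
have ml0 : lambda = mu.
  have [s + mE] := ml; rewrite mem_filter => /andP[ns _].
  have [dl dm] := (singular_dominant sv, singular_dominant su).
  apply: (casimir_value_inj XY _ _ _ cas_eq) => a; try exact: dominant_pairing_ge0.
  by rewrite mE opprD addrA subrr add0r mxE oppr_ge0 word_weight_le0.
(* Only the empty word has weight lambda, so the lambda weight space of S is the line of v; hence
   [S'] contains v. *)
suff : u \in <[v]>%VS.
  move=> /vlineP[c uE]; apply: gen => //.
  have c0 : c != 0 by apply/eqP => c0; apply: u0; rewrite uE c0 scale0r.
  by rewrite -[v](scalerK c0) -uE memvZ.
rewrite -(weight_proj_id PQ QP Pm mu_u) -ml0.
have [U UE] := mulmx_lpreim (weight_proj m P Q lambda) <[v]>%VS.
rewrite -UE; move: u {su uS' u0 mu_u ml ml0} (subvP S'S _ uS'); apply/subvP.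
rewrite SE; apply/span_subvP => z /mapP[s sk ->]; rewrite UE.
case: s sk => [|i s] sk; first by rewrite (weight_proj_id PQ QP Pm lv) memv_line.
rewrite (weight_proj0 PQ QP Pm (word_weightP (i :: s) lv)) ?mem0v //.
rewrite -subr_eq0 addrAC subrr add0r; apply/eqP/word_weight_neq0.
by move: sk; rewrite mem_filter => /andP[].
Qed.

End PBW.

(** * A bound on weights uniform in the highest weight *)

Section WeightBound.
Variables (X Y : 'I_n -> g) (w : 'I_n -> 'rV[R]_r).
Hypothesis XY : root_basis X Y w.

Lemma ler_sum_inj (I : eqType) (J : finType) (l : seq I) (c : I -> J) (G : J -> R) :
  uniq l -> {in l &, injective c} -> (forall j, 0 <= G j) ->
  \sum_(i <- l) G (c i) <= \sum_j G j.
Proof.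
move=> ul c_inj G0; rewrite -(big_map c xpredT) big_uniq ?map_inj_in_uniq //=.
by rewrite [leRHS](bigID (mem (map c l))) /= lerDl sumr_ge0.
Qed.

Lemma expR_sum (I : Type) (s : seq I) (P : pred I) (F : I -> R) :
  expR (\sum_(i <- s | P i) F i) = \prod_(i <- s | P i) expR (F i).
Proof.
by elim/big_rec2: _ => [|i x y _ <-]; rewrite ?expR0 ?expRD.
Qed.

Definition weight_bound t : R := \prod_(i | negative w i) (1 - expR <|w i, t|>)^-1.

Lemma negative_lt0 t i : (forall a, 0 < <|delta_mx 0 a, t|>) -> negative w i -> <|w i, t|> < 0.
Proof.
move=> t0 /positiveP[w0 wge]; rewrite -oppr_gt0 -pairingNl {1}(row_sum_delta (- w i)).
rewrite pairing_suml lt0r sumr_ge0 => [|a _]; last by rewrite pairingZl mulr_ge0 // ltW.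
rewrite andbT; apply/eqP => /eqP; rewrite psumr_eq0 => [/allP wz|a _]; last first.
  by rewrite pairingZl mulr_ge0 // ltW.
apply: w0; apply/rowP => a; have := wz a (mem_index_enum a).
by rewrite pairingZl mulf_eq0 (gt_eqF (t0 a)) orbF [RHS]mxE => /eqP.
Qed.

Lemma geometric_le (q : R) k : 0 <= q < 1 -> \sum_(l < k) q ^+ l <= (1 - q)^-1.
Proof.
move=> /andP[q0 q1]; have := subrX1 q k; rewrite -opprB -[X in _ = X * _]opprB mulNr.
move/oppr_inj => qk; rewrite -[leRHS]mul1r ler_pdivlMr ?subr_gt0 // mulrC -qk.
by rewrite gerBl exprn_ge0.
Qed.

(** A sorted word is determined by the multiplicities of its letters. Summing over all multiplicity
    functions with values at most k factors into truncated geometric series, one for each negative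
    letter. *)
Lemma neg_words_bound k t : (forall a, 0 < <|delta_mx 0 a, t|>) ->
  \sum_(s <- neg_words w k) expR <|word_weight w s, t|> <= weight_bound t.
Proof.
move=> t0; pose c (s : seq 'I_n) := [ffun i => inord (count_mem i s) : 'I_k.+1].
(* For a letter that is not negative the factor is the indicator of multiplicity 0, so its sum over
   l is 1. *)
pose F i (l : 'I_k.+1) : R := if negative w i then expR <|w i, t|> ^+ l else (l == 0 :> nat)%:R.
have F0 i l : 0 <= F i l by rewrite /F; case: ifP => _; rewrite ?exprn_ge0 ?expR_ge0 ?ler0n.
have szw s : s \in neg_words w k -> (size s <= k)%N /\ all (negative w) s.
  by rewrite mem_filter mem_words => /and3P[].
have cE s i : s \in neg_words w k -> c s i = count_mem i s :> nat.
  move=> /szw[sk _]; rewrite ffunE inordK // ltnS; apply: leq_trans sk; exact: count_size.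
apply: (@le_trans _ _ (\sum_(s <- neg_words w k) \prod_i F i (c s i))).
  rewrite big_seq [leRHS]big_seq; apply: ler_sum => s sk; rewrite le_eqVlt; apply/orP; left.
  have [_ ns] := szw s sk.
  rewrite /word_weight pairing_suml expR_sum; apply/eqP.
  transitivity (\prod_i expR <|w i, t|> ^+ count_mem i s).
    elim: (s) => [|j u IH]; first by rewrite big_nil big1.
    rewrite big_cons IH (bigD1 j) //= [RHS](bigD1 j) //= eqxx exprS -mulrA; congr (_ * (_ * _)).
    by apply: eq_bigr => i /negPf ij; rewrite eq_sym ij.
  apply: eq_bigr => i _; rewrite /F cE //; case: ifP => // ni.
  have -> : count_mem i s = 0%N.
    by apply/count_memPn; apply/negP => /(allP ns); rewrite ni.
  by rewrite expr0.
apply: (@le_trans _ _ (\sum_(f : {ffun 'I_n -> 'I_k.+1}) \prod_i F i (f i))).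
  apply: (ler_sum_inj (c := c) (G := fun f : {ffun 'I_n -> 'I_k.+1} => \prod_i F i (f i))).
  - by rewrite filter_uniq // words_uniq.
  - move=> s u sk uk /ffunP su.
    have srt q : q \in neg_words w k -> sorted (key_le w) q.
      by rewrite mem_filter mem_words => /and3P[].
    apply: (sorted_eq (@key_le_trans w) (@key_le_anti w) (srt _ sk) (srt _ uk)).
    apply/allP => i _ /=; rewrite -!cE //; apply/eqP; congr (nat_of_ord _); exact: su.
  - by move=> f; apply: prodr_ge0 => i _.
rewrite -(bigA_distr_bigA F) /weight_bound [leRHS]big_mkcond /=; apply: ler_prod => i _.
rewrite sumr_ge0 //= /F; case: ifP => ni.
  apply: geometric_le; rewrite expR_ge0 /= expR_lt1; exact: negative_lt0.
by rewrite big_ord_recl big1 ?addr0.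
Qed.

(** By irreducibility the submodule generated by v is everything, so the sorted negative words on v
    span V and a weight basis can be selected among them. *)
Lemma irreducible_weight_basis (V : lieModule g) lambda (v : 'cV_(mdim V)) :
  irreducible V -> singular lambda v -> exists m : 'I_(mdim V) -> 'rV[R]_r,
  [/\ weight_basis V m, forall i a, (m i - lambda) 0 a <= 0
    & forall t, (forall a, 0 < <|delta_mx 0 a, t|>) ->
      \sum_i expR <|m i - lambda, t|> <= weight_bound t].
Proof.
move=> [_ irr] sv; have [k [S [st vS SE gen]]] := singular_span XY sv.
have SF : S = fullv.
  have [|S0|//] := irr S; first exact: st.
  by case: sv => v0 _ _; move: vS; rewrite S0 memv0 => /eqP.
pose nw := neg_words w k; pose s_ (j : 'I_(size nw)) := nth [::] nw j.
have [_ lv _] := sv.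
have [||f f_inj fb] := @weight_basis_of_span V _ (fun j => word X (s_ j) v)
  (fun j => lambda + word_weight w (s_ j)).
- by move=> j; apply: word_weightP lv; exact: XY.
- move=> S' S'w; apply/eqP; rewrite eqEsubv subvf -SF SE; apply/span_subvP => z /mapP[s sk ->].
  have sk' : (index s nw < size nw)%N by rewrite index_mem.
  by have := S'w (Ordinal sk'); rewrite /s_ /= nth_index.
exists (fun i => lambda + word_weight w (s_ (f i))); split=> // [i a|t t0].
  rewrite addrAC subrr add0r; apply: word_weight_le0.
  have : s_ (f i) \in nw by exact: mem_nth.
  by rewrite mem_filter => /andP[].
apply: le_trans (neg_words_bound k t0); rewrite (big_nth [::]) big_mkord.
under eq_bigr do rewrite addrAC subrr add0r.
rewrite -(big_enum _) /=.
apply: (ler_sum_inj (c := f) (G := fun j => expR <|word_weight w (s_ j), t|>)).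
- exact: enum_uniq.
- by move=> i j _ _; exact: f_inj.
- by move=> j; exact: expR_ge0.
Qed.

End WeightBound.

(** The map inside [weight_space], named so that a linear structure can be attached to it and
    [lfunE] evaluates its [linfun]. *)
Definition weight_eq (V : lieModule g) mu a (v : 'cV[R[i]]_(mdim V)) : 'cV[R[i]]_(mdim V) :=
  mact V (alpha a) *m v - killing (cv mu) (alpha a) *: v.

Lemma weight_eq_linear (V : lieModule g) mu a : linear (@weight_eq V mu a).
Proof.
move=> c u v; rewrite /weight_eq mulmxDr -scalemxAr scalerDr scalerBr !scalerA mulrC.
by rewrite addrACA opprD.
Qed.

HB.instance Definition _ (V : lieModule g) mu a :=
  GRing.isLinear.Build R[i] 'cV[R[i]]_(mdim V) 'cV[R[i]]_(mdim V) *:%R (@weight_eq V mu a)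
    (@weight_eq_linear V mu a).

Lemma weight_spaceP (V : lieModule g) mu (v : 'cV_(mdim V)) :
  v \in weight_space alpha V mu <-> weight_vector mu v.
Proof.
have kE a : (v \in lker (linfun (@weight_eq V mu a))) =
    (mact V (alpha a) *m v == killing (cv mu) (alpha a) *: v).
  by rewrite memv_ker lfunE /= subr_eq0.
split=> [vm y|mv].
  have va a : mact V (alpha a) *m v = killing (cv mu) (alpha a) *: v.
    have /subvP/(_ v vm) : (weight_space alpha V mu <= lker (linfun (@weight_eq V mu a)))%VS.
      exact: (bigcapv_inf a).
    by rewrite kE => /eqP.
  rewrite /cvec -killing_cvec linear_sum /= mulmx_suml /cvec linear_sum scaler_suml.
  by apply: eq_bigr => a _; rewrite !linearZ /= -scalemxAl va scalerA.
rewrite memvE; apply/subv_bigcapP => a _; rewrite -memvE kE; apply/eqP.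
by rewrite -(cvec_delta alpha a) mv killing_cvec.
Qed.

Lemma highest_weightP (V : lieModule g) lambda : has_highest_weight alpha V lambda <->
  exists v : 'cV_(mdim V), singular lambda v.
Proof.
split=> [[v [v0 lv sv]]|[v [v0 lv sv]]]; exists v; split=> //.
- exact/weight_spaceP.
- move=> beta u b0 bu; have [->|/eqP u0] := eqVneq u 0; first by rewrite linear0 mul0mx.
  have /positiveP[bn bge] := b0; apply: sv (bu); split=> //; split=> //.
  by exists u.
- exact/weight_spaceP.
- move=> beta u [[bn _] bge] bu; apply: sv bu; exact/positiveP.
Qed.

End RootBasis.

(** * Complete reducibility *)

Section ModuleIso.
Variables (K : fieldType) (g : lieAlgebra K).
Implicit Types U V W : lieModule g.

Definition intertwiner U V (A : 'M[K]_(mdim V, mdim U)) : Prop :=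
  forall x, A *m mact U x = mact V x *m A.

Lemma module_iso_sym U V : module_iso U V -> module_iso V U.
Proof.
move=> [A [B [AB BA AU]]]; exists B, A; split=> // x.
by rewrite -[LHS]mulmx1 -AB mulmxA -(mulmxA B) -AU !mulmxA BA mul1mx.
Qed.

Lemma module_iso_trans U V W : module_iso U V -> module_iso V W -> module_iso U W.
Proof.
move=> [A [B [AB BA AU]]] [C [D [CD DC CV]]]; exists (C *m A), (B *m D); split=> [||x].
- by rewrite mulmxA -(mulmxA C) AB mulmx1.
- by rewrite mulmxA -(mulmxA B) DC mulmx1.
- by rewrite -mulmxA AU !mulmxA CV.
Qed.

Lemma module_iso_dsum U U' V V' : module_iso U U' -> module_iso V V' ->
  module_iso (dsum_module U V) (dsum_module U' V').
Proof.
move=> [A [B [AB BA AU]]] [C [D [CD DC CV]]].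
exists (block_mx A 0 0 C), (block_mx B 0 0 D); split=> [||x].
- rewrite mulmx_block !mulmx0 !mul0mx !addr0 add0r AB CD.
  by rewrite -scalar_mx_block.
- rewrite mulmx_block !mulmx0 !mul0mx !addr0 add0r BA DC.
  by rewrite -scalar_mx_block.
- by rewrite /= /dsum_act !mulmx_block !mulmx0 !mul0mx !addr0 !add0r AU CV.
Qed.

Lemma module_iso_zero U : mdim U = 0%N -> module_iso U (zero_module g).
Proof.
move=> U0; exists 0, 0; split=> [||x].
- by apply/matrixP => -[].
- by apply/matrixP => -[i ilt]; exfalso; rewrite U0 in ilt.
- by rewrite mul0mx mulmx0.
Qed.

Lemma bijective_iso U V (A : 'M[K]_(mdim V, mdim U)) : intertwiner A ->
  (forall v : 'cV_(mdim U), A *m v = 0 -> v = 0) ->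
  (forall v : 'cV_(mdim V), exists u, v = A *m u) -> module_iso U V.
Proof.
move=> AU inj surj; have fA : row_free A^T.
  rewrite -kermx_eq0; apply/eqP/row_matrixP => i; rewrite row0.
  apply: trmx_inj; rewrite trmx0; apply: inj; set c := row i _.
  have cA : c *m A^T = 0 by apply/sub_kermxP; exact: row_sub.
  by rewrite -(trmxK A) -trmx_mul cA trmx0.
pose B := (pinvmx A^T)^T; have BA : B *m A = 1%:M.
  by rewrite -[A]trmxK -trmx_mul mulmxVp // trmx1.
exists A, B; split=> //; apply/matrixP => i j.
have [u uE] := surj (delta_mx j 0).
have : A *m B *m delta_mx j 0 = delta_mx j 0 :> 'cV_(mdim V).
  by rewrite uE mulmxA -(mulmxA A) BA mulmx1.
by rewrite -colE => /colP/(_ i); rewrite !mxE eqxx andbT.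
Qed.

End ModuleIso.

Lemma dim_cV (K : fieldType) p : \dim {: 'cV[K]_p} = p.
Proof. by rewrite dimvf dim_matrix; exact: muln1. Qed.

(** * Submodules and Schur's lemma *)

Section Submodules.
Variables (R : realType) (g : lieAlgebra R[i]).
Implicit Types U V W : lieModule g.

Lemma schur U V (A : 'M[R[i]]_(mdim V, mdim U)) : irreducible U -> irreducible V ->
  intertwiner A -> A <> 0 -> module_iso U V.
Proof.
move=> [_ irrU] [_ irrV] AU A0; apply: (bijective_iso AU) => [v Av0|v].
  have [S SE] := mulmx_lpreim A 0%VS.
  have [x u|S0|SF] := irrU S.
  - by rewrite !SE !memv0 mulmxA AU -mulmxA => /eqP ->; rewrite mulmx0.
  - have : v \in S by rewrite SE Av0 mem0v.
    by rewrite S0 memv0 => /eqP.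
  - case: A0; apply/matrixP => i j; have : delta_mx j 0 \in S by rewrite SF memvf.
    by rewrite SE memv0 -colE => /eqP/colP/(_ i); rewrite !mxE.
have [||S SP] := @vspace_comprehension _ _ (fun v : 'cV_(mdim V) => exists u, v = A *m u).
- by exists 0; rewrite mulmx0.
- by move=> c x y [u ->] [u' ->]; exists (c *: u + u'); rewrite mulmxDr scalemxAr.
have [x u /SP[u' ->]|S0|SF] := irrV S.
- by apply/SP; exists (mact U x *m u'); rewrite !mulmxA AU.
- case: A0; apply/matrixP => i j.
  have : A *m delta_mx j 0 \in S by apply/SP; exists (delta_mx j 0).
  by rewrite S0 memv0 -colE => /eqP/colP/(_ i); rewrite !mxE.
- by apply/SP; rewrite SF memvf.
Qed.

(** [U] is a copy of S as a module of its own, [I] its inclusion and [J] a left inverse. Only [I] is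
    required to be an intertwiner; [J] commutes with the action on vectors of S. *)
Definition is_submodule U V (S : {vspace 'cV[R[i]]_(mdim V)})
    (I : 'M[R[i]]_(mdim V, mdim U)) (J : 'M[R[i]]_(mdim U, mdim V)) : Prop :=
  [/\ J *m I = 1%:M, intertwiner I & forall v, v \in S <-> I *m (J *m v) = v].

Lemma submodule_exists V (S : {vspace 'cV[R[i]]_(mdim V)}) : stable S ->
  exists U I J, @is_submodule U V S I J /\ mdim U = \dim S.
Proof.
move=> stS; pose k := \dim S; pose e := vbasis S.
pose A : 'M[R[i]]_(k, mdim V) := \matrix_(i, j) (e`_i) j 0.
have eA (i : 'I_k) : e`_i = (row i A)^T by apply/colP => j; rewrite !mxE.
have cA (c : 'cV_k) : A^T *m c = \sum_i c i 0 *: e`_i.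
  apply/colP => j; rewrite mxE summxE; apply: eq_bigr => i _.
  by rewrite !mxE mulrC.
have fA : row_free A.
  rewrite -kermx_eq0; apply/eqP/row_matrixP => i; rewrite row0; set c := row i _.
  have : A^T *m c^T = 0.
    by rewrite -trmx_mul; apply/eqP; rewrite trmx_eq0; apply/eqP/sub_kermxP; exact: row_sub.
  have /freeP free_e := basis_free (vbasisP S).
  rewrite cA => /free_e c0.
  by apply/rowP => j; have := c0 j; rewrite !mxE.
pose I := A^T; pose J := (pinvmx A)^T.
have JI : J *m I = 1%:M by rewrite -trmx_mul mulmxVp // trmx1.
have SP v : v \in S <-> I *m (J *m v) = v.
  split=> [vS|<-]; last first.
    rewrite cA memv_suml // => i _; rewrite memvZ // vbasis_mem //.
    by rewrite mem_nth // size_tuple.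
  have -> : v = I *m \col_i coord e i v.
    rewrite cA {1}(coord_vbasis vS); apply: eq_bigr => i _; by rewrite mxE.
  by rewrite (mulmxA J) JI mul1mx.
clearbody I J.
have IJ x : I *m (J *m (mact V x *m I)) = mact V x *m I.
  rewrite !mulmxA; apply/matrixP => i j; have : mact V x *m col j I \in S.
    by apply/stS/SP; rewrite colE (mulmxA J) JI mul1mx.
  by move=> /SP; rewrite colE !mulmxA -!colE => /colP/(_ i); rewrite [LHS]mxE [RHS]mxE.
have act_lin a x y : J *m mact V (a *: x + y) *m I
    = a *: (J *m mact V x *m I) + J *m mact V y *m I.
  by rewrite mact_linear mulmxDr mulmxDl -scalemxAr -scalemxAl.
have act_br x y : J *m mact V (lie_br x y) *m I
    = J *m mact V x *m I *m (J *m mact V y *m I) - J *m mact V y *m I *m (J *m mact V x *m I).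
  have IJ' u z : J *m mact V u *m I *m (J *m mact V z *m I) = J *m (mact V u *m mact V z) *m I.
    by rewrite -(mulmxA J (mact V z)) -(mulmxA _ I) IJ !mulmxA.
  by rewrite mact_br (mulmxBr J) mulmxBl !IJ'.
exists (LieModule act_lin act_br), I, J; split=> //; split=> // x.
by rewrite /= -!mulmxA IJ.
Qed.

Lemma submodule_irreducible U V (S : {vspace 'cV[R[i]]_(mdim V)}) I J :
  is_submodule (U := U) S I J -> S <> 0%VS ->
  (forall S', stable S' -> (S' <= S)%VS -> S' <> 0%VS -> S' = S) -> irreducible U.
Proof.
move=> [JI IU SP] S0 irr; split.
  rewrite lt0n; apply/eqP => U0; apply: S0; apply/eqP; rewrite -subv0.
  apply/subvP => v /SP <-; rewrite memv0; apply/eqP/colP => i; rewrite !mxE.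
  by apply: big1 => -[j jlt]; exfalso; rewrite U0 in jlt.
move=> T stT; have [->|/eqP T0] := eqVneq T 0%VS; [by left|right].
have [T' T'E] := mulmx_lpreim J T.
pose S' := (T' :&: S)%VS.
have mS' v : v \in S' <-> J *m v \in T /\ I *m (J *m v) = v.
  by rewrite memv_cap T'E; split=> [/andP[? /SP]|[? /SP ?]] //; apply/andP.
have S'E : S' = S.
  apply: irr; [|exact: capvSr|].
  - move=> x v /mS'[vT vE]; apply/mS'.
    have xv : J *m (mact V x *m v) = mact U x *m (J *m v).
      by rewrite -{1}vE (mulmxA _ I) -IU -mulmxA mulmxA JI mul1mx.
    by rewrite xv; split; [exact: stT|rewrite mulmxA IU -mulmxA vE].
  - move=> S'0; apply: T0; apply/eqP; rewrite -subv0; apply/subvP => u uT.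
    have : I *m u \in S' by apply/mS'; rewrite mulmxA JI mul1mx.
    by rewrite S'0 !memv0 => /eqP Iu; rewrite -[u]mul1mx -JI -mulmxA Iu mulmx0.
apply/eqP; rewrite eqEsubv subvf; apply/subvP => u _.
have : I *m u \in S by apply/SP; rewrite (mulmxA J) JI mul1mx.
by rewrite -S'E => /mS'[]; rewrite mulmxA JI mul1mx.
Qed.

Lemma submodule_singular r (alpha : 'I_r -> g) U V (S : {vspace 'cV[R[i]]_(mdim V)}) I J lambda v :
  is_submodule (U := U) S I J -> v \in S -> singular alpha lambda v ->
  singular alpha lambda (J *m v).
Proof.
move=> [JI IU SP] /SP vE [v0 lv sv].
have xv x : mact U x *m (J *m v) = J *m (mact V x *m v).
  by rewrite -{2}vE (mulmxA _ I) -IU -mulmxA mulmxA JI mul1mx.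
split=> [Jv0|y|beta u b0 bu].
- by apply: v0; rewrite -vE Jv0 mulmx0.
- by rewrite xv lv scalemxAr.
- by rewrite xv (sv _ _ b0 bu) mulmx0.
Qed.

(** W is the kernel of the matrix whose rows are a basis of U, so the dimension bound is
    rank-nullity. *)
Lemma annihilator p (U : {vspace 'cV[R[i]]_p}) : exists W : {vspace 'cV[R[i]]_p},
  (forall x, x \in W <-> forall psi, psi \in U -> psi^T *m x = 0) /\
  (p <= \dim W + \dim U)%N.
Proof.
pose k := \dim U; pose e := vbasis U.
pose A : 'M[R[i]]_(k, p) := \matrix_(i, j) (e`_i) j 0.
pose f : 'Hom('cV[R[i]]_p, 'cV[R[i]]_k) := linfun (mulmx A); exists (lker f); split=> [x|].
  rewrite memv_ker lfunE /=; split=> [/eqP Ax psi /coord_vbasis ->|xU].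
    rewrite linear_sum mulmx_suml big1 // => i _; rewrite linearZ /= -scalemxAl.
    have -> : ((vbasis U)`_i)^T = row i A by apply/rowP => j; rewrite !mxE.
    by rewrite -row_mul Ax row0 scaler0.
  apply/eqP/row_matrixP => i; rewrite row0 row_mul.
  have -> : row i A = (e`_i)^T by apply/rowP => j; rewrite !mxE.
  by apply: xU; rewrite vbasis_mem // mem_nth // size_tuple.
have := limg_ker_dim f fullv; rewrite capfv dim_cV => dimE.
apply: (@leq_trans (\dim (lker f) + \dim (limg f))%N); first by rewrite dimE.
by rewrite leq_add2l (leq_trans (dimvS (subvf _))) // dim_cV.
Qed.

End Submodules.

(** * Opposite simple roots and the dual module *)

Section OppositeRoots.
Variables (R : realType) (r : nat) (g : lieAlgebra R[i]) (gR hR : set g).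
Variable alpha : 'I_r -> g.
Hypothesis simple_g : is_simple g.
Hypothesis split_g : split_real_form gR hR.
Hypothesis simple_alpha : simple_roots alpha hR.
Hypothesis r_gt0 : exists x : 'rV[R]_r, x <> 0.

(** Negating the simple roots swaps raising and lowering. A weight - mu of the dual module then has
    the coordinates of mu, and the highest weight theory applies to the dual without change. *)
Definition opp_roots (a : 'I_r) : g := - alpha a.

Lemma cvec_opp y : cvec opp_roots y = - cvec alpha y.
Proof.
by rewrite /cvec -sumrN; apply: eq_bigr => a _; rewrite scalerN.
Qed.

Lemma pairing_opp x y : pairing opp_roots x y = pairing alpha x y.
Proof.
apply: eq_bigr => a _; apply: eq_bigr => b _; congr (_ * _ * _).
by rewrite !mxE /opp_roots killingNl (linearN (killing (alpha a))) /= opprK.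
Qed.

Lemma root_vector_opp beta u : root_vector opp_roots beta u <-> root_vector alpha (- beta) u.
Proof.
split=> bu y; have := bu y.
  rewrite !cvec_opp killingNl linearN opprK lie_brN linearN /= opprK cvecN killingNl => E.
  by rewrite lie_brN E scaleNr.
rewrite !cvec_opp cvecN !killingNl linearN opprK /= => E.
by rewrite lie_brN linearN /= opprK lie_brN E scaleNr opprK.
Qed.

Lemma is_root_opp beta : is_root opp_roots beta <-> is_root alpha (- beta).
Proof.
split=> -[b0 [u u0 bu]]; split.
- by move=> /eqP; rewrite oppr_eq0 => /eqP.
- by exists u => //; exact/root_vector_opp.
- by move=> bz; apply: b0; rewrite bz oppr0.
- by exists u => //; exact/root_vector_opp.
Qed.

Lemma simple_roots_opp : simple_roots opp_roots hR.
Proof.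
have [hc surj root_e root_int] := simple_alpha; split.
- by move=> y; rewrite cvec_opp -cvecN.
- move=> h /surj[y [-> yu]]; exists (- y); split; first by rewrite cvec_opp cvecN opprK.
  by move=> z; rewrite cvec_opp -cvecN => /yu ->; rewrite opprK.
- move=> a; apply/is_root_opp; have [e0 [u u0 eu]] := root_e a; split.
    by move=> /eqP; rewrite oppr_eq0 => /eqP.
  (* That - alpha_a is a root follows from nondegeneracy of the Killing form: the partner of a root
     vector is nonzero. *)
  have [v ev uv1] := root_partner simple_g split_g simple_alpha r_gt0 eu u0.
  exists v => // v0; move: uv1; rewrite v0 linear0 => /eqP.
  by rewrite eq_sym oner_eq0.
- move=> beta /is_root_opp/root_int[k [kE|kE]]; exists k; [right|left] => a.
    by rewrite -[beta]opprK mxE kE.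
  by rewrite -[beta]opprK mxE kE opprK.
Qed.

Section Dual.
Variable V : lieModule g.

Definition dual_act (x : g) : 'M[R[i]]_(mdim V) := - (mact V x)^T.

Lemma dual_linear a x y : dual_act (a *: x + y) = a *: dual_act x + dual_act y.
Proof. by rewrite /dual_act mact_linear linearP opprD scalerN. Qed.

Lemma dual_br x y :
  dual_act (lie_br x y) = dual_act x *m dual_act y - dual_act y *m dual_act x.
Proof.
rewrite /dual_act mact_br linearB /= !trmx_mul !mulmxN !mulNmx !opprK opprB //.
Qed.

Definition dual_module : lieModule g := LieModule dual_linear dual_br.

Lemma diag_weight_basis d (m : 'I_d -> 'rV[R]_r) (P : 'M[R[i]]_(mdim V, d)) y :
  (forall i, weight_vector alpha (m i) (col i P)) ->
  mact V (cvec alpha y) *m P = P *m diag_mx (\row_j (pairing alpha (m j) y)%:C%C).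
Proof.
move=> Pm; apply/matrixP => k j; rewrite mul_mx_diag !mxE mulrC.
have /colP/(_ k) := Pm j y; rewrite !mxE => <-.
by apply: eq_bigr => l _; rewrite !mxE.
Qed.

(* With respect to the opposite simple roots the dual module has the same
   weights. *)
Lemma weight_basis_dual d (m : 'I_d -> 'rV[R]_r) (P : 'M[R[i]]_(mdim V, d)) Q :
  P *m Q = 1%:M -> Q *m P = 1%:M -> (forall i, weight_vector alpha (m i) (col i P)) ->
  forall i, @weight_vector _ _ _ opp_roots dual_module (m i) (col i Q^T).
Proof.
move=> PQ QP Pm i y; rewrite cvec_opp pairing_opp /= /dual_act linearN /= linearN /= opprK.
have QmE : Q *m mact V (cvec alpha y) = diag_mx (\row_j (pairing alpha (m j) y)%:C%C) *m Q.
  rewrite -[Q *m _]mulmx1 -PQ mulmxA -(mulmxA Q) (diag_weight_basis y Pm) !mulmxA.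
  by rewrite QP mul1mx.
rewrite -tr_row -trmx_mul -row_mul QmE; apply/colP => k.
by rewrite mxE [RHS]mxE mul_diag_mx !mxE.
Qed.

End Dual.

Lemma max_weight_singular V d (m : 'I_d -> 'rV[R]_r) (P : 'M[R[i]]_(mdim V, d)) Q i :
  P *m Q = 1%:M -> Q *m P = 1%:M -> (forall i, weight_vector alpha (m i) (col i P)) ->
  (forall j, height (m j) <= height (m i)) -> singular alpha (m i) (col i P).
Proof.
move=> PQ QP Pm imax.
have bm : weight_basis alpha V m by exists P, Q.
split=> [Pi0||beta u b0 bu]; last 1 first.
- apply: contrapT => ux.
  have wux := weight_vector_root split_g simple_alpha (Pm i) bu.
  have [j wj] := weight_mem simple_g split_g simple_alpha bm ux wux.
  by have := imax j; rewrite wj heightD leNgt ltrDl height_gt0.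
- have : Q *m col i P = delta_mx i 0 by rewrite colE mulmxA QP mul1mx.
  rewrite Pi0 mulmx0 => /colP/(_ i)/eqP; rewrite mxE [X in _ == X]mxE !eqxx.
  by rewrite eq_sym oner_eq0.
- exact: Pm.
Qed.

Lemma col_diag_weight (V : lieModule g) d (m : 'I_d -> 'rV[R]_r) (P : 'M[R[i]]_(mdim V, d)) :
  (forall y, mact V (cvec alpha y) *m P = P *m diag_mx (\row_j (pairing alpha (m j) y)%:C%C)) ->
  forall i, weight_vector alpha (m i) (col i P).
Proof.
move=> PD i y; have := congr1 (col i) (PD y); rewrite colE -mulmxA -colE => ->.
by apply/colP => k; rewrite mxE mul_mx_diag [RHS]mxE !mxE mulrC.
Qed.

Lemma weight_basis_dsum U V d e (m : 'I_d -> 'rV[R]_r) (l : 'I_e -> 'rV[R]_r) :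
  weight_basis alpha U m -> weight_basis alpha V l ->
  weight_basis alpha (dsum_module U V)
    (fun k : 'I_(d + e) => match fintype.split k with inl i => m i | inr j => l j end).
Proof.
move=> [P [Q [PQ QP Pm]]] [P' [Q' [PQ' QP' Pl]]].
exists (block_mx P 0 0 P'), (block_mx Q 0 0 Q'); split.
- by rewrite mulmx_block !mulmx0 !mul0mx !addr0 add0r PQ PQ' -scalar_mx_block.
- by rewrite mulmx_block !mulmx0 !mul0mx !addr0 add0r QP QP' -scalar_mx_block.
apply: col_diag_weight => y.
have -> : diag_mx (\row_j (pairing alpha
      (match fintype.split j with inl i => m i | inr j => l j end) y)%:C%C) =
    block_mx (diag_mx (\row_j (pairing alpha (m j) y)%:C%C)) 0 0
             (diag_mx (\row_j (pairing alpha (l j) y)%:C%C)) :> 'M[R[i]]_(d + e).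
  rewrite -diag_mx_row; congr diag_mx; apply/rowP => j; rewrite !mxE.
  by case: fintype.split => k; rewrite mxE.
rewrite /= /dsum_act !mulmx_block !mulmx0 !mul0mx !addr0 !add0r.
by rewrite (diag_weight_basis y Pm) (diag_weight_basis y Pl).
Qed.

Lemma weight_basis_tensor U V d e (m : 'I_d -> 'rV[R]_r) (l : 'I_e -> 'rV[R]_r) :
  weight_basis alpha U m -> weight_basis alpha V l ->
  weight_basis alpha (tensor_module U V)
    (fun k : 'I_(d * e) => m (mxtens_unindex k).1 + l (mxtens_unindex k).2).
Proof.
move=> [P [Q [PQ QP Pm]]] [P' [Q' [PQ' QP' Pl]]].
have tens1 p q : (1%:M : 'M[R[i]]_p) *t (1%:M : 'M[R[i]]_q) = 1%:M.
  apply/matrixP => i j; case: (mxtens_indexP i) => i1 i2; case: (mxtens_indexP j) => j1 j2.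
  rewrite tensmxE !mxE (can_eq (@mxtens_indexK _ _)) xpair_eqE.
  by case: eqP; case: eqP; rewrite ?mul0r ?mulr0 ?mul1r.
exists (P *t P'), (Q *t Q'); split.
- by rewrite tensmx_mul PQ PQ' tens1.
- by rewrite tensmx_mul QP QP' tens1.
apply: col_diag_weight => y.
rewrite /= /tensor_act mulmxDl !tensmx_mul !mul1mx.
rewrite (diag_weight_basis y Pm) (diag_weight_basis y Pl).
apply/matrixP => i j; rewrite mul_mx_diag.
case: (mxtens_indexP i) => i1 i2; case: (mxtens_indexP j) => j1 j2.
have idx : mxtens_unindex (mxtens_index (j1, j2)) = (j1, j2) := mxtens_indexK _.
have /= idx1 := congr1 fst idx; have /= idx2 := congr1 snd idx.
have jdx : mxtens_unindex (mxtens_index (i1, i2)) = (i1, i2) := mxtens_indexK _.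
have /= jdx1 := congr1 fst jdx; have /= jdx2 := congr1 snd jdx.
rewrite mxE !tensmxE mul_mx_diag mul_mx_diag !mxE /= idx1 idx2 jdx1 jdx2 pairingDl rmorphD /=.
by ring.
Qed.

Lemma weight_basis_iso U V d (m : 'I_d -> 'rV[R]_r) : module_iso U V ->
  weight_basis alpha U m -> weight_basis alpha V m.
Proof.
move=> [A [B [AB BA AU]]] [P [Q [PQ QP Pm]]]; exists (A *m P), (Q *m B); split.
- by rewrite mulmxA -(mulmxA A) PQ mulmx1.
- by rewrite mulmxA -(mulmxA Q) BA mulmx1.
by apply: col_diag_weight => y; rewrite mulmxA -AU -!mulmxA (diag_weight_basis y Pm).
Qed.

Lemma weight_basis_const p : weight_basis alpha (const_module g p) (fun _ : 'I_p => 0).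
Proof.
exists 1%:M, 1%:M; split; rewrite ?mulmx1 // => i y.
by rewrite /= /const_module_act mul0mx pairing0l scale0r.
Qed.

(** Weight projections preserve the stable subspace S, so the weight components of the columns of
    [I] lie in S; transported by [J] they span U. *)
Lemma weight_basis_submodule U V d (m : 'I_d -> 'rV[R]_r) S I J :
  weight_basis alpha V m -> @is_submodule _ _ U V S I J -> stable S ->
  exists l : 'I_(mdim U) -> 'rV[R]_r, weight_basis alpha U l.
Proof.
move=> [P [Q [PQ QP Pm]]] [JI IU SP] stS.
pose T := ('I_d * 'I_(mdim U))%type.
pose L (k : T) := J *m (weight_proj m P Q (m k.1) *m col k.2 I).
have colS j : col j I \in S by apply/SP; rewrite colE (mulmxA J) JI mul1mx.
have pS (k : T) : weight_proj m P Q (m k.1) *m col k.2 I \in S.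
  exact: (weight_proj_stable simple_g split_g simple_alpha PQ QP Pm _ stS (colS _)).
have xv x v : v \in S -> mact U x *m (J *m v) = J *m (mact V x *m v).
  by move=> /SP vE; rewrite -[in RHS]vE (mulmxA (mact V x)) -IU -(mulmxA I) (mulmxA J) JI mul1mx.
have [||f f_inj fb] := @weight_basis_of_span _ _ _ alpha U #|{: T}|
  (fun k => L (enum_val k)) (fun k => m (enum_val k).1).
- move=> k y; rewrite /L xv ?pS // scalemxAr; congr (_ *m _).
  exact: (weight_proj_weight simple_g split_g simple_alpha PQ QP Pm).
- move=> S' LS'; apply/eqP; rewrite eqEsubv subvf; apply/subvP => u _.
  have colS' j : delta_mx j 0 \in S'.
    have -> : delta_mx j 0 = J *m col j I by rewrite colE mulmxA JI mul1mx.
    rewrite (weight_proj_sum m PQ QP (col j I)) mulmx_sumr big_seq memv_suml // => mu.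
    rewrite mem_undup => /codomP[i ->].
    by have := LS' (enum_rank (i, j)); rewrite enum_rankK.
  have -> : u = \sum_j u j 0 *: delta_mx j 0.
    by rewrite {1}[u]matrix_sum_delta; apply: eq_bigr => j _; rewrite big_ord1.
  by rewrite memv_suml // => j _; rewrite memvZ.
by exists (fun k => m (enum_val (f k)).1).
Qed.

End OppositeRoots.

(** In [complement_exists], a, b, c, d are the dimensions of M, N, of the submodule F of the dual
    and of the annihilator of M. *)
Lemma dim_arith p a b c d : (p <= b + c -> p <= d + a -> c + d <= p -> p <= a + b)%N.
Proof. by lia. Qed.

(** * Splitting into irreducible modules *)

Section Decomposition.
Variables (R : realType) (r : nat) (g : lieAlgebra R[i]) (gR hR : set g).
Variable alpha : 'I_r -> g.
Hypothesis simple_g : is_simple g.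
Hypothesis split_g : split_real_form gR hR.
Hypothesis simple_alpha : simple_roots alpha hR.
Hypothesis r_gt0 : exists x : 'rV[R]_r, x <> 0.
Implicit Types U V T : lieModule g.

Lemma singular_dsum U V lambda (u : 'cV_(mdim U)) (v : 'cV_(mdim V)) :
  singular alpha lambda u -> singular alpha lambda v ->
  @singular _ _ _ alpha (dsum_module U V) lambda (col_mx u v).
Proof.
move=> [u0 lu su] [v0 lv sv]; split=> [uv0|y|beta x b0 bx].
- by apply: u0; rewrite -(col_mxKu u v) uv0 linear0.
- by rewrite /= /dsum_act mul_block_col !mul0mx addr0 add0r lu lv scale_col_mx.
- by rewrite /= /dsum_act mul_block_col !mul0mx addr0 add0r (su _ _ b0) // (sv _ _ b0) // col_mx0.
Qed.

(** The submodule of the direct sum generated by (u, v) is irreducible and projects nontrivially to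
    both factors; Schur's lemma makes both projections isomorphisms. *)
Lemma irreducible_unique U V lambda (u : 'cV_(mdim U)) (v : 'cV_(mdim V)) :
  irreducible U -> irreducible V -> singular alpha lambda u -> singular alpha lambda v ->
  module_iso U V.
Proof.
move=> irrU irrV su sv.
have [X [Y [w XY]]] := root_basis_exists simple_g split_g simple_alpha r_gt0.
have [mU [bU _ _]] := irreducible_weight_basis split_g simple_alpha XY irrU su.
have [mV [bV _ _]] := irreducible_weight_basis split_g simple_alpha XY irrV sv.
have bD := weight_basis_dsum bU bV.
have sD := singular_dsum su sv.
have [S [stS xS _ irrS]] := singular_irreducible simple_g split_g simple_alpha r_gt0 XY bD sD.
have [W [I [J [subW _]]]] := submodule_exists stS.
have [u0 _ _] := su; have [v0 _ _] := sv.
have irrW : irreducible W.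
  apply: submodule_irreducible subW _ irrS => S0; move: xS; rewrite S0 memv0 => /eqP x0.
  by apply: u0; rewrite -(col_mxKu u v) x0 linear0.
have [JI IW SP] := subW; have IJx := (SP _).1 xS.
have dE x : mact (dsum_module U V) x *m I
    = col_mx (mact U x *m usubmx I) (mact V x *m dsubmx I).
  by rewrite -[I in LHS]vsubmxK /= /dsum_act mul_block_col !mul0mx addr0 add0r.
have WU : module_iso W U.
  apply: (@schur _ _ W U (usubmx I) irrW irrU) => [x|I0].
    have := congr1 usubmx (IW x); rewrite dE col_mxKu => <-.
    by rewrite -[I in RHS]vsubmxK mul_col_mx col_mxKu.
  by apply: u0; rewrite -(col_mxKu u v) -IJx -[I]vsubmxK I0 mul_col_mx col_mxKu mul0mx.
have WV : module_iso W V.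
  apply: (@schur _ _ W V (dsubmx I) irrW irrV) => [x|I0].
    have := congr1 dsubmx (IW x); rewrite dE col_mxKd => <-.
    by rewrite -[I in RHS]vsubmxK mul_col_mx col_mxKd.
  by apply: v0; rewrite -(col_mxKd u v) -IJx -[I]vsubmxK I0 mul_col_mx col_mxKd mul0mx.
exact: module_iso_trans (module_iso_sym WU) WV.
Qed.

(* The complement is the annihilator of the submodule of the dual generated by
   a functional dual to the chosen highest weight vector. *)
Lemma complement_exists T d (m : 'I_d -> 'rV[R]_r) : weight_basis alpha T m ->
  (0 < mdim T)%N -> exists i (v : 'cV_(mdim T)) (M N : {vspace 'cV_(mdim T)}),
  [/\ singular alpha (m i) v, v \in M, stable M /\ stable N,
      (forall S, stable S -> (S <= M)%VS -> S <> 0%VS -> S = M) &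
      (M + N = fullv)%VS /\ (M :&: N = 0)%VS].
Proof.
move=> bm T_gt0; have [P [Q [PQ QP Pm]]] := bm.
have [X [Y [w XY]]] := root_basis_exists simple_g split_g simple_alpha r_gt0.
have i1 : 'I_d.
  case: d m P Q PQ QP {Pm} bm => [|d] m P Q PQ QP bm; last exact: ord0.
  have /matrixP/(_ (Ordinal T_gt0) (Ordinal T_gt0)) := PQ.
  by rewrite !mxE big_ord0 eqxx => /eqP; rewrite eq_sym oner_eq0.
case: (@arg_maxP _ _ _ i1 xpredT (fun i => height (m i))) => // i _ imax'.
have imax j : height (m j) <= height (m i) by exact: imax'.
have sv := max_weight_singular simple_g split_g simple_alpha PQ QP Pm imax.
pose alpha' := opp_roots alpha.
have simple_alpha' := simple_roots_opp simple_g split_g simple_alpha r_gt0.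
have [X' [Y' [w' XY']]] := root_basis_exists simple_g split_g simple_alpha' r_gt0.
have Qm := weight_basis_dual PQ QP Pm.
have PQt : Q^T *m P^T = 1%:M by rewrite -trmx_mul PQ trmx1.
have QPt : P^T *m Q^T = 1%:M by rewrite -trmx_mul QP trmx1.
have bm' : weight_basis alpha' (dual_module T) m by exists Q^T, P^T.
have sphi := max_weight_singular (V := dual_module T) simple_g split_g simple_alpha' PQt QPt Qm imax.
have [M [stM vM _ irrM]] := singular_irreducible simple_g split_g simple_alpha r_gt0 XY bm sv.
have [F [stF phiF _ irrF]] :=
  singular_irreducible simple_g split_g simple_alpha' r_gt0 XY' bm' sphi.
have [N [NP dimN]] := @annihilator R (mdim T) F.
have [A [AP dimA]] := annihilator M.
have phi_v : (col i Q^T)^T *m col i P = 1%:M.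
  rewrite -tr_row trmxK -row_mul colE mulmxA QP mul1mx; apply/matrixP => a b.
  by rewrite !mxE !ord1 !eqxx.
have dualE (x : g) (psi v : 'cV[R[i]]_(mdim T)) :
    psi^T *m (mact T x *m v) = - ((mact (dual_module T) x *m psi)^T *m v).
  by rewrite /= /dual_act mulNmx linearN /= trmx_mul trmxK mulNmx opprK mulmxA.
have stN : @stable _ _ T N.
  move=> x v /NP vN; apply/NP => psi pF; rewrite dualE vN ?oppr0 //; exact: stF.
(* Since M is irreducible, a nonzero intersection would be M itself; but v lies in M and the
   functional phi in F takes the value 1 on v. *)
have MN0 : (M :&: N = 0)%VS.
  apply: contrapT => MN0.
  have MNM : (M :&: N)%VS = M.
    apply: irrM MN0; last exact: capvSl.
    by move=> x v /memv_capP[vM' vN]; apply/memv_capP; split; [exact: stM|exact: stN].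
  move: vM; rewrite -MNM => /memv_capP[_ /NP/(_ _ phiF)].
  rewrite phi_v => /matrixP/(_ 0 0); rewrite !mxE => /eqP; apply/negP; exact: oner_neq0.
(* The same argument with the roles of T and its dual exchanged. It bounds dim F + dim A, from which
   M + N has full dimension. *)
have FA0 : (F :&: A = 0)%VS.
  apply: contrapT => FA0.
  have FAF : (F :&: A)%VS = F.
    apply: irrF FA0; last exact: capvSl.
    move=> x psi /memv_capP[pF /AP pA]; apply/memv_capP; split; first exact: stF.
    apply/AP => v vM'; apply: trmx_inj; rewrite trmx0 trmx_mul trmxK.
    apply/eqP; rewrite -oppr_eq0 -dualE; apply/eqP.
    by apply: trmx_inj; rewrite trmx0 trmx_mul trmxK pA //; exact: stM.
  move: phiF; rewrite -FAF => /memv_capP[_ /AP/(_ _ vM)].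
  move=> /(congr1 trmx); rewrite trmx_mul trmxK phi_v trmx0.
  by move=> /matrixP/(_ 0 0); rewrite !mxE => /eqP; apply/negP; exact: oner_neq0.
exists i, (col i P), M, N; split=> //; split=> //.
apply/eqP; rewrite eqEdim subvf dim_cV dimv_disjoint_sum //.
have := dimvS (subvf (F + A)%VS); rewrite dim_cV dimv_disjoint_sum //.
exact: dim_arith dimN dimA.
Qed.

Lemma dsum_submodules T M N U V I J I' J' :
  @is_submodule _ _ U T M I J -> @is_submodule _ _ V T N I' J' ->
  (M + N)%VS = fullv -> (M :&: N = 0)%VS -> module_iso (dsum_module U V) T.
Proof.
move=> [JI IU MP] [JI' IV NP] MN MN0.
apply: (@bijective_iso _ _ (dsum_module U V) T (row_mx I I')) => [x|v|v].
- by rewrite /= /dsum_act mul_row_block !mulmx0 addr0 add0r mul_mx_row IU IV.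
- rewrite -[v]vsubmxK mul_row_col => /eqP; rewrite addr_eq0 => /eqP IE.
  have Iv : I *m usubmx v \in (M :&: N)%VS.
    apply/memv_capP; split; first by apply/MP; rewrite (mulmxA J) JI mul1mx.
    by rewrite IE memvN; apply/NP; rewrite (mulmxA J') JI' mul1mx.
  move: Iv; rewrite MN0 memv0 => /eqP Iv0.
  have -> : usubmx v = 0 by rewrite -[LHS]mul1mx -JI -mulmxA Iv0 mulmx0.
  have /eqP : I' *m dsubmx v = 0 by apply/eqP; rewrite -oppr_eq0 -IE Iv0.
  by move=> /eqP Iv1; rewrite -[dsubmx v]mul1mx -JI' -mulmxA Iv1 mulmx0 col_mx0.
- have : v \in (M + N)%VS by rewrite MN memvf.
  move=> /memv_addP[a /MP aE [b /NP bE ->]]; exists (col_mx (J *m a) (J' *m b)).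
  by rewrite mul_row_col aE bE.
Qed.

Variable VV : 'rV[R]_r -> lieModule g.
Hypothesis hVV : highest_weight_modules alpha VV.

(** Induction on the dimension, splitting off the irreducible submodule at a weight of maximal
    height. This existence is what makes the choice [components] a genuine decomposition. *)
Lemma decomposition_exists T d (m : 'I_d -> 'rV[R]_r) : weight_basis alpha T m ->
  exists s, decomposition alpha VV T s.
Proof.
elim/ltn_ind: (mdim T) {-2}T (erefl (mdim T)) d m => p IH {}T dimT d m bm.
have [T0|T_gt0] := posnP (mdim T).
  by exists [::]; split=> //; rewrite big_nil; exact: module_iso_zero.
have [i [v [M [N [sv vM [stM stN] irrM [MN MN0]]]]]] := complement_exists bm T_gt0.
have [U [I [J [subU dimU]]]] := submodule_exists stM.
have [V [I' [J' [subV dimV]]]] := submodule_exists stN.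
have dl := singular_dominant simple_g split_g simple_alpha r_gt0 sv.
have [v0 _ _] := sv.
have M0 : M <> 0%VS by move=> M0; move: vM; rewrite M0 memv0 => /eqP.
have irrU := submodule_irreducible subU M0 irrM.
have sU := submodule_singular subU vM sv.
have [irrL /(highest_weightP split_g simple_alpha)[l sl]] := hVV dl.
have UL := irreducible_unique irrU irrL sU sl.
have [m' bV] := weight_basis_submodule simple_g split_g simple_alpha bm subV stN.
have [|s [sdom Vs]] := IH (mdim V) _ V erefl _ _ bV.
  have := dim_cV R[i] (mdim T); rewrite -MN dimv_disjoint_sum // -dimU -dimV dimT => <-.
  by rewrite -{1}[mdim V]add0n ltn_add2r; case: irrU.
exists (m i :: s); split=> [x|].
  by rewrite inE => /predU1P[->|/sdom].
rewrite big_cons; apply: module_iso_trans (module_iso_dsum UL Vs).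
apply: module_iso_sym; exact: dsum_submodules subU subV MN MN0.
Qed.

End Decomposition.

(** * Weights and characters *)

Section Characters.
Variables (R : realType) (r : nat) (g : lieAlgebra R[i]) (gR hR : set g).
Variable alpha : 'I_r -> g.
Hypothesis simple_g : is_simple g.
Hypothesis split_g : split_real_form gR hR.
Hypothesis simple_alpha : simple_roots alpha hR.
Hypothesis r_gt0 : exists x : 'rV[R]_r, x <> 0.
Implicit Types U V T : lieModule g.

Lemma dim_weight_space V d (m : 'I_d -> 'rV[R]_r) mu : weight_basis alpha V m ->
  \dim (weight_space alpha V mu) = #|[pred i | m i == mu]|.
Proof.
move=> [P [Q [PQ QP Pm]]]; set S := [pred i | m i == mu].
pose X := [tuple col (enum_val j) P | j < #|S|].
have XE (j : 'I_#|S|) : X`_j = col (enum_val j) P by rewrite -tnth_nth tnth_mktuple.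
have QX (j : 'I_#|S|) : Q *m X`_j = delta_mx (enum_val j) 0.
  by rewrite XE colE mulmxA QP mul1mx.
have fX : free X.
  apply/freeP => k k0 i; have := congr1 (mulmx Q) k0; rewrite mulmx0 mulmx_sumr.
  move=> /colP/(_ (enum_val i)); rewrite summxE [RHS]mxE (bigD1 i) //= big1 => [|j ji].
    by rewrite -scalemxAr QX !mxE !eqxx addr0 mulr1.
  rewrite -scalemxAr QX !mxE (inj_eq enum_val_inj) eq_sym (negPf ji).
  by rewrite mulr0.
have -> : weight_space alpha V mu = <<X>>%VS.
  apply/eqP; rewrite eqEsubv; apply/andP; split.
    apply/subvP => v /(weight_spaceP split_g simple_alpha).
    move=> /(weight_vectorP simple_g split_g simple_alpha PQ QP Pm) v0.
    rewrite (weight_basis_expand PQ v) memv_suml // => i _.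
    have [mi|/v0 ->] := eqVneq (m i) mu; last by rewrite scale0r mem0v.
    have iS : i \in S by rewrite inE mi.
    rewrite memvZ // memv_span //; apply/tnthP; exists (enum_rank_in iS i).
    by rewrite tnth_mktuple enum_rankK_in.
  apply/span_subvP => v /tnthP[j ->]; rewrite tnth_mktuple.
  apply/(weight_spaceP split_g simple_alpha).
  by have := enum_valP j; rewrite inE => /eqP <-; exact: Pm.
by move/eqP: fX => ->; rewrite size_tuple.
Qed.

(** Each weight occurs in a weight basis as often as the dimension of its weight space, so such sums
    depend on the module only. The target is any commutative monoid: counts, reals and complex
    numbers are all used. *)
Lemma weight_basis_sum_dim (A : nmodType) V d (m : 'I_d -> 'rV[R]_r) (F : 'rV[R]_r -> A) s :
  weight_basis alpha V m -> uniq s -> {subset codom m <= s} ->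
  \sum_i F (m i) = \sum_(mu <- s) F mu *+ \dim (weight_space alpha V mu).
Proof.
move=> bm us ms.
transitivity (\sum_(mu <- s) \sum_i if m i == mu then F mu else 0); last first.
  apply: eq_bigr => mu _; rewrite (dim_weight_space _ bm) -sum1_card -sumrMnr.
  by rewrite [RHS]big_mkcond.
rewrite exchange_big; apply: eq_bigr => i _.
rewrite (bigD1_seq (m i)) ?ms ?codom_f //= eqxx big1 ?addr0 // => mu mm.
by rewrite eq_sym (negPf mm).
Qed.

Lemma weight_basis_sum_eq (A : nmodType) V d e (m : 'I_d -> 'rV[R]_r) (l : 'I_e -> 'rV[R]_r)
    (F : 'rV[R]_r -> A) :
  weight_basis alpha V m -> weight_basis alpha V l -> \sum_i F (m i) = \sum_i F (l i).
Proof.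
move=> bm bl; pose s := undup (codom m ++ codom l).
rewrite (weight_basis_sum_dim F (s := s) bm) ?undup_uniq //; last first.
  by move=> mu ml; rewrite mem_undup mem_cat ml.
rewrite (weight_basis_sum_dim F (s := s) bl) ?undup_uniq //.
by move=> mu ml; rewrite mem_undup mem_cat ml orbT.
Qed.

Lemma characterE V d (m : 'I_d -> 'rV[R]_r) y : weight_basis alpha V m ->
  character alpha V y = \sum_i expR (pairing alpha (m i) y).
Proof.
move=> bm; pose s := undup (codom m).
rewrite (weight_basis_sum_dim (fun mu => expR (pairing alpha mu y)) (s := s) bm) ?undup_uniq //.
  rewrite /character (fsbigE s) ?undup_uniq //.
    by apply: eq_big => [mu|mu _]; [rewrite in_setT|rewrite mulr_natl].
  move=> mu _; rewrite mem_undup => ml; rewrite (dim_weight_space _ bm) eq_card0 ?mul0r // => i.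
  by rewrite inE; apply/negP => /eqP mi; rewrite -mi codom_f in ml.
by move=> mu; rewrite mem_undup.
Qed.

(* Junk unless [V] has a basis of weight vectors. *)
Definition weights V : 'I_(mdim V) -> 'rV[R]_r := xget (fun=> 0) [set m | weight_basis alpha V m].

Section Highest.
Variable VV : 'rV[R]_r -> lieModule g.
Hypothesis hVV : highest_weight_modules alpha VV.

Lemma weightsP lambda : dominant_integral alpha lambda ->
  weight_basis alpha (VV lambda) (@weights (VV lambda)).
Proof.
move=> /hVV[irr /(highest_weightP split_g simple_alpha)[v sv]].
have [X [Y [w XY]]] := root_basis_exists simple_g split_g simple_alpha r_gt0.
have [m [bm _ _]] := irreducible_weight_basis split_g simple_alpha XY irr sv.
by rewrite /weights; case: xgetP => // /(_ m).
Qed.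

Lemma weights_le lambda j a : dominant_integral alpha lambda ->
  (@weights (VV lambda) j - lambda) 0 a <= 0.
Proof.
move=> dl; have [X [Y [w XY]]] := root_basis_exists simple_g split_g simple_alpha r_gt0.
have [irr /(highest_weightP split_g simple_alpha)[v sv]] := hVV dl.
have [m [bm le_m _]] := irreducible_weight_basis split_g simple_alpha XY irr sv.
(* Counting the occurrences of the weight of index j in both bases shows that it is one of the
   [m i], for which the bound is known. *)
have := weight_basis_sum_eq (fun mu => (mu == @weights (VV lambda) j : nat)) (weightsP dl) bm.
rewrite (bigD1 j) //= eqxx; have [/existsP[i /eqP <-]//|] := boolP [exists i, m i == weights j].
by rewrite negb_exists => /forallP mj; rewrite [RHS]big1 // => i _; rewrite (negPf (mj i)).
Qed.

(** The constant is [weight_bound], which depends on the roots and t alone and is therefore uniform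
    in lambda. *)
Lemma weights_bound t : (forall a, 0 < pairing alpha (delta_mx 0 a) t) ->
  exists C, forall lambda, dominant_integral alpha lambda ->
    \sum_i expR (pairing alpha (@weights (VV lambda) i - lambda) t) <= C.
Proof.
move=> t0; have [X [Y [w XY]]] := root_basis_exists simple_g split_g simple_alpha r_gt0.
exists (weight_bound alpha w t) => lambda dl.
have [irr /(highest_weightP split_g simple_alpha)[v sv]] := hVV dl.
have [m [bm _ le_m]] := irreducible_weight_basis split_g simple_alpha XY irr sv.
rewrite (weight_basis_sum_eq (fun mu => expR (pairing alpha (mu - lambda) t)) (weightsP dl) bm).
exact: le_m.
Qed.

Lemma character_ge t lambda : dominant_integral alpha lambda ->
  expR (pairing alpha lambda t) <= character alpha (VV lambda) t.
Proof.
move=> dl; rewrite (characterE _ (weightsP dl)).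
have [_ /(highest_weightP split_g simple_alpha)[v [v0 lv _]]] := hVV dl.
have [i li] := weight_mem simple_g split_g simple_alpha (weightsP dl) v0 lv.
by rewrite -{1}li (bigD1 i) //= lerDl sumr_ge0 // => j _; exact: expR_ge0.
Qed.

(** If all weights agree on u, then u acts by a scalar and every [x, u] acts by 0. The kernel of the
    action is an ideal: if it is 0 then u is central, hence 0; if it is g then the highest weight nu
    is 0. *)
Lemma weights_separate nu u c : dominant_integral alpha nu -> nu <> 0 ->
  (forall i, pairing alpha (@weights (VV nu) i) u = c) -> u = 0.
Proof.
move=> dn n0 uc; have [_ /(highest_weightP split_g simple_alpha)[v [v0 nv _]]] := hVV dn.
have [P [Q [PQ QP Pm]]] := weightsP dn.
have uE : mact (VV nu) (cvec alpha u) = (c%:C%C)%:M.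
  rewrite -[LHS]mulmx1 -PQ mulmxA (diag_weight_basis u Pm).
  have -> : diag_mx (\row_j (pairing alpha (@weights (VV nu) j) u)%:C%C) = (c%:C%C)%:M.
    by apply/matrixP => i j; rewrite !mxE uc.
  by rewrite mul_mx_scalar -scalemxAl PQ scalemx1.
have [||S SP] := @vspace_comprehension _ g (fun x => mact (VV nu) x = 0).
- by rewrite linear0.
- by move=> a x y x0 y0; rewrite linearP /= x0 y0 scaler0 addr0.
have [_ /(_ S)[x y /SP y0|S0|SF]] := simple_g.
- by apply/SP; rewrite mact_br y0 mulmx0 mul0mx subrr.
- apply: (cvec_inj simple_alpha); rewrite cvec0.
  apply: (center_trivial simple_g) => x; apply/eqP; rewrite -memv0 -S0; apply/SP.
  by rewrite mact_br uE scalar_mxC subrr.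
- case: n0; apply: (pairing_inj simple_g split_g simple_alpha) => z.
  have /SP z0 : cvec alpha z \in S by rewrite SF memvf.
  have := nv z; rewrite z0 mul0mx => /esym/eqP; rewrite scaler_eq0 => /orP[/eqP zn|/eqP //].
  by rewrite pairing0l; apply: (@realC_inj R).
Qed.

(** The weights are fixed before the ring [A] and the function [psi], so one family serves both real
    exponentials and complex characters. *)
Lemma weight_basis_tensor_pow V n : (exists d (m : 'I_d -> 'rV[R]_r), weight_basis alpha V m) ->
  exists d (m : 'I_d -> 'rV[R]_r), weight_basis alpha (tensor_pow V n) m /\
  forall (A : comNzRingType) (psi : 'rV[R]_r -> A), psi 0 = 1 ->
    (forall x y, psi (x + y) = psi x * psi y) ->
    forall d' (l : 'I_d' -> 'rV[R]_r), weight_basis alpha V l ->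
    \sum_i psi (m i) = (\sum_i psi (l i)) ^+ n.
Proof.
move=> [d [m bm]]; elim: n => [|n [e [l [bl lE]]]].
  exists 1%N, (fun=> 0); split; first exact: weight_basis_const.
  by move=> A psi psi0 _ d' l _; rewrite big_ord1 psi0 expr0.
exists (d * e)%N, (fun k : 'I_(d * e) => m (mxtens_unindex k).1 + l (mxtens_unindex k).2).
split=> [|A psi psi0 psiD d' l' bl']; first exact: weight_basis_tensor bm bl.
transitivity ((\sum_i psi (m i)) * (\sum_i psi (l i))).
  by rewrite mulr_sum; apply: eq_bigr => i _; rewrite psiD.
rewrite (lE _ _ psi0 psiD _ _ bl') exprS; congr (_ * _).
exact: weight_basis_sum_eq bm bl'.
Qed.

Lemma weight_basis_big_tensor k (nu : 'I_k -> 'rV[R]_r) (N : 'I_k -> nat) :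
  (forall i, dominant_integral alpha (nu i)) ->
  exists d (m : 'I_d -> 'rV[R]_r), weight_basis alpha (big_tensor VV nu N) m /\
  forall (A : comNzRingType) (psi : 'rV[R]_r -> A), psi 0 = 1 ->
    (forall x y, psi (x + y) = psi x * psi y) ->
    \sum_i psi (m i) = \prod_i (\sum_j psi (@weights (VV (nu i)) j)) ^+ N i.
Proof.
move=> dnu; rewrite /big_tensor; elim: (index_enum _) => [|i s [d [m [bm mE]]]].
  exists 1%N, (fun=> 0); split; first by rewrite big_nil; exact: weight_basis_const.
  by move=> A psi psi0 _; rewrite big_nil big_ord1 psi0.
have [|e [l [bl lE]]] := @weight_basis_tensor_pow (VV (nu i)) (N i).
  by exists (mdim (VV (nu i))), (@weights _); exact: weightsP.
exists (e * d)%N, (fun k : 'I_(e * d) => l (mxtens_unindex k).1 + m (mxtens_unindex k).2).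
split=> [|A psi psi0 psiD]; first by rewrite big_cons; exact: weight_basis_tensor bl bm.
transitivity ((\sum_i psi (l i)) * (\sum_i psi (m i))).
  by rewrite mulr_sum; apply: eq_bigr => j _; rewrite psiD.
by rewrite (mE _ _ psi0 psiD) (lE _ _ psi0 psiD _ _ (weightsP (dnu i))) big_cons.
Qed.

Lemma weight_basis_big_dsum s : (forall lambda, lambda \in s -> dominant_integral alpha lambda) ->
  exists d (m : 'I_d -> 'rV[R]_r),
  weight_basis alpha (\big[@dsum_module _ g/@zero_module _ g]_(lambda <- s) VV lambda) m /\
  forall (A : nmodType) (F : 'rV[R]_r -> A),
    \sum_i F (m i) = \sum_(lambda <- s) \sum_j F (@weights (VV lambda) j).
Proof.
elim: s => [|lambda s IH] ds.
  exists 0%N, (fun=> 0); split; first by rewrite big_nil; exact: weight_basis_const.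
  by move=> A F; rewrite big_nil big_ord0.
have [|d [m [bm mE]]] := IH; first by move=> mu ms; apply: ds; rewrite inE ms orbT.
have bl := weightsP (ds _ (mem_head _ _)).
exists (mdim (VV lambda) + d)%N, (fun k : 'I_(mdim (VV lambda) + d) =>
  match fintype.split k with inl i => @weights _ i | inr j => m j end).
split=> [|A F]; first by rewrite big_cons; exact: weight_basis_dsum bl bm.
rewrite big_cons -mE big_split_ord /=; congr (_ + _); apply: eq_bigr => j _.
  by case: splitP => k /= jk; [rewrite (ord_inj jk)|have := ltn_ord j; rewrite jk ltnNge leq_addr].
case: splitP => k /= jk; first by have := ltn_ord k; rewrite -jk ltnNge leq_addr.
by have -> : j = k by apply/ord_inj/eqP; rewrite -(eqn_add2l (mdim (VV lambda))) jk.
Qed.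

(** The weights of the tensor product are counted twice: through its decomposition, and as sums of
    weights of the factors, where multiplicative functions turn into products. *)
Lemma components_weights k (nu : 'I_k -> 'rV[R]_r) (N : 'I_k -> nat) :
  (forall i, dominant_integral alpha (nu i)) ->
  (forall lambda, lambda \in components alpha VV (big_tensor VV nu N) ->
     dominant_integral alpha lambda) /\
  exists d (m : 'I_d -> 'rV[R]_r),
  (forall (A : nmodType) (F : 'rV[R]_r -> A),
    \sum_(lambda <- components alpha VV (big_tensor VV nu N))
      \sum_j F (@weights (VV lambda) j) = \sum_i F (m i)) /\
  forall (A : comNzRingType) (psi : 'rV[R]_r -> A), psi 0 = 1 ->
    (forall x y, psi (x + y) = psi x * psi y) ->
    \sum_i psi (m i) = \prod_i (\sum_j psi (@weights (VV (nu i)) j)) ^+ N i.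
Proof.
move=> dnu; have [d [m [bm mE]]] := weight_basis_big_tensor N dnu.
have [s0 s0P] := decomposition_exists simple_g split_g simple_alpha r_gt0 hVV bm.
have [dom iso] : decomposition alpha VV (big_tensor VV nu N)
    (components alpha VV (big_tensor VV nu N)).
  by rewrite /components; case: xgetP => // /(_ s0).
split=> //; exists d, m; split=> // A F.
have [d' [m' [bm' mE']]] := weight_basis_big_dsum dom.
by rewrite -mE'; apply: weight_basis_sum_eq bm' (weight_basis_iso iso bm).
Qed.

End Highest.

End Characters.

(** * Gaussian integrals *)

Section Taylor.
Variable R : realType.
Implicit Types x y u a b h : R.

Lemma ge0_of_derive (f df : R -> R) : (forall x, is_derive x 1 f (df x)) -> f 0 = 0 ->
  (forall x, 0 <= x -> 0 <= df x) -> forall x, 0 <= x -> 0 <= f x.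
Proof.
move=> fd f0 df0 x; rewrite le_eqVlt => /predU1P[<-|x0]; first by rewrite f0.
have [|c cI] := @MVT R f df 0 x x0 (fun z _ => fd z).
  by apply: derivable_within_continuous => z _; have [] := fd z.
rewrite f0 !subr0 => ->; rewrite mulr_ge0 ?(ltW x0) // df0 //.
by move: cI; rewrite in_itv /= => /andP[/ltW].
Qed.

(** This and the next three bounds each follow from the previous one by [ge0_of_derive], starting
    from cos <= 1. *)
Lemma sin_le x : 0 <= x -> sin x <= x.
Proof.
move=> x0; rewrite -subr_ge0; move: x x0; apply: (@ge0_of_derive (fun x => x - sin x) (fun x => 1 - cos x)).
- by rewrite sin0 subrr.
- by move=> z _; rewrite subr_ge0 cos_le1.
Qed.

Lemma cos_ge x : 0 <= x -> 1 - x ^+ 2 / 2 <= cos x.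
Proof.
move=> x0; rewrite -subr_ge0; move: x x0.
apply: (@ge0_of_derive (fun x => cos x - (1 - x ^+ 2 / 2)) (fun x => x - sin x)).
- by move=> z; apply: is_derive_eq; rewrite /GRing.scale /=; field.
- by rewrite cos0 expr0n /= mul0r subr0 subrr.
- by move=> z z0; rewrite subr_ge0 sin_le.
Qed.

Lemma sin_ge x : 0 <= x -> x - x ^+ 3 / 6 <= sin x.
Proof.
move=> x0; rewrite -subr_ge0; move: x x0.
apply: (@ge0_of_derive (fun x => sin x - (x - x ^+ 3 / 6)) (fun x => cos x - (1 - x ^+ 2 / 2))).
- by move=> z; apply: is_derive_eq; rewrite /GRing.scale /=; field.
- by rewrite sin0 expr0n /= mul0r subr0 subrr.
- by move=> z z0; rewrite subr_ge0 cos_ge.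
Qed.

Lemma cos_le x : 0 <= x -> cos x <= 1 - x ^+ 2 / 2 + x ^+ 4 / 24.
Proof.
move=> x0; rewrite -subr_ge0; move: x x0.
apply: (@ge0_of_derive (fun x => (1 - x ^+ 2 / 2 + x ^+ 4 / 24) - cos x)
  (fun x => sin x - (x - x ^+ 3 / 6))).
- by move=> z; apply: is_derive_eq; rewrite /GRing.scale /=; field.
- by rewrite cos0 !expr0n /= !mul0r subr0 addr0 subrr.
- by move=> z z0; rewrite subr_ge0 sin_ge.
Qed.

Lemma cos_taylor x : `|cos x - (1 - x ^+ 2 / 2)| <= x ^+ 4 / 24.
Proof.
wlog x0 : x / 0 <= x => [H|].
  have [/H//|/ltW x0] := leP 0 x.
  by have := H (- x); rewrite oppr_ge0 cosN sqrrN -[4%N]/(2 * 2)%N exprM sqrrN exprM; exact.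
have := cos_ge x0; have := cos_le x0 => h1 h2.
by rewrite ger0_norm; lra.
Qed.

Lemma sin_taylor x : `|sin x - x| <= `|x| ^+ 3 / 6.
Proof.
wlog x0 : x / 0 <= x => [H|].
  have [/H//|/ltW x0] := leP 0 x.
  by have := H (- x); rewrite oppr_ge0 sinN normrN -opprD normrN; exact.
have := sin_le x0; have := sin_ge x0 => h1 h2.
by rewrite (ger0_norm x0) ler0_norm; lra.
Qed.

Lemma cos_diff_le x : `|cos x - 1| <= x ^+ 2 / 2.
Proof.
wlog x0 : x / 0 <= x => [H|].
  have [/H//|/ltW x0] := leP 0 x.
  by have := H (- x); rewrite oppr_ge0 cosN sqrrN; exact.
have := cos_ge x0; have := cos_le1 x => h1 h2.
by rewrite ler0_norm; lra.
Qed.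

Lemma sin_norm_le x : `|sin x| <= `|x|.
Proof.
wlog x0 : x / 0 <= x => [H|].
  have [/H//|/ltW x0] := leP 0 x.
  by have := H (- x); rewrite oppr_ge0 sinN !normrN; exact.
rewrite (ger0_norm x0) ler_norml sin_le // andbT.
apply: (@le_trans _ _ (- x)) => //; have [x2|x2] := leP x 2.
  apply: le_trans (sin_ge x0); rewrite (exprS x 2).
  have : x * x ^+ 2 <= x * 4 by rewrite ler_wpM2l // expr2; nra.
  by lra.
by apply: le_trans (sin_geN1 x); lra.
Qed.

Lemma cos_first_order a h : `|cos (a + h) - cos a + h * sin a| <= h ^+ 2.
Proof.
have -> : cos (a + h) - cos a + h * sin a = cos a * (cos h - 1) - sin a * (sin h - h).
  by rewrite cosD; ring.
apply: (le_trans (ler_normB _ _)); rewrite !normrM.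
have c1 : `|cos a| <= 1 by rewrite ler_norml cos_geN1 cos_le1.
have s1 : `|sin a| <= 1 by rewrite ler_norml sin_geN1 sin_le1.
have sh : `|sin h - h| <= h ^+ 2 / 2.
  (* For |h| <= 3 the cubic bound |h|^3 / 6 is at most h^2 / 2; beyond 3 already 1 + |h| is. *)
  have [h3|h3] := leP `|h| 3.
    apply: (le_trans (sin_taylor h)); rewrite -(real_normK (num_real h)).
    by have := normr_ge0 h; nra.
  apply: (le_trans (ler_normB _ _)); rewrite -(real_normK (num_real h)).
  have : `|sin h| <= 1 by rewrite ler_norml sin_geN1 sin_le1.
  by nra.
have ch := cos_diff_le h.
have := ler_pM (normr_ge0 _) (normr_ge0 _) c1 ch.
have := ler_pM (normr_ge0 _) (normr_ge0 _) s1 sh.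
by lra.
Qed.

Lemma expR_taylor y : 0 <= y -> `|expR (- y) - (1 - y)| <= y ^+ 2.
Proof.
move=> y0; have h1 : 1 - y <= expR (- y) by exact: expR_ge1Dx.
rewrite ger0_norm ?subr_ge0 //.
have h2 : expR (- y) * (1 + y) <= 1.
  rewrite -[leRHS](expRxMexpNx_1 y) mulrC ler_wpM2r ?expR_ge0 //; exact: expR_ge1Dx.
have : expR (- y) <= 1 by rewrite -[leRHS]expR0 ler_expR oppr_le0.
by nra.
Qed.

End Taylor.

(** * One-dimensional Gaussian integrals *)

Section GaussianIntegral.
Variable R : realType.
Implicit Types (x u y k c C theta : R) (f F G : R -> R).

Local Notation "\I F" := (Rintegral (@lebesgue_measure R) setT F) (at level 10).

Definition gauss_dominated C c F := continuous F /\ forall x, `|F x| <= C * expR (- c * x ^+ 2).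

Lemma gaussE y k x : 0 < k ->
  expR (- (k / 2) * (x - y) ^+ 2) = normal_pdf y (Num.sqrt k^-1) x * Num.sqrt (2 * pi / k).
Proof.
move=> k0; have s0 : Num.sqrt k^-1 != 0 by rewrite gt_eqF // sqrtr_gt0 invr_gt0.
rewrite normal_pdfE // /normal_peak /normal_fun sqr_sqrtr ?invr_ge0 ?ltW //.
have -> : k^-1 * pi *+ 2 = 2 * pi / k by rewrite -mulr_natl; ring.
rewrite mulrAC mulVf ?mul1r.
  by congr expR; rewrite -mulr_natl; field; exact: lt0r_neq0.
by rewrite gt_eqF // sqrtr_gt0 divr_gt0 // mulr_gt0 // pi_gt0.
Qed.

Lemma gauss_integrable y k C : 0 < k ->
  (@lebesgue_measure R).-integrable setT (EFin \o (fun x => C * expR (- (k / 2) * (x - y) ^+ 2))).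
Proof.
move=> k0; have := integrable_normal_pdf y (Num.sqrt k^-1).
move=> /(integrableZl measurableT (C * Num.sqrt (2 * pi / k))); apply: eq_integrable => // x _.
by rewrite /= gaussE // [normal_pdf _ _ _ * _]mulrC mulrA.
Qed.

Lemma gauss_integral y k : 0 < k ->
  \I (fun x => expR (- (k / 2) * (x - y) ^+ 2)) = Num.sqrt (2 * pi / k).
Proof.
move=> k0; rewrite /Rintegral.
under eq_integral do rewrite gaussE // mulrC EFinM.
rewrite integralZl // ?integral_normal_pdf ?mule1 //.
exact: integrable_normal_pdf.
Qed.

Lemma gauss_dominated_integrable C c F : 0 < c -> gauss_dominated C c F ->
  (@lebesgue_measure R).-integrable setT (EFin \o F).
Proof.
move=> c0 [cF leF]; apply: le_integrable (@gauss_integrable 0 (2 * c) C _) => //.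
- by apply/measurable_EFinP; exact: continuous_measurable_fun.
- move=> x _; rewrite lee_fin; apply: le_trans (ler_norm _); rewrite subr0.
  by have -> : 2 * c / 2 = c by field.
- by rewrite mulr_gt0.
Qed.

Lemma gauss_dominated_D C c C' c' F G : 0 < c -> 0 < c' ->
  gauss_dominated C c F -> gauss_dominated C' c' G ->
  \I (fun x => F x + G x) = \I F + \I G.
Proof.
by move=> c0 c0' dF dG; rewrite RintegralD //; exact: gauss_dominated_integrable dF || exact: gauss_dominated_integrable dG.
Qed.

Lemma gauss_dominated_le_int C c F : 0 < c -> gauss_dominated C c F ->
  `|\I F| <= C * Num.sqrt (pi / c).
Proof.
move=> c0 dF; have iF := gauss_dominated_integrable c0 dF.
apply: (le_trans (le_normr_Rintegral _ iF)) => //.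
have <- : \I (fun x => C * expR (- (2 * c / 2) * (x - 0) ^+ 2)) = C * Num.sqrt (pi / c).
  rewrite RintegralZl //; last first.
    have := @gauss_integrable 0 (2 * c) 1; rewrite mulr_gt0 // => /(_ isT).
    by apply: eq_integrable => // x _; rewrite /= mul1r.
  rewrite gauss_integral ?mulr_gt0 //; congr (_ * Num.sqrt _).
  by field; exact: lt0r_neq0.
apply: le_Rintegral => //.
- exact: integrable_norm.
- by apply: gauss_integrable; rewrite mulr_gt0.
- move=> x _; rewrite subr0; have -> : 2 * c / 2 = c by field.
  by case: dF => _ /(_ x).
Qed.

Lemma gauss_dominated_cvg C c (F_ : nat -> R -> R) F : 0 < c ->
  (forall n, gauss_dominated C c (F_ n)) -> continuous F ->
  (forall x, F_ n x @[n --> \oo] --> F x) ->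
  \I (F_ n) @[n --> \oo] --> \I F.
Proof.
move=> c0 dF cF FF.
have [||||| iF _ cvgI] := @dominated_convergence _ _ R (@lebesgue_measure R) setT measurableT
  (fun n => EFin \o F_ n) (EFin \o F) (EFin \o (fun x => C * expR (- (2 * c / 2) * (x - 0) ^+ 2))).
- by move=> n; apply/measurable_EFinP; apply: continuous_measurable_fun; case: (dF n).
- by apply/measurable_EFinP; exact: continuous_measurable_fun.
- by apply: aeW => x _; apply: cvg_EFin; [exact: nearW|exact: FF].
- by apply: gauss_integrable; rewrite mulr_gt0.
- apply: aeW => x n _; rewrite lee_fin subr0; have -> : 2 * c / 2 = c by field.
  by case: (dF n) => _ /(_ x).
apply: fine_cvg; rewrite fineK; first exact: cvgI.
exact: integrable_fin_num iF.
Qed.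

(** A global quadratic remainder suits both explicit polynomials and integrals depending on a
    parameter, where the remainder is bounded under the integral sign. *)
Lemma is_derive_quadratic f x d M : (forall h, `|f (x + h) - f x - d * h| <= M * h ^+ 2) ->
  is_derive x 1 f d.
Proof.
move=> fd.
have M0 : 0 <= M by have := le_trans (normr_ge0 _) (fd 1); rewrite expr1n mulr1.
have lim : (fun h : R => h^-1 *: (f (h *: (1 : R) + x) - f x)) @ 0^' --> d.
  apply/cvgrPdist_le => e e0; near=> h.
  have h0 : h != 0 by near: h; exact: nbhs_dnbhs_neq.
  have hM : `|h| <= e / (M + 1).
    by near: h; apply: dnbhs0_le; rewrite divr_gt0 // ltr_wpDl.
  rewrite /GRing.scale /= mulr1 (addrC h).
  have -> : d - h^-1 * (f (x + h) - f x) = - (h^-1 * (f (x + h) - f x - d * h)).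
    by field.
  rewrite normrN normrM normfV ler_pdivrMl ?normr_gt0 //.
  apply: (le_trans (fd h)); rewrite -(real_normK (num_real h)) expr2.
  have := normr_ge0 h; set t := `|h| => t0; rewrite mulrA [M * t * t]mulrC ler_wpM2l //.
  have := hM; rewrite ler_pdivlMr ?ltr_wpDl // => le_e.
  by apply: le_trans le_e; rewrite mulrC ler_wpM2l // lerDl.
have df : derivable f x 1 by apply/cvg_ex; exists d; exact: lim.
by apply: DeriveDef => //; exact: cvg_lim lim.
Unshelve. all: end_near. Qed.

(** Half of the decay rate k/2 absorbs the factor 1 + (x - y)^2; half of what remains pays for
    moving the centre from y to 0. *)
Lemma gauss_dominated_poly y k C F : 0 < k -> 0 <= C -> continuous F ->
  (forall x, `|F x| <= C * (1 + (x - y) ^+ 2) * expR (- (k / 2) * (x - y) ^+ 2)) ->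
  gauss_dominated (C * (1 + 4 / k) * expR (k / 4 * y ^+ 2)) (k / 8) F.
Proof.
move=> k0 C0 cF leF; split=> // x; apply: (le_trans (leF x)).
rewrite -(mulrA C (1 + 4 / k)) -!(mulrA C) ler_wpM2l //.
set z := x - y.
have z1 : 1 + z ^+ 2 <= (1 + 4 / k) * expR (k / 4 * z ^+ 2).
  have k4 : 0 <= 4 / k by rewrite divr_ge0 // ltW.
  have le1 : (1 + 4 / k) * (1 + k / 4 * z ^+ 2) <= (1 + 4 / k) * expR (k / 4 * z ^+ 2).
    by rewrite ler_wpM2l ?addr_ge0 // expR_ge1Dx.
  apply: le_trans le1.
  have -> : (1 + 4 / k) * (1 + k / 4 * z ^+ 2) = 1 + z ^+ 2 + 4 / k + k / 4 * z ^+ 2.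
    by field; exact: lt0r_neq0.
  rewrite -[leLHS]addr0 -!addrA !lerD2l addr_ge0 // mulr_ge0 ?sqr_ge0 //.
  by rewrite divr_ge0 // ltW.
apply: (@le_trans _ _ ((1 + 4 / k) * expR (k / 4 * z ^+ 2) * expR (- (k / 2) * z ^+ 2))).
  by rewrite ler_wpM2r // expR_ge0.
have k4 : 0 <= 1 + 4 / k by rewrite addr_ge0 // divr_ge0 // ltW.
rewrite -!(mulrA (1 + 4 / k)) ler_wpM2l // -!expRD ler_expR.
(* The gap k/4 y^2 - k/8 x^2 + k/4 (x - y)^2 between the two exponents is k/8 (x - 2y)^2. *)
have : 0 <= k * (x - 2 * y) ^+ 2 by rewrite mulr_ge0 ?sqr_ge0 // ltW.
by rewrite /z; lra.
Qed.

(** The fundamental theorem on [-n-1, n+1] leaves boundary terms, which vanish because e^(-c x^2) <=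
    1 / (c x) at x = n + 1. *)
Lemma integral_derivative0 C c C' c' F G : 0 < c -> 0 < c' ->
  (forall x, is_derive x 1 F (G x)) -> gauss_dominated C c F -> gauss_dominated C' c' G ->
  \I G = 0.
Proof.
move=> c0 c0' dF [cF leF] dG; have [cG leG] := dG.
have iG := gauss_dominated_integrable c0' dG.
have FTC n : Rintegral (@lebesgue_measure R) `[- n.+1%:R, n.+1%:R] G = F n.+1%:R - F (- n.+1%:R).
  have nn : - n.+1%:R < n.+1%:R :> R by rewrite (@lt_trans _ _ 0) // oppr_lt0.
  rewrite /Rintegral (@continuous_FTC2 R G F) //.
  - exact: continuous_subspaceT.
  - by split=> [x _||]; [have [] := dF x|apply: cvg_at_right_filter; exact: cF|apply: cvg_at_left_filter; exact: cF].
  - by move=> x _; rewrite derive1E; have [_ ->] := dF x.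
have F0 : F n.+1%:R - F (- n.+1%:R) @[n --> \oo] --> (0 : R).
  have bnd n : `|F n.+1%:R - F (- n.+1%:R)| <= 2 * `|C| / c * n.+1%:R^-1.
    apply: (le_trans (ler_normB _ _)).
    have le1 x : x ^+ 2 = n.+1%:R ^+ 2 -> `|F x| <= `|C| / c * n.+1%:R^-1.
      move=> xE; apply: (le_trans (leF x)); rewrite xE.
      apply: (@le_trans _ _ (`|C| * expR (- c * n.+1%:R ^+ 2))).
        by rewrite ler_wpM2r ?expR_ge0 // ler_norm.
      rewrite -mulrA ler_wpM2l // mulNr expRN -invfM.
      have n1 : 1 <= n.+1%:R :> R by rewrite ler1n.
      have le_n : n.+1%:R <= n.+1%:R ^+ 2 :> R by rewrite expr2 ler_peMl.
      rewrite lef_pV2 ?posrE ?expR_gt0 ?mulr_gt0 //.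
      apply: (@le_trans _ _ (c * n.+1%:R ^+ 2)); first by rewrite ler_wpM2l // ltW.
      by apply: le_trans (expR_ge1Dx _); rewrite lerDr.
    have -> : 2 * `|C| / c * n.+1%:R^-1 = `|C| / c * n.+1%:R^-1 + `|C| / c * n.+1%:R^-1 by ring.
    exact: lerD (le1 n.+1%:R erefl) (le1 (- n.+1%:R) (sqrrN _)).
  apply/cvgr0Pnorm_le => e e0.
  have lim : 2 * `|C| / c * n.+1%:R^-1 @[n --> \oo] --> (0 : R).
    by rewrite -(mulr0 (2 * `|C| / c)); apply: cvgMl_tmp; exact: cvg_harmonic.
  move/cvgr0Pnorm_le : lim => /(_ _ e0); apply: filterS => n le_e.
  by apply: le_trans le_e; apply: le_trans (ler_norm _).
have cvgI : Rintegral (@lebesgue_measure R) `[- n.+1%:R, n.+1%:R] G @[n --> \oo] --> \I G.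
  have [||||| _ _ cvgI] := @dominated_convergence _ _ R (@lebesgue_measure R) setT measurableT
    (fun n => EFin \o (G \_ `[- n.+1%:R, n.+1%:R])) (EFin \o G) (EFin \o (fun x => `|G x|)).
  - move=> n; apply/measurable_EFinP; apply/(measurable_restrictT G) => //.
    by apply: measurable_funTS; exact: continuous_measurable_fun.
  - by apply/measurable_EFinP; exact: continuous_measurable_fun.
  - apply: aeW => x _; apply: cvg_EFin; first exact: nearW.
    apply: cvg_near_cst; near=> n; rewrite /= /patch mem_set //= in_itv /= -ler_norml.
    have nx : `|x| <= n%:R by near: n; exact: nbhs_infty_ger.
    by apply: le_trans nx _; rewrite ler_nat.
  - exact: integrable_norm.
  - apply: aeW => x n _; rewrite lee_fin /= /patch; case: ifP => _ //.
    by rewrite normr0.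
  under eq_fun do rewrite Rintegral_mkcond.
  apply: fine_cvg; rewrite fineK; first exact: cvgI.
  exact: integrable_fin_num iG.
move: cvgI; under eq_fun do rewrite FTC.
by move=> cvgI; exact: cvg_unique cvgI F0.
Unshelve. all: end_near. Qed.

(** As a function of u the integral [I] satisfies I' = - J, and integration by parts gives k J = u
    I. Hence I(u) e^(u^2 / 2k) is constant, equal to its value at u = 0. *)
Lemma gauss_cos_integral y k u theta : 0 < k ->
  \I (fun x => cos (u * (x - y) + theta) * expR (- (k / 2) * (x - y) ^+ 2))
  = cos theta * expR (- (u ^+ 2 / (2 * k))) * Num.sqrt (2 * pi / k).
Proof.
move=> k0; have kN0 := lt0r_neq0 k0.
pose E x := expR (- (k / 2) * (x - y) ^+ 2).
have dE x : is_derive x 1 E (- k * (x - y) * E x).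
  have dq : is_derive x 1 (fun z : R => - (k / 2) * (z - y) ^+ 2) (- k * (x - y)).
    apply: is_derive_quadratic (k / 2) _ => h.
    have -> : - (k / 2) * (x + h - y) ^+ 2 - - (k / 2) * (x - y) ^+ 2 - - k * (x - y) * h
       = - ((k / 2) * h ^+ 2) by field.
    by rewrite normrN ger0_norm // mulr_ge0 ?sqr_ge0 // divr_ge0 // ltW.
  have := @is_derive1_comp R expR _ x _ _ (is_derive_expR _) dq.
  by rewrite [expR _ * _]mulrC.
have cE : continuous E by move=> x; apply: differentiable_continuous; apply/derivable1_diffP; have [] := dE x.
have czu v : continuous (fun x : R => v * (x - y) + theta).
  move=> x; apply: cvgD; last exact: cvg_cst.
  by apply: cvgMl_tmp; apply: cvgB => //; exact: cvg_cst.
have ccos v : continuous (fun x : R => cos (v * (x - y) + theta)).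
  by move=> x; apply: continuous_comp; [exact: czu|exact: continuous_cos].
have csin v : continuous (fun x : R => sin (v * (x - y) + theta)).
  by move=> x; apply: continuous_comp; [exact: czu|exact: continuous_sin].
have ccE v : continuous (fun x => cos (v * (x - y) + theta) * E x).
  by move=> x; apply: cvgM; [exact: ccos|exact: cE].
have csE v : continuous (fun x => sin (v * (x - y) + theta) * E x).
  by move=> x; apply: cvgM; [exact: csin|exact: cE].
have cxsE v : continuous (fun x => (x - y) * (sin (v * (x - y) + theta) * E x)).
  by move=> x; apply: cvgM; [apply: cvgB => //; exact: cvg_cst|exact: csE].
pose I v := \I (fun x => cos (v * (x - y) + theta) * E x).
pose J v := \I (fun x => (x - y) * (sin (v * (x - y) + theta) * E x)).
have lin x : `|x - y| <= 1 + (x - y) ^+ 2.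
  have := sqr_ge0 (`|x - y| - 1); rewrite sqrrB1 real_normK ?num_real //.
  have := normr_ge0 (x - y); lra.
have E0 x : 0 <= E x by exact: expR_ge0.
have one x : 1 <= 1 + (x - y) ^+ 2 by rewrite lerDl sqr_ge0.
have bc v x : `|cos (v * (x - y) + theta) * E x| <= 1 * (1 + (x - y) ^+ 2) * E x.
  rewrite mul1r normrM (ger0_norm (E0 x)) ler_wpM2r //; apply: le_trans (one x).
  by rewrite ler_norml cos_geN1 cos_le1.
have bs v x : `|sin (v * (x - y) + theta) * E x| <= 1 * (1 + (x - y) ^+ 2) * E x.
  rewrite mul1r normrM (ger0_norm (E0 x)) ler_wpM2r //; apply: le_trans (one x).
  by rewrite ler_norml sin_geN1 sin_le1.
have bxs v x : `|(x - y) * (sin (v * (x - y) + theta) * E x)| <= 1 * (1 + (x - y) ^+ 2) * E x.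
  rewrite mul1r mulrA normrM (ger0_norm (E0 x)) ler_wpM2r // normrM; apply: le_trans (lin x).
  by rewrite ler_piMr // ler_norml sin_geN1 sin_le1.
have dom C F := @gauss_dominated_poly y k C F k0.
have k8 : 0 < k / 8 by rewrite divr_gt0.
have dc v := dom _ _ ler01 (ccE v) (bc v).
have ds v := dom _ _ ler01 (csE v) (bs v).
have dx v := dom _ _ ler01 (cxsE v) (bxs v).
have ic v := gauss_dominated_integrable k8 (dc v).
have ix v := gauss_dominated_integrable k8 (dx v).
(* Differentiation under the integral: by [cos_first_order] the remainder of the integrand is at
   most h^2 (x - y)^2 E x. *)
have dI (v : R) : is_derive v 1 I (- J v).
  pose M := (1 + 4 / k) * expR (k / 4 * y ^+ 2) * Num.sqrt (pi / (k / 8)).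
  apply: (@is_derive_quadratic _ _ _ M) => h.
  have -> : I (v + h) - I v - - J v * h
      = \I (fun x => (cos ((v + h) * (x - y) + theta) - cos (v * (x - y) + theta)
            + h * (x - y) * sin (v * (x - y) + theta)) * E x).
    have -> : I (v + h) - I v - - J v * h = I (v + h) - I v + h * J v by ring.
    rewrite /I /J -RintegralB // -RintegralZl // -RintegralD //.
    - by apply: eq_Rintegral => x _; ring.
    - by apply: (integrableB measurableT) (ic _) (ic _).
    - by apply: (integrableZl measurableT) (ix _).
  have -> : M * h ^+ 2 = h ^+ 2 * (1 + 4 / k) * expR (k / 4 * y ^+ 2) * Num.sqrt (pi / (k / 8)).
    by rewrite /M; ring.
  apply: gauss_dominated_le_int => //; apply: gauss_dominated_poly => //.
  - exact: sqr_ge0.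
  - move=> x; apply: cvgM; last exact: cE.
    apply: cvgD; first by apply: cvgB; exact: ccos.
    apply: cvgM; last exact: csin.
    by apply: cvgMl_tmp; apply: cvgB => //; exact: cvg_cst.
  - move=> x; rewrite normrM (ger0_norm (E0 x)) ler_wpM2r //.
    have := cos_first_order (v * (x - y) + theta) (h * (x - y)).
    have -> : v * (x - y) + theta + h * (x - y) = (v + h) * (x - y) + theta by ring.
    move/le_trans; apply; rewrite exprMn ler_wpM2l ?sqr_ge0 //.
    by rewrite lerDr.
have JI (v : R) : k * J v = v * I v.
  have dS x : is_derive x 1 (fun x => sin (v * (x - y) + theta) * E x)
     (v * (cos (v * (x - y) + theta) * E x) - k * ((x - y) * (sin (v * (x - y) + theta) * E x))).
    have dl : is_derive x 1 (fun z : R => v * (z - y) + theta) v.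
      apply: (@is_derive_quadratic _ _ _ 0) => h.
      have -> : v * (x + h - y) + theta - (v * (x - y) + theta) - v * h = 0 by ring.
      by rewrite normr0 mul0r.
    have dsin := @is_derive1_comp R sin _ x _ _ (is_derive_sin _) dl.
    have dsE := is_deriveM dsin (dE x).
    by apply: (is_derive_eq dsE); rewrite /GRing.scale /=; ring.
  have := @integral_derivative0 _ _ _ _ _ _ k8 k8 dS (ds v).
  have dsum : gauss_dominated ((`|v| + k) * (1 + 4 / k) * expR (k / 4 * y ^+ 2)) (k / 8)
     (fun x => v * (cos (v * (x - y) + theta) * E x) - k * ((x - y) * (sin (v * (x - y) + theta) * E x))).
    apply: gauss_dominated_poly => //; first by rewrite addr_ge0 // ltW.
    - by move=> x; apply: cvgB; apply: cvgMl_tmp; [exact: ccE|exact: cxsE].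
    - move=> x; apply: le_trans (ler_normB _ _) _; rewrite (mulrDl `|v| k) [X in _ <= X]mulrDl; apply: lerD.
        by rewrite normrM -mulrA ler_wpM2l //; have := bc v x; rewrite mul1r.
      by rewrite normrM (gtr0_norm k0) -mulrA ler_wpM2l ?(ltW k0) //; have := bxs v x; rewrite mul1r.
  move=> /(_ _ dsum); rewrite RintegralB //; last 2 first.
  - by apply: (integrableZl measurableT) (ic _).
  - by apply: (integrableZl measurableT) (ix _).
  by rewrite !RintegralZl // => /subr0_eq.
pose P v := I v * expR (v ^+ 2 / (2 * k)).
have dP (v : R) : is_derive v 1 P 0.
  have dq : is_derive v 1 (fun z : R => z ^+ 2 / (2 * k)) (v / k).
    apply: (@is_derive_quadratic _ _ _ (2 * k)^-1) => h.
    have -> : (v + h) ^+ 2 / (2 * k) - v ^+ 2 / (2 * k) - v / k * h = (2 * k)^-1 * h ^+ 2 by field.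
    by rewrite ger0_norm // mulr_ge0 ?sqr_ge0 // invr_ge0 mulr_ge0 // ltW.
  have de := @is_derive1_comp R expR _ v _ _ (is_derive_expR _) dq.
  have dIe := is_deriveM (dI v) de; apply: (is_derive_eq dIe); rewrite /GRing.scale /=.
  have -> : I v * (expR (v ^+ 2 / (2 * k)) * (v / k)) = expR (v ^+ 2 / (2 * k)) * (v * I v / k) by ring.
  by rewrite -JI; field.
have I0 : I 0 = cos theta * Num.sqrt (2 * pi / k).
  rewrite /I -(gauss_integral y k0) -RintegralZl //; last first.
    by have := gauss_integrable y 1 k0; apply: eq_integrable => // x _; rewrite /= mul1r.
  by apply: eq_Rintegral => x _; rewrite mul0r add0r.
have := @is_derive_0_is_cst R P u 0 dP; rewrite /P I0 expr0n /= mul0r expR0 mulr1 => Pu.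
by rewrite -/(I u) mulrAC -Pu -mulrA -expRD subrr expR0 mulr1.
Qed.

End GaussianIntegral.

(** * Iterated integrals of dominated functions *)

Section IteratedIntegral.
Variable R : realType.
Implicit Types (C c x : R) (n : nat).

Local Notation "\I F" := (Rintegral (@lebesgue_measure R) setT F) (at level 10).

Definition mx_cons n x (v : 'rV[R]_n) : 'rV[R]_n.+1 := row_mx (const_mx x : 'rV[R]_1) v.

Lemma mx_cons0 n x (v : 'rV[R]_n) : mx_cons x v 0 ord0 = x.
Proof.
rewrite /mx_cons; have -> : ord0 = lshift n (ord0 : 'I_1) by exact: val_inj.
by have := row_mxEl (const_mx x : 'rV[R]_1) v 0 ord0; rewrite [X in _ = X]mxE.
Qed.

Lemma mx_cons_lift n x (v : 'rV[R]_n) j : mx_cons x v 0 (lift ord0 j) = v 0 j.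
Proof.
rewrite /mx_cons; have -> : lift ord0 j = rshift 1 j by exact: val_inj.
exact: (row_mxEr (const_mx x : 'rV[R]_1) v 0 j).
Qed.

Lemma integral_rVS n (F : 'rV[R]_n.+1 -> R) :
  integral_rV F = \I (fun x => integral_rV (fun v => F (mx_cons x v))).
Proof. by []. Qed.

Definition sqnorm n (v : 'rV[R]_n) : R := \sum_j v 0 j ^+ 2.

Lemma sqnorm_ge0 n (v : 'rV[R]_n) : 0 <= sqnorm v.
Proof. by apply: sumr_ge0 => j _; exact: sqr_ge0. Qed.

Lemma sqnorm_cons n x (v : 'rV[R]_n) : sqnorm (mx_cons x v) = x ^+ 2 + sqnorm v.
Proof.
by rewrite /sqnorm big_ord_recl mx_cons0; under eq_bigr do rewrite mx_cons_lift.
Qed.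

(* Convergence and continuity of functions on R^n are tested on entrywise
   convergent sequences, which are easily combined under [row_mx]. *)
Definition row_cvg n (v_ : nat -> 'rV[R]_n) (v : 'rV[R]_n) :=
  forall j, v_ k 0 j @[k --> \oo] --> v 0 j.

Definition cont_cvg n (F_ : nat -> 'rV[R]_n -> R) (F : 'rV[R]_n -> R) :=
  forall v_ v, row_cvg v_ v -> F_ k (v_ k) @[k --> \oo] --> F v.

Definition seq_continuous n (F : 'rV[R]_n -> R) := cont_cvg (fun=> F) F.

Lemma row_cvg_cons n (x_ : nat -> R) x (v_ : nat -> 'rV[R]_n) v :
  x_ k @[k --> \oo] --> x -> row_cvg v_ v ->
  row_cvg (fun k => mx_cons (x_ k) (v_ k)) (mx_cons x v).
Proof.
move=> cx cv j; have [->|[i ->]] : j = ord0 \/ exists i, j = lift ord0 i.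
- by case: (unliftP ord0 j) => [i ->|->]; [right; exists i|left].
- by rewrite mx_cons0; under eq_fun do rewrite mx_cons0.
- by rewrite mx_cons_lift; under eq_fun do rewrite mx_cons_lift; exact: cv.
Qed.

Lemma row_cvgP n (v_ : nat -> 'rV[R]_n) v : row_cvg v_ v <-> (v_ k @[k --> \oo] --> v).
Proof.
split=> [cv|cv j]; last first.
  have := @cvg_comp _ _ _ v_ (fun w : 'rV[R]_n => w 0 j) _ _ _ cv.
  by apply; exact: coord_continuous.
apply/cvg_mx_entourageP => A entA.
suff : \forall k \near \oo, forall (i : 'I_n) (i' : 'I_1), (v i' i, v_ k i' i) \in A.
  by apply: filterS => k kA i j; exact: kA.
apply: filter_forall => j; have : \forall k \near \oo, xsection A (v 0 j) (v_ k 0 j).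
  by apply: cv; exact: nbhs_entourage.
apply: filterS => k; rewrite /= /xsection /= => vA i; rewrite (ord1 i).
by move: vA; rewrite inE.
Qed.

Lemma continuous_seq n (F : 'rV[R]_n -> R) : continuous F -> seq_continuous F.
Proof. by move=> cF v_ v /row_cvgP cv; exact: (cvg_comp _ _ cv (cF v)). Qed.

Definition dominated n C c (F : 'rV[R]_n -> R) :=
  seq_continuous F /\ forall v, `|F v| <= C * expR (- c * sqnorm v).

Lemma dominated_cons n C c (F : 'rV[R]_n.+1 -> R) x : dominated C c F ->
  dominated (C * expR (- c * x ^+ 2)) c (fun v => F (mx_cons x v)).
Proof.
move=> [cF leF]; split=> [v_ v cv|v].
  by apply: cF; apply: row_cvg_cons => //; exact: cvg_cst.
by rewrite -mulrA -expRD -mulrDr -sqnorm_cons.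
Qed.

Lemma seq_continuous1 (F : R -> R) :
  (forall (x_ : nat -> R) x, x_ k @[k --> \oo] --> x -> F (x_ k) @[k --> \oo] --> F x) -> continuous F.
Proof.
move=> cF x; apply/continuous_withinNx; apply/cvgr_dnbhsP => u [_ ux]; exact: cF.
Qed.

Let bounded_integral n c := forall C (F : 'rV[R]_n -> R), dominated C c F ->
  `|integral_rV F| <= C * Num.sqrt (pi / c) ^+ n.

Let convergent_integral n c := forall C (F_ : nat -> 'rV[R]_n -> R) F,
  (forall k, dominated C c (F_ k)) -> dominated C c F -> cont_cvg F_ F ->
  integral_rV (F_ k) @[k --> \oo] --> integral_rV F.

Let slice n c : 0 < c -> bounded_integral n c -> convergent_integral n c ->
  forall C (F : 'rV[R]_n.+1 -> R), dominated C c F ->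
  gauss_dominated (C * Num.sqrt (pi / c) ^+ n) c (fun x => integral_rV (fun v => F (mx_cons x v))).
Proof.
move=> c0 IHb IHc C F dF; split=> [|x]; last first.
  by rewrite mulrAC; apply: IHb; exact: dominated_cons.
apply: seq_continuous1 => x_ x cx.
have C0 : 0 <= C.
  by have := le_trans (normr_ge0 _) (dF.2 0); rewrite pmulr_lge0 // expR_gt0.
(* Dropping the factor e^(-c z^2) <= 1 gives one bound for all slices, as convergence along x_k
   requires. *)
have dC z : dominated C c (fun v => F (mx_cons z v)).
  split=> [|v]; first exact: (dominated_cons _ dF).1.
  apply: le_trans ((dominated_cons z dF).2 v) _; rewrite ler_wpM2r ?expR_ge0 //.
  by rewrite ler_piMr // -expR0 ler_expR mulNr oppr_le0 mulr_ge0 ?sqr_ge0 // ltW.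
apply: (IHc C) => // v_ v cv.
by apply: dF.1; exact: row_cvg_cons.
Qed.

(** Bound and convergence go through one induction: a slice of a function on R^(n+1) is continuous
    in x by convergence in dimension n and dominated by the bound in dimension n. *)
Let integral_bound_cvg n c : 0 < c -> bounded_integral n c /\ convergent_integral n c.
Proof.
move=> c0; elim: n => [|n [IHb IHc]].
  split=> [C F [_ leF]|C F_ F _ _ FF] /=.
    by have := leF 0; rewrite /sqnorm big_ord0 mulr0 expR0 expr0.
  by apply: FF => -[].
split=> [C F dF|C F_ F dF_ dF FF].
  rewrite integral_rVS exprSr mulrA; apply: (gauss_dominated_le_int c0); exact: slice.
rewrite integral_rVS; apply: (gauss_dominated_cvg c0 (fun k => slice c0 IHb IHc (dF_ k))) => [|x].
  by case: (slice c0 IHb IHc dF).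
apply: (IHc (C * expR (- c * x ^+ 2))) => [k||v_ v cv].
- exact: dominated_cons.
- exact: dominated_cons.
- by apply: FF; apply: row_cvg_cons => //; exact: cvg_cst.
Qed.

Lemma dominated_slice n C c (F : 'rV[R]_n.+1 -> R) : 0 < c -> dominated C c F ->
  gauss_dominated (C * Num.sqrt (pi / c) ^+ n) c (fun x => integral_rV (fun v => F (mx_cons x v))).
Proof. by move=> c0; have [b cv] := integral_bound_cvg n c0; exact: slice. Qed.

Lemma eq_integral_rV n (F G : 'rV[R]_n -> R) : F =1 G -> integral_rV F = integral_rV G.
Proof. by move=> /funext ->. Qed.

Lemma integral_rVD n C C' c (F G : 'rV[R]_n -> R) : 0 < c -> dominated C c F -> dominated C' c G ->
  integral_rV (fun v => F v + G v) = integral_rV F + integral_rV G.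
Proof.
move=> c0; elim: n C C' F G => [//|n IH] C C' F G dF dG; rewrite !integral_rVS.
rewrite -(gauss_dominated_D c0 c0 (dominated_slice c0 dF) (dominated_slice c0 dG)).
apply: eq_Rintegral => x _.
exact: (IH _ _ _ _ (dominated_cons x dF) (dominated_cons x dG)).
Qed.

Lemma integral_rVZ n C c a (F : 'rV[R]_n -> R) : 0 < c -> dominated C c F ->
  integral_rV (fun v => a * F v) = a * integral_rV F.
Proof.
move=> c0; elim: n C F => [//|n IH] C F dF; rewrite !integral_rVS.
rewrite -RintegralZl //; last exact: gauss_dominated_integrable (dominated_slice c0 dF).
apply: eq_Rintegral => x _; exact: (IH _ _ (dominated_cons x dF)).
Qed.

Lemma le_integral_rV n C C' c (F G : 'rV[R]_n -> R) : 0 < c -> dominated C c F -> dominated C' c G ->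
  (forall v, F v <= G v) -> integral_rV F <= integral_rV G.
Proof.
move=> c0; elim: n C C' F G => [|n IH] C C' F G dF dG FG; first exact: FG.
rewrite !integral_rVS; apply: le_Rintegral => //.
- exact: gauss_dominated_integrable (dominated_slice c0 dF).
- exact: gauss_dominated_integrable (dominated_slice c0 dG).
- move=> x _; apply: IH (dominated_cons x dF) (dominated_cons x dG) _ => v; exact: FG.
Qed.

Lemma seq_continuousD n (F G : 'rV[R]_n -> R) : seq_continuous F -> seq_continuous G ->
  seq_continuous (fun v => F v + G v).
Proof. by move=> cF cG v_ v cv; apply: cvgD; [exact: cF|exact: cG]. Qed.

Lemma seq_continuousM n (F G : 'rV[R]_n -> R) : seq_continuous F -> seq_continuous G ->
  seq_continuous (fun v => F v * G v).
Proof. by move=> cF cG v_ v cv; apply: cvgM; [exact: cF|exact: cG]. Qed.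

Lemma seq_continuous_comp n (f : R -> R) (F : 'rV[R]_n -> R) : continuous f -> seq_continuous F ->
  seq_continuous (fun v => f (F v)).
Proof. by move=> cf cF v_ v cv; apply: (cvg_comp _ _ (cF _ _ cv)); exact: cf. Qed.

Lemma seq_continuous_sum n (I : finType) (F : I -> 'rV[R]_n -> R) :
  (forall i, seq_continuous (F i)) -> seq_continuous (fun v => \sum_i F i v).
Proof.
move=> cF v_ v cv; elim: (index_enum I) => [|i s IH].
  by rewrite big_nil; under eq_fun do rewrite big_nil; exact: cvg_cst.
by rewrite big_cons; under eq_fun do rewrite big_cons; apply: cvgD => //; exact: cF.
Qed.

Lemma seq_continuous_cst n a : seq_continuous (fun _ : 'rV[R]_n => a).
Proof. by move=> v_ v _; exact: cvg_cst. Qed.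

Lemma seq_continuous_coord n j : seq_continuous (fun v : 'rV[R]_n => v 0 j).
Proof. by move=> v_ v; apply. Qed.

End IteratedIntegral.

(** * Positive definite forms and the Gaussian characteristic function *)

Section GaussianMatrix.
Variable R : realType.
Implicit Types (x s k theta : R) (n : nat).

Local Notation "\I F" := (Rintegral (@lebesgue_measure R) setT F) (at level 10).

Local Notation "''e_' a" := (delta_mx 0 a : 'rV[R]_ _) (at level 8, a at level 2).

Definition dot n (x y : 'rV[R]_n) : R := (x *m y^T) 0 0.

Definition bilin n (K : 'M[R]_n) (x y : 'rV[R]_n) : R := dot (x *m K) y.

Definition posdef n (K : 'M[R]_n) := K^T = K /\ forall v : 'rV[R]_n, v != 0 -> 0 < bilin K v v.

Section Forms.
Variable n : nat.
Implicit Types (u v w : 'rV[R]_n) (K : 'M[R]_n) (a : R).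

Lemma dotE u v : dot u v = \sum_j u 0 j * v 0 j.
Proof. by rewrite /dot mxE; apply: eq_bigr => j _; rewrite mxE. Qed.

Lemma dotC u v : dot u v = dot v u.
Proof. by rewrite !dotE; apply: eq_bigr => j _; rewrite mulrC. Qed.

Lemma dotDl u v w : dot (u + v) w = dot u w + dot v w.
Proof. by rewrite /dot mulmxDl mxE. Qed.

Lemma dotDr u v w : dot w (u + v) = dot w u + dot w v.
Proof. by rewrite ![dot w _]dotC dotDl. Qed.

Lemma dotZl a u v : dot (a *: u) v = a * dot u v.
Proof. by rewrite /dot -scalemxAl mxE. Qed.

Lemma dotZr a u v : dot u (a *: v) = a * dot u v.
Proof. by rewrite dotC dotZl dotC. Qed.

Lemma dotNl u v : dot (- u) v = - dot u v.
Proof. by rewrite -scaleN1r dotZl mulN1r. Qed.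

Lemma dotBl u v w : dot (u - v) w = dot u w - dot v w.
Proof. by rewrite dotDl dotNl. Qed.

Lemma dotBr u v w : dot w (u - v) = dot w u - dot w v.
Proof. by rewrite ![dot w _]dotC dotBl. Qed.

Lemma dot0l u : dot 0 u = 0.
Proof. by rewrite /dot mul0mx mxE. Qed.

Lemma dot_delta u j : dot 'e_j u = u 0 j.
Proof. by rewrite dotE (bigD1 j) //= big1 ?addr0 ?mxE ?eqxx ?mul1r // => i ij; rewrite !mxE eqxx (negPf ij) mul0r. Qed.

Lemma bilinDl K u v w : bilin K (u + v) w = bilin K u w + bilin K v w.
Proof. by rewrite /bilin mulmxDl dotDl. Qed.

Lemma bilinDr K u v w : bilin K w (u + v) = bilin K w u + bilin K w v.
Proof. exact: dotDr. Qed.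

Lemma bilinZl K a u v : bilin K (a *: u) v = a * bilin K u v.
Proof. by rewrite /bilin -scalemxAl dotZl. Qed.

Lemma bilinZr K a u v : bilin K u (a *: v) = a * bilin K u v.
Proof. exact: dotZr. Qed.

Lemma bilinC K u v : K^T = K -> bilin K u v = bilin K v u.
Proof.
move=> KT; rewrite /bilin /dot.
have <- : (u *m K *m v^T)^T = v *m K *m u^T by rewrite !trmx_mul trmxK KT mulmxA.
by rewrite [RHS]mxE.
Qed.

Lemma bilinE K u v : bilin K u v = \sum_i \sum_j u 0 i * K i j * v 0 j.
Proof.
rewrite /bilin dotE exchange_big /=; apply: eq_bigr => j _.
by rewrite mxE mulr_suml.
Qed.

Lemma posdef_unit K : posdef K -> K \in unitmx.
Proof.
move=> [_ K0]; rewrite -row_free_unit -kermx_eq0; apply/negP => /negP /rowV0Pn [v vK v0].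
by have := K0 v v0; rewrite /bilin (sub_kermxP vK) dot0l ltxx.
Qed.

Lemma posdef_ge0 K u : posdef K -> 0 <= bilin K u u.
Proof.
move=> [_ K0]; have [->|u0] := eqVneq u 0; last exact: ltW (K0 _ u0).
by rewrite /bilin mul0mx dot0l.
Qed.

Lemma posdef_inv K : posdef K -> posdef (invmx K).
Proof.
move=> pK; have uK := posdef_unit pK; split=> [|u u0]; first by rewrite trmx_inv pK.1.
have -> : bilin (invmx K) u u = bilin K (u *m invmx K) (u *m invmx K).
  by rewrite /bilin -mulmxA mulVmx // mulmx1 dotC.
apply: pK.2; apply: contra_neq u0 => u0.
by rewrite -(mulmxKV uK u) u0 mul0mx.
Qed.

Lemma cauchy_schwarz K u v : posdef K -> bilin K u v ^+ 2 <= bilin K u u * bilin K v v.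
Proof.
move=> pK; have [->|v0] := eqVneq v 0.
  rewrite (bilinC u 0 pK.1) /bilin !mul0mx !dot0l mulr0 expr0n /=; exact: lexx.
have vv := pK.2 v v0; have := posdef_ge0 (bilin K v v *: u - bilin K u v *: v) pK.
rewrite -scaleNr bilinDl !bilinDr !bilinZl !bilinZr (bilinC v u pK.1).
set p := bilin K u u; set q := bilin K u v; set s := bilin K v v => ge0.
have : 0 <= s * (p * s - q ^+ 2) by move: ge0; congr (_ <= _); ring.
by rewrite pmulr_rge0 // subr_ge0.
Qed.

(** Writing u_j = K(e_j K^-1, u), Cauchy-Schwarz gives u_j^2 <= (K^-1)_jj K(u, u); summing, c is the
    inverse of the trace of K^-1. The added 1 keeps c defined and positive when n = 0. *)
Lemma posdef_coercive K : posdef K -> exists2 c : R, 0 < c & forall u, c * sqnorm u <= bilin K u u.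
Proof.
move=> pK; have uK := posdef_unit pK; pose S := \sum_j invmx K j j.
have S0 : 0 <= S.
  apply: sumr_ge0 => j _.
  have := posdef_ge0 ('e_j) (posdef_inv pK).
  by rewrite /bilin dotC dot_delta -rowE mxE.
exists (S + 1)^-1 => [|u]; first by rewrite invr_gt0 ltr_wpDl.
rewrite ler_pdivrMl ?ltr_wpDl //.
have : sqnorm u <= S * bilin K u u.
  rewrite /sqnorm /S mulr_suml; apply: ler_sum => j _.
  have := cauchy_schwarz ('e_j *m invmx K) u pK.
  rewrite /bilin mulmxKV // !dot_delta.
  by rewrite -rowE mxE.
move/le_trans; apply; rewrite ler_wpM2r ?posdef_ge0 //.
by rewrite lerDl.
Qed.

End Forms.

Section Block.
Variables (n : nat) (k : R) (b : 'rV[R]_n) (K : 'M[R]_n).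

Let BK : 'M[R]_n.+1 := block_mx (k%:M : 'M[R]_1) b b^T K.

Lemma dot_cons x y (v w : 'rV[R]_n) : dot (mx_cons x v) (mx_cons y w) = x * y + dot v w.
Proof.
rewrite !dotE big_ord_recl !mx_cons0; congr (_ + _).
by apply: eq_bigr => j _; rewrite !mx_cons_lift.
Qed.

Lemma mx_cons_block x v :
  mx_cons x v *m BK = mx_cons (x * k + dot b v) (x *: b + v *m K).
Proof.
rewrite /mx_cons /BK; have cE y : const_mx y = y%:M :> 'M[R]_1 by apply/matrixP => i j; rewrite !mxE !ord1 eqxx mulr1n.
rewrite !cE (@mul_row_block R 1 1 n 1 n) mul_scalar_mx [x%:M *m b]mul_scalar_mx scale_scalar_mx.
suff -> : (x * k)%:M + v *m b^T = (x * k + dot b v)%:M :> 'M[R]_1 by [].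
by apply/matrixP => i j; rewrite !ord1 dotC /dot !mxE eqxx !mulr1n.
Qed.

Lemma bilin_block x y (v w : 'rV[R]_n) :
  bilin BK (mx_cons x v) (mx_cons y w)
  = x * k * y + x * dot b w + y * dot b v + bilin K v w.
Proof. by rewrite /bilin mx_cons_block dot_cons dotDl dotZl; ring. Qed.

Hypothesis pK : posdef BK.

Lemma posdef_block_dr : posdef K.
Proof.
split=> [|v v0].
  have := pK.1; rewrite /BK (@tr_block_mx _ 1 n 1 n) => /(@eq_block_mx _ 1 n 1 n).
  by case.
have := pK.2 (mx_cons 0 v); rewrite bilin_block !mul0r !add0r; apply.
apply: contra_neq v0 => v0; apply/rowP => j.
by have /rowP/(_ (lift ord0 j)) := v0; rewrite mx_cons_lift !mxE.
Qed.

Definition schur_complement := k - dot (b *m invmx K) b.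

Lemma schur_complement_gt0 : 0 < schur_complement.
Proof.
have uK := posdef_unit posdef_block_dr.
have := pK.2 (mx_cons 1 (- (b *m invmx K))).
have -> : bilin BK (mx_cons 1 (- (b *m invmx K))) (mx_cons 1 (- (b *m invmx K))) = schur_complement.
  rewrite bilin_block /bilin mulNmx mulmxKV // dotNl (dotC b) dotNl /schur_complement; ring.
apply; apply/negP => /eqP /rowP/(_ ord0); rewrite mx_cons0 mxE => /eqP.
by rewrite oner_eq0.
Qed.

(** Right multiplication by the unipotent [L] clears the lower left block and leaves the Schur
    complement in the corner. *)
Lemma det_schur : \det BK = schur_complement * \det K.
Proof.
have uK := posdef_unit posdef_block_dr.
pose L : 'M[R]_n.+1 := block_mx (1%:M : 'M[R]_1) 0 (- (b *m invmx K)^T) 1%:M.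
have : \det (BK *m L) = schur_complement * \det K.
  rewrite /BK /L (@mulmx_block _ 1 n 1 n 1 n) !mulmx1 !mulmx0 mulmxN trmx_mul trmx_inv posdef_block_dr.1.
  rewrite mulmxN (mulmxA K) mulmxV // mul1mx subrr add0r add0r.
  rewrite (@det_ublock _ 1 n) det_mx11 -(posdef_block_dr.1) -trmx_inv -trmx_mul.
  suff -> : (k%:M - b *m (b *m invmx K)^T) 0 0 = schur_complement by [].
  by rewrite /schur_complement dotC /dot; move: (b *m _) => M; rewrite mxE [X in X + _]mxE [X in _ + X]mxE.
by rewrite det_mulmx (@det_lblock _ 1 n) !det1 !mulr1.
Qed.

End Block.

Lemma mx_cons_surj n (v : 'rV[R]_n.+1) : exists x w, v = mx_cons x w.
Proof.
exists (v 0 ord0), (\row_j v 0 (lift ord0 j)); apply/rowP => j.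
case: (unliftP ord0 j) => [i ->|->]; first by rewrite mx_cons_lift mxE.
by rewrite mx_cons0.
Qed.

Lemma block_surj n (A : 'M[R]_n.+1) : A^T = A ->
  exists k b K, A = block_mx (k%:M : 'M[R]_1) b b^T K :> 'M[R]_(1 + n).
Proof.
move=> AT; exists (A 0 0), (@ursubmx _ 1 n 1 n A), (@drsubmx _ 1 n 1 n A).
rewrite -[LHS](@submxK _ 1 n 1 n A); congr (@block_mx _ 1 n 1 n _ _ _ _).
  rewrite [LHS]mx11_scalar; congr (_%:M); rewrite !mxE; congr (A _ _); exact: val_inj.
by rewrite -[in LHS]AT trmx_dlsub || by rewrite trmx_ursub AT.
Qed.

Lemma det_posdef_gt0 n (K : 'M[R]_n) : posdef K -> 0 < \det K.
Proof.
elim: n K => [|n IH] K pK; first by rewrite det_mx00.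
have [k [b [K' KE]]] := block_surj pK.1; subst K.
by rewrite det_schur // mulr_gt0 ?schur_complement_gt0 // IH //; exact: posdef_block_dr pK.
Qed.

Lemma gauss_cos_integralZ C y k u theta : 0 < k ->
  \I (fun x => C * (cos (u * (x - y) + theta) * expR (- (k / 2) * (x - y) ^+ 2)))
  = C * (cos theta * expR (- (u ^+ 2 / (2 * k))) * Num.sqrt (2 * pi / k)).
Proof.
move=> k0; rewrite RintegralZl ?gauss_cos_integral //.
apply: le_integrable (gauss_integrable y 1 k0) => //.
  apply/measurable_EFinP; apply: continuous_measurable_fun => x.
  have cz : continuous (fun x : R => x - y) by move=> z; apply: cvgB => //; exact: cvg_cst.
  apply: cvgM.
    apply: continuous_comp; last exact: continuous_cos.
    by apply: cvgD; [apply: cvgMl_tmp; exact: cz|exact: cvg_cst].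
  apply: continuous_comp; last exact: continuous_expR.
  by apply: cvgMl_tmp; exact: (cvgM (cz x) (cz x)).
move=> x _; rewrite lee_fin mul1r !normrM ler_piMl // ler_norml cos_geN1 cos_le1 //.
Qed.

(** The statement carries a factor C, a tilt y and a phase theta so that the induction closes:
    fixing the first coordinate x turns the cross terms into a tilt and a phase depending on x. What
    remains is a one-dimensional Gaussian in x whose curvature is the Schur complement s. *)
Let gaussian_cos_integralZ C n (K : 'M[R]_n) y w theta : posdef K ->
  integral_rV (fun a => C * (cos (dot (w *m K) a + theta)
                             * expR (- (1 / 2) * bilin K a a + dot (y *m K) a)))
  = C * (Num.sqrt ((2 * pi) ^+ n / \det K)
    * (expR ((bilin K y y - bilin K w w) / 2) * cos (theta + bilin K y w))).
Proof.
elim: n C K y w theta => [|n IH] C K y w theta pK.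
  rewrite /= det_mx00 expr0 divr1 sqrtr1 mul1r /bilin !dotE !big_ord0 subr0 mul0r mulr0 !addr0 add0r.
  by rewrite mul1r [cos _ * _]mulrC.
have [k [b [K' KE]]] := block_surj pK.1; subst K.
have [y1 [y' ->]] := mx_cons_surj y; have [w1 [w' ->]] := mx_cons_surj w.
have pK' := posdef_block_dr pK; have uK' := posdef_unit pK'.
pose c := b *m invmx K'; pose s := schur_complement k b K'.
have s0 : 0 < s := schur_complement_gt0 pK.
have d0 := det_posdef_gt0 pK'.
have cK v : bilin K' c v = dot b v by rewrite /bilin mulmxKV.
have Kc v : bilin K' v c = dot b v by rewrite (bilinC _ _ pK'.1).
have ck : dot b c = k - s by rewrite /s /schur_complement -/c dotC; ring.
have bY (z : R) v u : dot ((v + z *: c) *m K') u = dot (v *m K') u + z * dot b u.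
  by rewrite mulmxDl -scalemxAl mulmxKV // dotDl dotZl.
have dS : \det (block_mx (k%:M : 'M[R]_1) b b^T K' : 'M[R]_n.+1) = s * \det K' := det_schur pK.
clearbody s c.
rewrite integral_rVS.
set Y := bilin _ (mx_cons y1 y') (mx_cons y1 y'); set W := bilin _ (mx_cons w1 w') (mx_cons w1 w').
set YW := bilin _ (mx_cons y1 y') (mx_cons w1 w').
(* The part that does not depend on x once the square around y1 is completed; s w1^2 / 2 is returned
   by the integral over x, whose frequency is s w1. *)
pose Z := C * (Num.sqrt ((2 * pi) ^+ n / \det K') * expR ((Y - W + s * w1 ^+ 2) / 2)).
transitivity (\I (fun x => Z * (cos (s * w1 * (x - y1) + (theta + YW))
    * expR (- (s / 2) * (x - y1) ^+ 2)))).
  apply: eq_Rintegral => x _.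
  have := IH (C * expR (- (1 / 2) * (k * x ^+ 2) + (y1 * k + dot b y') * x)) K'
     (y' + (y1 - x) *: c) (w' + w1 *: c) (theta + (w1 * k + dot b w') * x) pK'.
  rewrite !(bilinDl, bilinDr, bilinZl, bilinZr, cK, Kc) ck => IH'.
  transitivity (integral_rV (fun a => C * expR (- (1 / 2) * (k * x ^+ 2) + (y1 * k + dot b y') * x)
    * (cos (dot ((w' + w1 *: c) *m K') a + (theta + (w1 * k + dot b w') * x))
       * expR (- (1 / 2) * bilin K' a a + dot ((y' + (y1 - x) *: c) *m K') a)))).
    apply: eq_integral_rV => v; rewrite !mx_cons_block !dot_cons bilin_block !bY !dotDl !dotZl.
    rewrite -(mulrA C) [expR _ * (cos _ * _)]mulrCA -expRD; congr (_ * (_ * expR _)); last by field.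
    by congr cos; ring.
  rewrite IH' /Z; set S := Num.sqrt _.
  set e1 := expR (_ + _); set e2 := expR (_ / 2); set c1 := cos _; set c0 := cos _.
  have -> : c1 = c0 by rewrite /c1 /c0 /YW bilin_block; congr cos; ring.
  have ee : e1 * e2 = expR ((Y - W + s * w1 ^+ 2) / 2) * expR (- (s / 2) * (x - y1) ^+ 2).
    by rewrite /e1 /e2 -!expRD; congr expR; rewrite /Y /W !bilin_block; field.
  transitivity (C * S * c0 * (e1 * e2)); first by ring.
  by rewrite ee; ring.
rewrite gauss_cos_integralZ // /Z dS.
have -> : Num.sqrt ((2 * pi) ^+ n.+1 / (s * \det K')) = Num.sqrt ((2 * pi) ^+ n / \det K') * Num.sqrt (2 * pi / s).
  rewrite -sqrtrM ?divr_ge0 ?exprn_ge0 ?mulr_ge0 ?pi_ge0 ?(ltW d0) //; congr Num.sqrt.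
  by rewrite exprSr; field; rewrite !gt_eqF.
have <- : expR ((Y - W + s * w1 ^+ 2) / 2) * expR (- ((s * w1) ^+ 2 / (2 * s))) = expR ((Y - W) / 2).
  by rewrite -expRD; congr expR; field; rewrite gt_eqF.
ring.
Qed.

Lemma gaussian_cos_integral n (K : 'M[R]_n) w theta : posdef K ->
  integral_rV (fun a => cos (dot (w *m K) a + theta) * gaussian_density K a)
  = expR (- (bilin K w w / 2)) * cos theta.
Proof.
move=> pK; have d0 := det_posdef_gt0 pK.
pose C := Num.sqrt (\det K) / (2 * pi) `^ (n%:R / 2).
transitivity (integral_rV (fun a => C * (cos (dot (w *m K) a + theta)
    * expR (- (1 / 2) * bilin K a a + dot (0 *m K) a)))).
  apply: eq_integral_rV => a; rewrite /gaussian_density -bilinE mul0mx dot0l addr0 -/C.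
  by rewrite mulrCA.
rewrite gaussian_cos_integralZ // /bilin mul0mx !dot0l add0r mulNr addr0 mulrA.
rewrite -[RHS]mul1r; congr (_ * _).
rewrite /C powRrM powR_mulrn ?mulr_ge0 ?pi_ge0 // powR12_sqrt ?exprn_ge0 ?mulr_ge0 ?pi_ge0 //.
have pn : 0 < (2 * pi) ^+ n :> R by rewrite exprn_gt0 // mulr_gt0 // pi_gt0.
rewrite sqrtrM ?(ltW pn) // sqrtrV ?(ltW d0) //.
by rewrite mulrA divfK ?divff // gt_eqF // sqrtr_gt0.
Qed.

Lemma gaussian_integral n (K : 'M[R]_n) : posdef K -> integral_rV (gaussian_density K) = 1.
Proof.
move=> pK; have := gaussian_cos_integral 0 0 pK.
rewrite cos0 mulr1 /bilin !mul0mx dot0l mul0r oppr0 expR0 => <-.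
by apply: eq_integral_rV => a; rewrite dot0l addr0 cos0 mul1r.
Qed.

Lemma gaussian_density_ge0 n (K : 'M[R]_n) a : 0 <= gaussian_density K a.
Proof. by rewrite /gaussian_density mulr_ge0 ?expR_ge0 // divr_ge0 ?sqrtr_ge0 // powR_ge0. Qed.

Lemma gaussian_density_continuous n (K : 'M[R]_n) : seq_continuous (gaussian_density K).
Proof.
apply: seq_continuousM; first exact: seq_continuous_cst.
apply: (@seq_continuous_comp _ _ expR); first exact: continuous_expR.
apply: seq_continuousM; first exact: seq_continuous_cst.
apply: seq_continuous_sum => i; apply: seq_continuous_sum => j.
apply: seq_continuousM; last exact: seq_continuous_coord.
by apply: seq_continuousM; [exact: seq_continuous_coord|exact: seq_continuous_cst].
Qed.

(** The density decays at rate c/2, with c the coercivity constant; half of it absorbs 1 + |v|^2, so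
    the remaining rate c/4 is the same for all h. *)
Lemma gaussian_dominated n (K : 'M[R]_n) : posdef K ->
  exists2 c : R, 0 < c & forall M (h : 'rV[R]_n -> R), seq_continuous h ->
    (forall v, `|h v| <= M * (1 + sqnorm v)) ->
    exists C, dominated C c (fun v => h v * gaussian_density K v).
Proof.
move=> pK; have [c c0 Kc] := posdef_coercive pK.
have c4 : 0 < c / 4 by rewrite divr_gt0.
exists (c / 4) => // M h ch hM.
pose C := Num.sqrt (\det K) / (2 * pi) `^ (n%:R / 2).
have C0 : 0 <= C by rewrite divr_ge0 ?sqrtr_ge0 // powR_ge0.
exists (M * (1 + 4 / c) * C); split=> [|v].
  by apply: seq_continuousM => //; exact: gaussian_density_continuous.
have M0 : 0 <= M.
  have := le_trans (normr_ge0 _) (hM 0); rewrite pmulr_lge0 //.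
  by rewrite ltr_wpDr // sqnorm_ge0.
rewrite normrM (ger0_norm (gaussian_density_ge0 _ _)) /gaussian_density -bilinE -/C.
apply: (@le_trans _ _ (M * ((1 + 4 / c) * expR (c / 4 * sqnorm v)) * (C * expR (- (c / 2) * sqnorm v)))).
  apply: ler_pM => //; first by rewrite mulr_ge0 // expR_ge0.
    apply: le_trans (hM v) _; rewrite ler_wpM2l //.
    have le1 : (1 + 4 / c) * (1 + c / 4 * sqnorm v) <= (1 + 4 / c) * expR (c / 4 * sqnorm v).
      by rewrite ler_wpM2l ?expR_ge1Dx // addr_ge0 // divr_ge0 // ltW.
    apply: le_trans le1.
    have -> : (1 + 4 / c) * (1 + c / 4 * sqnorm v) = 1 + sqnorm v + (4 / c + c / 4 * sqnorm v).
      by field; exact: lt0r_neq0.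
    by rewrite lerDl addr_ge0 ?mulr_ge0 ?sqnorm_ge0 ?invr_ge0 ?(ltW c0).
  by rewrite ler_wpM2l // ler_expR; have := Kc v; lra.
rewrite le_eqVlt; apply/orP; left; apply/eqP.
have -> : expR (- (c / 4) * sqnorm v) = expR (c / 4 * sqnorm v) * expR (- (c / 2) * sqnorm v).
  by rewrite -expRD; congr expR; field.
ring.
Qed.

End GaussianMatrix.

(** * Trigonometric approximation and weak convergence *)

Section TrigApproximation.
Variables (R : realType) (n : nat).
Implicit Types (F G h : 'rV[R]_n -> R) (x y s p u v : 'rV[R]_n) (w : seq 'I_n).

Local Notation "''e_' a" := (delta_mx 0 a : 'rV[R]_n) (at level 8, a at level 2).

(** Real trigonometric polynomials. The phases theta include the sines and make the class closed
    under multiplication by a sine. *)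
Inductive trig : ('rV[R]_n -> R) -> Prop :=
| trig0 : trig (fun=> 0)
| trigS a u theta F : trig F -> trig (fun x => a * cos (dot u x + theta) + F x).

Lemma trigD F G : trig F -> trig G -> trig (fun x => F x + G x).
Proof.
move=> tF tG; elim: tF => [|a u th F' _ IH].
  by have -> : (fun x => 0 + G x) = G by apply/funext => x; rewrite add0r.
have -> : (fun x => a * cos (dot u x + th) + F' x + G x)
  = (fun x => a * cos (dot u x + th) + (F' x + G x)) by apply/funext => x; rewrite addrA.
exact: trigS.
Qed.

Lemma trigZ b F : trig F -> trig (fun x => b * F x).
Proof.
elim=> [|a u th F' _ IH].
  by have -> : (fun _ : 'rV[R]_n => b * 0) = fun=> 0 by [apply/funext => x; rewrite mulr0|]; exact: trig0.
have -> : (fun x => b * (a * cos (dot u x + th) + F' x))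
  = (fun x => b * a * cos (dot u x + th) + b * F' x) by apply/funext => x; rewrite mulrDr mulrA.
exact: trigS.
Qed.

Lemma trig_cst a : trig (fun=> a).
Proof.
have := trigS a 0 0 trig0.
by under eq_fun do rewrite dot0l !addr0 cos0 mulr1.
Qed.

Lemma trig_mul_sin c j F : trig F -> trig (fun x => sin (c * x 0 j) * F x).
Proof.
elim=> [|a u th F' _ IH].
  by under eq_fun do rewrite mulr0; exact: trig0.
have -> : (fun x => sin (c * x 0 j) * (a * cos (dot u x + th) + F' x))
  = (fun x => (a / 2) * cos (dot (u + c *: 'e_j) x + (th - pi / 2))
      + (- (a / 2) * cos (dot (u - c *: 'e_j) x + (th - pi / 2)) + sin (c * x 0 j) * F' x)).
  apply/funext => x; rewrite dotBl dotDl dotZl dot_delta mulrDr addrA; congr (_ + _).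
  rewrite !addrA !cosB cos_pihalf sin_pihalf !mulr0 !add0r !mulr1.
  rewrite [dot u x + _ + th]addrAC [dot u x - _ + th]addrAC sinD sinB; by field.
by apply: trigS; exact: trigS.
Qed.

Section Bernstein.
Variables (p : 'rV[R]_n) (d : R).
Hypothesis p01 : forall j, 0 <= p 0 j <= 1.

(** The expectation of F after a walk from s: for each letter j of w, a step d e_j is taken with
    probability p_j. With N copies of each j, d = 1/N and s = 0 it is the multivariate Bernstein
    polynomial of degree N. *)
Fixpoint bernstein w F s : R :=
  if w is j :: w' then p 0 j * bernstein w' F (s + d *: 'e_j) + (1 - p 0 j) * bernstein w' F s
  else F s.

Lemma le_bernstein w F G s : (forall v, F v <= G v) -> bernstein w F s <= bernstein w G s.
Proof.
move=> FG; elim: w s => [|j w IH] s //=; have /andP[p0 p1] := p01 j.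
by apply: lerD; rewrite ler_wpM2l ?subr_ge0.
Qed.

Lemma bernstein_cst w a s : bernstein w (fun=> a) s = a.
Proof. by elim: w s => [|j w IH] s //=; rewrite !IH; ring. Qed.

Lemma bernsteinD w F G s : bernstein w (fun v => F v + G v) s = bernstein w F s + bernstein w G s.
Proof. by elim: w s => [|j w IH] s //=; rewrite !IH; ring. Qed.

Lemma bernsteinZ w a F s : bernstein w (fun v => a * F v) s = a * bernstein w F s.
Proof. by elim: w s => [|j w IH] s //=; rewrite !IH; ring. Qed.

Lemma bernstein_sum w (I : finType) (F : I -> 'rV[R]_n -> R) s :
  bernstein w (fun v => \sum_i F i v) s = \sum_i bernstein w (F i) s.
Proof.
by elim: w s => [|j w IH] s //=; rewrite !IH !mulr_sumr -big_split.
Qed.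

(** The number of steps in direction j is binomial: the first summand is the squared bias, the
    second the variance. *)
Lemma bernstein_sqr w j q s :
  bernstein w (fun v => (v 0 j - q) ^+ 2) s
  = (s 0 j + d * (count_mem j w)%:R * p 0 j - q) ^+ 2
    + d ^+ 2 * (count_mem j w)%:R * (p 0 j * (1 - p 0 j)).
Proof.
elim: w s => [|i w IH] s /=; first by rewrite !mulr0 !mul0r !addr0.
rewrite !IH !mxE eqxx /= natrD; have [->|ij] := eqVneq i j; rewrite /=; first by ring.
by rewrite mulr0 addr0 add0r; ring.
Qed.

End Bernstein.

Lemma bernstein_trig (c d : R) w F s :
  trig (fun x => bernstein (\row_j ((1 + sin (c * x 0 j)) / 2)) d w F s).
Proof.
elim: w s => [|j w IH] s /=; first exact: trig_cst.
have -> : (fun x => (\row_j ((1 + sin (c * x 0 j)) / 2) : 'rV[R]_n) 0 j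
     * bernstein (\row_j ((1 + sin (c * x 0 j)) / 2)) d w F (s + d *: 'e_j) +
   (1 - (\row_j ((1 + sin (c * x 0 j)) / 2) : 'rV[R]_n) 0 j)
     * bernstein (\row_j ((1 + sin (c * x 0 j)) / 2)) d w F s)
  = (fun x => 2^-1 * bernstein (\row_j ((1 + sin (c * x 0 j)) / 2)) d w F (s + d *: 'e_j)
     + (2^-1 * (sin (c * x 0 j) * bernstein (\row_j ((1 + sin (c * x 0 j)) / 2)) d w F (s + d *: 'e_j))
     + (2^-1 * bernstein (\row_j ((1 + sin (c * x 0 j)) / 2)) d w F s
     + - 2^-1 * (sin (c * x 0 j) * bernstein (\row_j ((1 + sin (c * x 0 j)) / 2)) d w F s)))).
  by apply/funext => x; rewrite !mxE; field.
by do !apply: trigD; apply: trigZ => //; apply: trig_mul_sin.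
Qed.

(** Near x, continuity gives the error e. At distance at least d/2 the bound 2M on the difference is
    at most i |x - y|^2 for i large. Compactness of the box makes one i suffice, with y
    unrestricted. *)
Lemma uniform_quadratic h M L (e : R) : continuous h -> (forall v, `|h v| <= M) -> 0 < e ->
  exists2 K : R, 0 <= K & forall x y, (forall j, `|x 0 j| <= L) ->
    `|h x - h y| <= e + K * sqnorm (x - y).
Proof.
move=> ch hM e0.
have cA := @rV_compact R n (fun=> `[- L, L]%classic) (fun=> @segment_compact _ _ _).
have M0 : 0 <= M by exact: le_trans (normr_ge0 _) (hM 0).
have [|K _ KP] := (compact_near_coveringP _).1 cA nat \oo
   (fun i x => forall y, `|h x - h y| <= e + i%:R * sqnorm (x - y)) _.
  move=> x _.
  have : \forall z \near x, `|h x - h z| < e / 2.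
    by move: (ch x) => /cvgrPdist_lt; apply; rewrite divr_gt0.
  move=> /nbhs_ballP [d /= d0 hd].
  exists (ball x (d / 2), [set i | 2 * M / (d / 2) ^+ 2 <= i%:R]) => /=.
    split; first by apply: nbhsx_ballx; rewrite divr_gt0.
    exact: nbhs_infty_ger.
  move=> [z i] [/= xz Mi] y.
  have [xy|] := pselect (ball x d y).
    have hxz : `|h x - h z| < e / 2.
      by apply: hd; apply: le_ball xz; rewrite ler_pdivrMr // ler_pMr // ler1n.
    have := ler_distD (h x) (h z) (h y); have := hd y xy; rewrite distrC in hxz.
    have : 0 <= i%:R * sqnorm (z - y) by rewrite mulr_ge0 ?sqnorm_ge0.
    by rewrite /=; lra.
  move=> nb; have [k /existsNP [j /negP]] : exists k, ~ forall j, ball (x k j) d (y k j).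
    by apply/existsNP => xyd; apply: nb; split.
  rewrite (ord1 k) /ball /= -leNgt => yd.
  have zd : d / 2 <= `|z 0 j - y 0 j|.
    have [_ /(_ 0 j)] := xz; rewrite /ball /= => xzj.
    have := ler_distD (z 0 j) (x 0 j) (y 0 j); lra.
  have sq : (d / 2) ^+ 2 <= sqnorm (z - y).
    rewrite /sqnorm (bigD1 j) //= -[X in X <= _]addr0; apply: lerD; last by apply: sumr_ge0 => ? _; exact: sqr_ge0.
    rewrite !mxE -[(z 0 j - _) ^+ 2]real_normK ?num_real // lerXn2r ?nnegrE //.
    by rewrite divr_ge0 // ltW.
  have d2 : 0 < (d / 2) ^+ 2 by rewrite exprn_gt0 // divr_gt0.
  have : 2 * M <= i%:R * sqnorm (z - y).
    move: Mi; rewrite ler_pdivrMr // => /le_trans; apply; rewrite ler_wpM2l //.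
  have := ler_normB (h z) (h y); have := hM z; have := hM y; lra.
exists K%:R => // x y xL; have := KP K (leqnn _) x _ y; apply => j.
by rewrite /= in_itv /= -ler_norml.
Qed.

(** Half sum and half difference are at most 5/4 in absolute value. There cos >= 1/5 and |sin z| >=
    7/10 |z|, so |sin a - sin b| >= 7/50 |a - b|, and 7/50 >= 1/8. *)
Lemma sin_sub_ge (a b : R) : `|a| <= 1 / 2 -> `|b| <= pi / 2 -> `|a - b| <= 8 * `|sin a - sin b|.
Proof.
move=> a1 b1.
have pi4 : pi / 2 <= 2 :> R by exact: ltW (pihalf_lt2 R).
have -> : sin a - sin b = 2 * (sin ((a - b) / 2) * cos ((a + b) / 2)).
  have -> : sin a = sin ((a + b) / 2 + (a - b) / 2) by congr sin; field.
  have -> : sin b = sin ((a + b) / 2 - (a - b) / 2) by congr sin; field.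
  by rewrite sinD sinB; ring.
have sq (z : R) : `|z| <= 5 / 4 -> z ^+ 2 <= 25 / 16.
  move=> z1; rewrite -real_normK ?num_real //.
  have -> : 25 / 16 = (5 / 4) ^+ 2 :> R by field.
  by rewrite lerXn2r ?nnegrE // divr_ge0.
have half (z : R) : `|z| <= 5 / 2 -> `|z / 2| <= 5 / 4.
  by rewrite normrM normfV (ger0_norm (ler0n _ 2)); lra.
have c1 : 1 / 5 <= cos ((a + b) / 2).
  have /half/sq : `|a + b| <= 5 / 2 by have := ler_normD a b; lra.
  have := cos_diff_le ((a + b) / 2); rewrite ler_norml => /andP[]; lra.
have s1 : 7 / 10 * `|(a - b) / 2| <= `|sin ((a - b) / 2)|.
  have /half/sq : `|a - b| <= 5 / 2 by have := ler_normB a b; lra.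
  set z := (a - b) / 2; rewrite -[z ^+ 2]real_normK ?num_real // => z2.
  have : `|z| ^+ 3 <= 25 / 16 * `|z| by rewrite exprSr ler_wpM2r.
  have := sin_taylor z; have := ler_distD (sin z) z 0; rewrite !subr0 (distrC z).
  have := normr_ge0 z; lra.
rewrite !normrM (ger0_norm (ler0n _ 2)) (ger0_norm (le_trans _ c1)); last by lra.
have : 1 / 5 * `|sin ((a - b) / 2)| <= `|sin ((a - b) / 2)| * cos ((a + b) / 2).
  by rewrite mulrC ler_wpM2l.
have : `|(a - b) / 2| = `|a - b| / 2 by rewrite normrM normfV (ger0_norm (ler0n _ 2)).
have := normr_ge0 (a - b); lra.
Qed.

(** Inside the box |x_j| <= L the change of variable p = (1 + sin (x / 2L)) / 2 is inverted by an
    arcsine, and the Bernstein polynomial of h in p is close to h. Outside the box both functions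
    are bounded by M and 2M <= 2M |x|^2 / L^2. *)
Lemma trig_approx h M (L e : R) : continuous h -> (forall v, `|h v| <= M) -> 0 < e -> 0 < L ->
  exists2 B, trig B & forall x, `|h x - B x| <= e + 2 * M / L ^+ 2 * sqnorm x.
Proof.
move=> ch hM e0 L0; have M0 : 0 <= M by exact: le_trans (normr_ge0 _) (hM 0).
have [K K0 hK] := uniform_quadratic L ch hM (divr_gt0 e0 (ltr0n R 2)).
(* Inside the box |c x_j| <= 1/2, away from the critical points of the sine, as [sin_sub_ge]
   requires. *)
pose c : R := (2 * L)^-1; have c0 : 0 < c by rewrite invr_gt0 mulr_gt0.
pose clamp (z : R) := Num.max (- 1) (Num.min 1 z).
pose X s : 'rV[R]_n := \row_j (asin (clamp (2 * s 0 j - 1)) / c).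
(* Each coordinate has variance at most 1/N; this N makes K (32 L)^2 n / N at most e/2. *)
pose N := (Num.truncn (2 * (K * (32 * L) ^+ 2) * n%:R / e)).+1.
pose w := flatten [seq nseq N j | j <- enum 'I_n].
have wN j : count_mem j w = N.
  rewrite /w count_flatten -map_comp sumnE big_map big_enum /= (bigD1 j) //= count_nseq /= eqxx mul1n.
  by rewrite big1 ?addn0 // => i ij; rewrite count_nseq /= (negPf ij).
pose p x : 'rV[R]_n := \row_j ((1 + sin (c * x 0 j)) / 2).
have p01 x j : 0 <= p x 0 j <= 1.
  by rewrite mxE; have := sin_le1 (c * x 0 j); have := sin_geN1 (c * x 0 j); lra.
exists (fun x => bernstein (p x) N%:R^-1 w (h \o X) 0); first exact: bernstein_trig.
move=> x; set B := bernstein _ _ _ _ _.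
have BM : `|B| <= M.
  rewrite ler_norml -[X in X <= _ <= _](bernstein_cst (p x) N%:R^-1 w _ 0).
  rewrite -[X in _ <= _ <= X](bernstein_cst (p x) N%:R^-1 w _ 0).
  by rewrite !le_bernstein // => v; have := hM (X v); rewrite ler_norml => /andP[].
have [xL|] := pselect (forall j, `|x 0 j| <= L); last first.
  move=> /existsNP [j /negP]; rewrite -ltNge => xj.
  have le2M : 2 * M <= 2 * M / L ^+ 2 * sqnorm x.
    rewrite -mulrA ler_peMr ?mulr_ge0 // mulrC ler_pdivlMr ?exprn_gt0 // mul1r.
    rewrite /sqnorm (bigD1 j) //= -[X in X <= _]addr0; apply: lerD; last by apply: sumr_ge0 => ? _; exact: sqr_ge0.
    by rewrite -[x 0 j ^+ 2]real_normK ?num_real // lerXn2r ?nnegrE ?(ltW L0) ?(ltW xj).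
  apply: le_trans (ler_normB _ _) _; have := hM x; lra.
have clampE (z : R) : -1 <= clamp z <= 1.
  by rewrite /clamp /Num.max /Num.min; do ![case: ifP]; lra.
have clamp_le (y z : R) : -1 <= y <= 1 -> `|y - clamp z| <= `|y - z|.
  rewrite /clamp /Num.max /Num.min => y1.
  case: (ltP 1 z) => z1; first by case: ltP => ?; rewrite !ler0_norm; lra.
  by case: ltP => z2; rewrite // ?ger0_norm; lra.
(* The constant is 8 * 2 * 2L: 8 from [sin_sub_ge], 2 from p = (1 + sin) / 2, and 1 / c = 2L. *)
have sX s j : `|x 0 j - X s 0 j| <= 32 * L * `|s 0 j - p x 0 j|.
  rewrite mxE; set q := clamp _; have [asin_le asinE] := asin_def (clampE (2 * s 0 j - 1)).
  rewrite -/q in asin_le asinE.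
  have cx : `|c * x 0 j| <= 1 / 2.
    rewrite normrM (gtr0_norm c0) /c invfM -mulrA mul1r ler_piMr // ler_pdivrMl // mulr1.
    exact: xL.
  have := sin_sub_ge cx; rewrite -ler_norml in asin_le; move=> /(_ _ asin_le); rewrite asinE => le8.
  have -> : x 0 j - asin q / c = (c * x 0 j - asin q) / c by field; rewrite gt_eqF.
  rewrite normrM normfV (gtr0_norm c0) ler_pdivrMr //; apply: le_trans le8 _.
  have -> : 32 * L * `|s 0 j - p x 0 j| * c = 8 * (2 * `|s 0 j - p x 0 j|).
    by rewrite /c; field; rewrite gt_eqF.
  rewrite ler_wpM2l //.
  have -> : 2 * `|s 0 j - p x 0 j| = `|sin (c * x 0 j) - (2 * s 0 j - 1)|.
    rewrite -{1}(ger0_norm (ler0n R 2)) -normrM distrC mxE; congr `|_|; by field.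
  by apply: clamp_le; rewrite sin_geN1 sin_le1.
have hX s : `|h (X s) - h x| <= e / 2 + K * (32 * L) ^+ 2 * \sum_j (s 0 j - p x 0 j) ^+ 2.
  rewrite distrC; apply: le_trans (hK _ _ xL) _; rewrite lerD2l -mulrA ler_wpM2l // mulr_sumr.
  apply: ler_sum => j _; rewrite !mxE -[X in X <= _]real_normK ?num_real //.
  rewrite -[(s 0 j - _) ^+ 2]real_normK ?num_real // -exprMn lerXn2r ?nnegrE ?mulr_ge0 ?(ltW L0) //.
  by have := sX s j; rewrite !mxE.
have Bx : bernstein (p x) N%:R^-1 w (fun s => e / 2 + K * (32 * L) ^+ 2 * \sum_j (s 0 j - p x 0 j) ^+ 2) 0 <= e.
  rewrite bernsteinD bernstein_cst bernsteinZ bernstein_sum.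
  have N0 : 0 < N%:R :> R by rewrite ltr0n.
  have : \sum_j bernstein (p x) N%:R^-1 w (fun s => (s 0 j - p x 0 j) ^+ 2) 0 <= n%:R / N%:R.
    have -> : n%:R / N%:R = \sum_(j < n) N%:R^-1 :> R by rewrite sumr_const card_ord mulr_natl.
    apply: ler_sum => j _.
    rewrite bernstein_sqr wN mxE mulVf ?gt_eqF // mul1r add0r subrr expr0n add0r.
    have -> : N%:R^-1 ^+ 2 * N%:R = N%:R^-1 :> R by rewrite expr2 mulfVK ?gt_eqF.
    rewrite ler_piMr ?invr_ge0 ?(ltW N0) //.
    by have /andP[] := p01 x j; nra.
  set S := \sum_j _ => Sn; have K1 : 0 <= K * (32 * L) ^+ 2 by rewrite mulr_ge0 ?sqr_ge0.
  have : K * (32 * L) ^+ 2 * S <= e / 2; last by lra.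
  apply: le_trans (ler_wpM2l K1 Sn) _; rewrite mulrA ler_pdivrMr //.
  have := truncnS_gt (2 * (K * (32 * L) ^+ 2) * n%:R / e); rewrite -/N ltr_pdivrMr // => /ltW; lra.
have B1 : bernstein (p x) N%:R^-1 w (fun s => h (X s) - h x) 0 = B - h x.
  by rewrite bernsteinD bernstein_cst.
have Be : `|B - h x| <= e.
  rewrite -B1 ler_norml; apply/andP; split.
    apply: le_trans (_ : - bernstein (p x) N%:R^-1 w (fun s => e / 2 + K * (32 * L) ^+ 2 * \sum_j (s 0 j - p x 0 j) ^+ 2) 0 <= _).
      by rewrite lerN2.
    rewrite -mulN1r -bernsteinZ; apply: le_bernstein => // v; rewrite mulN1r.
    by have := hX v; rewrite ler_norml => /andP[].
  apply: le_trans Bx; apply: le_bernstein => // v.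
  by have := hX v; rewrite ler_norml => /andP[].
rewrite distrC; apply: le_trans Be _; rewrite lerDl mulr_ge0 ?sqnorm_ge0 // divr_ge0 ?sqr_ge0 // mulr_ge0 //.
Qed.

End TrigApproximation.

(** * From characteristic functions to weak convergence *)

Section GaussianConvergence.
Variables (R : realType) (n : nat) (K : 'M[R]_n).
Implicit Types (F G h B : 'rV[R]_n -> R).
Hypothesis pK : posdef K.

Lemma seq_continuous_dot (u : 'rV[R]_n) : seq_continuous (dot u).
Proof.
have -> : dot u = (fun x => \sum_j u 0 j * x 0 j) by apply/funext => x; exact: dotE.
apply: seq_continuous_sum => j.
by apply: seq_continuousM; [exact: seq_continuous_cst|exact: seq_continuous_coord].
Qed.

Lemma seq_continuous_cos_dot (u : 'rV[R]_n) (theta : R) :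
  seq_continuous (fun x => cos (dot u x + theta)).
Proof.
apply: (@seq_continuous_comp _ _ cos); first exact: continuous_cos.
by apply: seq_continuousD; [exact: seq_continuous_dot|exact: seq_continuous_cst].
Qed.

Lemma trig_bounded B : trig B -> seq_continuous B /\ exists M, forall x, `|B x| <= M.
Proof.
elim=> [|a u th F _ [cF [M FM]]].
  by split; [exact: seq_continuous_cst|exists 0 => x; rewrite normr0].
split.
  apply: seq_continuousD => //; apply: seq_continuousM; first exact: seq_continuous_cst.
  exact: seq_continuous_cos_dot.
exists (`|a| + M) => x; apply: le_trans (ler_normD _ _) _; apply: lerD => //.
by rewrite normrM ler_piMr // ler_norml cos_geN1 cos_le1.
Qed.

(** [E k] is a normalized positive functional. Replacing h by a trigonometric polynomial B costs at
    most 2e/5 under [E k] and under the Gaussian, by the bounds on second moments; on B the assumed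
    convergence leaves e/5. *)
Lemma gaussian_convergence (E : nat -> ('rV[R]_n -> R) -> R) (S : R) :
  (forall k a F G, E k (fun x => a * F x + G x) = a * E k F + E k G) ->
  (forall k F G, (forall x, F x <= G x) -> E k F <= E k G) ->
  (forall k, E k (fun=> 1) = 1) ->
  (forall k, E k (@sqnorm R n) <= S) ->
  (forall u theta, E k (fun x => cos (dot u x + theta)) @[k --> \oo]
     --> expR (- (bilin (invmx K) u u / 2)) * cos theta) ->
  forall h M, continuous h -> (forall x, `|h x| <= M) ->
  E k h @[k --> \oo] --> integral_rV (fun x => h x * gaussian_density K x).
Proof.
move=> Elin Ele E1 ES Ecos h M ch hM.
have M0 : 0 <= M by exact: le_trans (normr_ge0 _) (hM 0).
have uK := posdef_unit pK; have [c c0 dom] := gaussian_dominated pK.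
pose I F := integral_rV (fun x => F x * gaussian_density K x).
pose quad F := seq_continuous F /\ exists N, forall x, `|F x| <= N * (1 + sqnorm x).
have quadb F N : seq_continuous F -> (forall x, `|F x| <= N) -> quad F.
  move=> cF FN; split=> //; exists N => x; apply: le_trans (FN x) _.
  by rewrite ler_peMr ?lerDl ?sqnorm_ge0 // (le_trans (normr_ge0 _) (FN x)).
have domq F : quad F -> exists C, dominated C c (fun v => F v * gaussian_density K v).
  by move=> [cF [N FN]]; exact: dom cF FN.
have IL a F G : quad F -> quad G -> I (fun x => a * F x + G x) = a * I F + I G.
  move=> /domq [C dC] /domq [C' dC'].
  rewrite /I -(integral_rVZ a c0 dC).
  have daC : dominated (`|a| * C) c (fun v => a * (F v * gaussian_density K v)).
    split=> [|v]; first by apply: seq_continuousM; [exact: seq_continuous_cst|exact: dC.1].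
    by rewrite normrM -mulrA ler_wpM2l //; exact: dC.2.
  rewrite -(integral_rVD c0 daC dC'); apply: eq_integral_rV => v.
  by rewrite mulrDl mulrA.
have Ile F G : quad F -> quad G -> (forall x, F x <= G x) -> I F <= I G.
  move=> /domq [C dC] /domq [C' dC'] FG; apply: (le_integral_rV c0 dC dC') => v.
  by rewrite ler_wpM2r // gaussian_density_ge0.
have qcst a : quad (fun=> a) by apply: (quadb _ `|a|) => //; exact: seq_continuous_cst.
have Icst a : I (fun=> a) = a.
  have := IL a (fun=> 1) (fun=> 0) (qcst 1) (qcst 0).
  have -> : I (fun=> 1) = 1.
    transitivity (integral_rV (gaussian_density K)); last exact: gaussian_integral.
    by apply: eq_integral_rV => x; rewrite mul1r.
  have -> : I (fun=> 0) = 0.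
    have := IL (-1) (fun=> 0) (fun=> 0) (qcst 0) (qcst 0); under eq_fun do rewrite mulr0 addr0.
    by rewrite mulN1r addNr.
  by under eq_fun do rewrite mulr1 addr0; rewrite mulr1 addr0.
have Icos u th : I (fun x => cos (dot u x + th)) = expR (- (bilin (invmx K) u u / 2)) * cos th.
  have := gaussian_cos_integral (u *m invmx K) th pK.
  rewrite mulmxKV // /I => ->; congr (expR (- (_ / 2)) * _).
  by rewrite /bilin mulmxKV // dotC.
have E0 k : E k (fun=> 0) = 0.
  have := Elin k (-1) (fun=> 0) (fun=> 0); under eq_fun do rewrite mulr0 addr0.
  by rewrite mulN1r addNr.
have Ecst k a : E k (fun=> a) = a.
  by have := Elin k a (fun=> 1) (fun=> 0); under eq_fun do rewrite mulr1 addr0; rewrite E1 E0 mulr1 addr0.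
have qtrig B : trig B -> quad B.
  by move=> /trig_bounded [cB [N BN]]; exact: quadb cB BN.
have EB B : trig B -> E k B @[k --> \oo] --> I B.
  elim=> [|a u th F tF IH].
    by rewrite Icst; under eq_fun do rewrite E0; exact: cvg_cst.
  rewrite IL; last 2 first.
  - by apply: (quadb _ 1); [exact: seq_continuous_cos_dot|move=> x; rewrite ler_norml cos_geN1 cos_le1].
  - exact: qtrig.
  under eq_fun do rewrite Elin; apply: cvgD => //.
  by rewrite Icos; apply: cvgMl_tmp; exact: Ecos.
have qsq : quad (@sqnorm R n).
  split.
    apply: seq_continuous_sum => j; apply: (@seq_continuousM _ _ (fun v => v 0 j) (fun v => v 0 j)).
      exact: seq_continuous_coord.
    exact: seq_continuous_coord.
  by exists 1 => x; rewrite mul1r ger0_norm ?sqnorm_ge0 // lerDr.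
have qh : quad h by apply: quadb hM; exact: continuous_seq.
pose S' := Num.max S (I (@sqnorm R n)).
have S'0 : 0 <= S'.
  by rewrite le_max; apply/orP; right; rewrite -[0](Icst 0); apply: Ile => // x; exact: sqnorm_ge0.
apply/cvgrPdist_le => e e0.
(* Chosen so that the quadratic error 2M S' / L^2 is at most e/5; the added 1 keeps L positive. *)
pose L := Num.sqrt (2 * M * S' * 5 / e + 1).
have L20 : 0 < 2 * M * S' * 5 / e + 1.
  by rewrite ltr_wpDl // divr_ge0 ?(ltW e0) // !mulr_ge0.
have L0 : 0 < L by rewrite sqrtr_gt0.
have e5 : 0 < e / 5 by rewrite divr_gt0.
have [B tB hB] := trig_approx ch hM e5 L0.
pose a := 2 * M / L ^+ 2.
have a0 : 0 <= a by rewrite divr_ge0 ?sqr_ge0 // mulr_ge0.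
have aS : a * S' <= e / 5.
  rewrite /a /L sqr_sqrtr ?(ltW L20) // mulrAC ler_pdivrMr //.
  have -> : e / 5 * (2 * M * S' * 5 / e + 1) = 2 * M * S' + e / 5 by field; rewrite gt_eqF.
  by rewrite lerDl ltW.
(* Stated for an abstract functional, since it is applied both to [E k] and to the Gaussian
   integral, which is linear and monotone on the class [quad]. *)
have sub (T : ('rV[R]_n -> R) -> R) :
    (forall F G, quad F -> quad G -> (forall x, F x <= G x) -> T F <= T G) ->
    (forall b F G, quad F -> quad G -> T (fun x => b * F x + G x) = b * T F + T G) ->
    (forall b, T (fun=> b) = b) -> T (@sqnorm R n) <= S' -> `|T h - T B| <= 2 * (e / 5).
  move=> Tle TL Tcst TS.
  have qbd : quad (fun x => a * sqnorm x + e / 5).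
    split; first by apply: seq_continuousD; [apply: seq_continuousM; [exact: seq_continuous_cst|exact: qsq.1]|exact: seq_continuous_cst].
    exists (a + e / 5) => x; rewrite ger0_norm; last by apply: addr_ge0; [apply: mulr_ge0 => //; exact: sqnorm_ge0|exact: ltW].
    rewrite mulrDl; apply: lerD; first by rewrite ler_wpM2l // lerDr.
    by rewrite ler_peMr ?(ltW e5) // lerDl sqnorm_ge0.
  have Tbd : T (fun x => a * sqnorm x + e / 5) <= 2 * (e / 5).
    rewrite TL // Tcst; have := ler_wpM2l a0 TS; lra.
  have qhB : quad (fun x => -1 * B x + h x).
    have [cB [N BN]] := trig_bounded tB.
    apply: (quadb _ (N + M)).
      by apply: seq_continuousD; [apply: seq_continuousM => //; exact: seq_continuous_cst|exact: qh.1].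
    by move=> x; apply: le_trans (ler_normD _ _) _; rewrite mulN1r normrN lerD.
  have -> : T h - T B = T (fun x => -1 * B x + h x) by rewrite TL //; [ring|exact: qtrig].
  have up : T (fun x => -1 * B x + h x) <= 2 * (e / 5).
    apply: le_trans Tbd; apply: Tle => // x; rewrite mulN1r addrC.
    by have := hB x; rewrite ler_norml => /andP[_]; rewrite -/a [e / 5 + _]addrC.
  have lo : - (2 * (e / 5)) <= T (fun x => -1 * B x + h x).
    have : T (fun x => -1 * (a * sqnorm x + e / 5) + 0) <= T (fun x => -1 * B x + h x).
      apply: Tle => //.
        split; first by apply: seq_continuousD; [apply: seq_continuousM; [exact: seq_continuous_cst|exact: qbd.1]|exact: seq_continuous_cst].
        by have [_ [N bN]] := qbd; exists N => x; rewrite addr0 mulN1r normrN.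
      by move=> x; have := hB x; rewrite ler_norml => /andP[+ _]; rewrite -/a; lra.
    by rewrite (TL (-1) (fun x => a * sqnorm x + e / 5)) // Tcst; lra.
  by rewrite ler_norml lo up.
have hI : `|I h - I B| <= 2 * (e / 5) by apply: sub => //; rewrite le_max lexx orbT.
have /cvgrPdist_le /(_ _ e5) := EB B tB; apply: filterS => k kB.
have hE : `|E k h - E k B| <= 2 * (e / 5).
  by apply: sub => //; [move=> F G _ _; exact: Ele|rewrite le_max ES].
have := ler_distD (I B) (I h) (E k h); have := ler_distD (E k B) (I B) (E k h).
by rewrite (distrC (E k B) (E k h)); rewrite -/(I h); lra.
Qed.

End GaussianConvergence.

(** * Characteristic functions and moments *)

Lemma norm_exprB (A : numDomainType) (x y : A) n : `|x| <= 1 -> `|y| <= 1 ->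
  `|x ^+ n - y ^+ n| <= n%:R * `|x - y|.
Proof.
move=> x1 y1; elim: n => [|n IH]; first by rewrite subrr normr0 mul0r.
have -> : x ^+ n.+1 - y ^+ n.+1 = x * (x ^+ n - y ^+ n) + (x - y) * y ^+ n by rewrite !exprS; ring.
apply: le_trans (ler_normD _ _) _; rewrite -natr1 (mulrDl n%:R) mul1r; apply: lerD.
  by rewrite normrM; apply: le_trans (ler_wpM2r _ x1) _; rewrite ?mul1r.
by rewrite normrM ler_piMr // normrX exprn_ile1.
Qed.

(** Telescoping: factors are exchanged one at a time, the others having norm at most 1. *)
Lemma norm_prodB (A : numDomainType) (I : Type) (s : seq I) (x y : I -> A) :
  (forall i, `|x i| <= 1) -> (forall i, `|y i| <= 1) ->
  `|\prod_(i <- s) x i - \prod_(i <- s) y i| <= \sum_(i <- s) `|x i - y i|.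
Proof.
move=> x1 y1; elim: s => [|i s IH]; first by rewrite !big_nil subrr normr0.
have p1 : `|\prod_(j <- s) y j| <= 1.
  by rewrite normr_prod; apply: prodr_ile1 => j _; rewrite normr_ge0 y1.
rewrite !big_cons.
have -> : x i * \prod_(j <- s) x j - y i * \prod_(j <- s) y j
  = x i * (\prod_(j <- s) x j - \prod_(j <- s) y j) + (x i - y i) * \prod_(j <- s) y j by ring.
apply: le_trans (ler_normD _ _) _; rewrite addrC; apply: lerD.
  by rewrite normrM ler_piMr.
by rewrite normrM; apply: le_trans (ler_wpM2r _ (x1 i)) _; rewrite ?mul1r.
Qed.

Section CharacteristicFunction.
Variable R : realType.
Implicit Types (x y e : R).

Definition cis x : R[i] := (cos x +i* sin x)%C.

Lemma cisD x y : cis (x + y) = cis x * cis y.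
Proof.
apply/eqP; rewrite eq_complex /= cosD sinD; apply/andP; split=> //.
by rewrite addrC.
Qed.

Lemma cis0 : cis 0 = 1.
Proof. by rewrite /cis cos0 sin0. Qed.

Lemma norm_cis x : `|cis x| = 1.
Proof. by rewrite normc_def /= cos2Dsin2 sqrtr1. Qed.

Lemma normc_le (z : R[i]) a b : `|complex.Re z| <= a -> `|complex.Im z| <= b -> `|z| <= (a + b)%:C%C.
Proof.
move=> za zb; have a0 := le_trans (normr_ge0 _) za; have b0 := le_trans (normr_ge0 _) zb.
rewrite normc_def lecR -[leRHS]ger0_norm ?addr_ge0 // -sqrtr_sqr ler_wsqrtr //.
have : complex.Re z ^+ 2 <= a ^+ 2 by rewrite -real_normK ?num_real // lerXn2r ?nnegrE.
have : complex.Im z ^+ 2 <= b ^+ 2 by rewrite -real_normK ?num_real // lerXn2r ?nnegrE.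
by have := mulr_ge0 a0 b0; nra.
Qed.

(** The mean is 0, so the imaginary part starts at third order, giving e sqrt e; the real part
    agrees with the exponential up to e^2. *)
Lemma cis_sum_taylor d (p y : 'I_d -> R) (A e : R) :
  (forall j, 0 <= p j) -> \sum_j p j = 1 -> \sum_j p j * y j = 0 ->
  (forall j, `|y j| <= A) -> 0 <= e ->
  `|\sum_j (p j)%:C%C * cis (Num.sqrt e * y j)
     - (expR (- (e * (\sum_j p j * y j ^+ 2) / 2)))%:C%C|
  <= ((A ^+ 4 + A ^+ 3) * (e ^+ 2 + e * Num.sqrt e))%:C%C.
Proof.
move=> p0 p1 py yA e0; set q := Num.sqrt e; set s := \sum_j p j * y j ^+ 2.
have q0 : 0 <= q by exact: sqrtr_ge0.
have qq : q ^+ 2 = e by rewrite sqr_sqrtr.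
have d0 : 0 <= A.
  have [j _|d0] := pickP 'I_d; first exact: le_trans (normr_ge0 _) (yA j).
  by move: p1; rewrite big1 => [/eqP|j _]; [rewrite eq_sym oner_eq0|have := d0 j].
have ysq j : y j ^+ 2 <= A ^+ 2 by rewrite -real_normK ?num_real // lerXn2r ?nnegrE.
have s0 : 0 <= s by apply: sumr_ge0 => j _; rewrite mulr_ge0 // sqr_ge0.
have avg (F : 'I_d -> R) B : (forall j, F j <= B) -> \sum_j p j * F j <= B.
  move=> FB; rewrite -[B]mul1r -p1 mulr_suml; apply: ler_sum => j _.
  by rewrite ler_wpM2l.
have avgn (F : 'I_d -> R) B : (forall j, `|F j| <= B) -> `|\sum_j p j * F j| <= B.
  move=> FB; apply: le_trans (ler_norm_sum _ _ _) _; apply: le_trans (avg _ _ FB).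
  by apply: ler_sum => j _; rewrite normrM (ger0_norm (p0 j)).
have sA : s <= A ^+ 2 by exact: avg.
have re : complex.Re (\sum_j (p j)%:C%C * cis (q * y j)) = \sum_j p j * cos (q * y j).
  by rewrite raddf_sum; apply: eq_bigr => j _; rewrite /= mul0r subr0.
have im : complex.Im (\sum_j (p j)%:C%C * cis (q * y j)) = \sum_j p j * sin (q * y j).
  by rewrite raddf_sum; apply: eq_bigr => j _; rewrite /= mul0r addr0.
have re1 : `|\sum_j p j * cos (q * y j) - (1 - e * s / 2)| <= A ^+ 4 * e ^+ 2 / 24.
  have -> : \sum_j p j * cos (q * y j) - (1 - e * s / 2)
      = \sum_j p j * (cos (q * y j) - (1 - (q * y j) ^+ 2 / 2)).
    transitivity (\sum_j p j * cos (q * y j) - (\sum_j p j - e * s / 2)); first by rewrite p1.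
    rewrite /s mulr_sumr mulr_suml -!sumrB; apply: eq_bigr => j _.
    by rewrite exprMn qq; field.
  apply: avgn => j; apply: le_trans (cos_taylor _) _.
  rewrite ler_pM2r ?invr_gt0 // exprMn mulrC -[4%N]/(2 * 2)%N !exprM qq.
  by rewrite ler_wpM2r ?sqr_ge0 // lerXn2r ?nnegrE ?sqr_ge0.
have re2 : `|expR (- (e * s / 2)) - (1 - e * s / 2)| <= A ^+ 4 * e ^+ 2 / 4.
  apply: le_trans (expR_taylor _) _; first by rewrite divr_ge0 // mulr_ge0.
  have -> : A ^+ 4 * e ^+ 2 / 4 = (e * A ^+ 2 / 2) ^+ 2 by field.
  rewrite lerXn2r ?nnegrE ?divr_ge0 ?mulr_ge0 ?sqr_ge0 //.
  by rewrite ler_pM2r ?invr_gt0 // ler_wpM2l.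
have im1 : `|\sum_j p j * sin (q * y j)| <= A ^+ 3 * (e * q) / 6.
  have -> : \sum_j p j * sin (q * y j) = \sum_j p j * (sin (q * y j) - q * y j).
    transitivity (\sum_j p j * sin (q * y j) - q * \sum_j p j * y j); first by rewrite py mulr0 subr0.
    rewrite mulr_sumr -sumrB; apply: eq_bigr => j _.
    ring.
  apply: avgn => j; apply: le_trans (sin_taylor _) _.
  rewrite ler_pM2r ?invr_gt0 // normrM (ger0_norm q0) exprMn.
  have -> : q ^+ 3 = e * q by rewrite exprSr qq.
  by rewrite mulrC ler_wpM2r ?mulr_ge0 // lerXn2r ?nnegrE.
have eq0 : 0 <= e * q by rewrite mulr_ge0.
have A4 : 0 <= A ^+ 4 * e ^+ 2 by rewrite mulr_ge0 ?sqr_ge0 // exprn_ge0.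
have A3 : 0 <= A ^+ 3 * (e * q) by rewrite mulr_ge0 // exprn_ge0.
have A43 : 0 <= A ^+ 4 * (e * q) by rewrite mulr_ge0 // exprn_ge0.
have A34 : 0 <= A ^+ 3 * e ^+ 2 by rewrite mulr_ge0 ?sqr_ge0 // exprn_ge0.
apply: (@le_trans _ _ ((A ^+ 4 * e ^+ 2 / 24 + A ^+ 4 * e ^+ 2 / 4) + A ^+ 3 * (e * q) / 6)%:C%C).
  apply: normc_le; last by rewrite raddfB /= im subr0.
  rewrite raddfB /= re.
  have := ler_distD (1 - e * s / 2) (\sum_j p j * cos (q * y j)) (expR (- (e * s / 2))).
  by move/le_trans; apply; rewrite lerD // distrC.
by rewrite lecR; lra.
Qed.

(* The N n k factors of index k are the independent copies of a centred variable
   taking the value y k j with probability p k j. *)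
Lemma cis_clt m (d : 'I_m -> nat) (p y : forall k, 'I_(d k) -> R) (tau : 'I_m -> R)
    (eps : nat -> R) (N : nat -> 'I_m -> nat) (theta : R) :
  (forall k j, 0 <= p k j) -> (forall k, \sum_j p k j = 1) ->
  (forall k, \sum_j p k j * y k j = 0) ->
  (forall n, 0 < eps n) -> eps n @[n --> \oo] --> (0 : R) ->
  (forall n k, (N n k)%:R = tau k / eps n) ->
  complex.Re (cis theta * \prod_k (\sum_j (p k j)%:C%C * cis (Num.sqrt (eps n) * y k j)) ^+ N n k)
    @[n --> \oo] --> expR (- ((\sum_k tau k * \sum_j p k j * y k j ^+ 2) / 2)) * cos theta.
Proof.
move=> p0 p1 py eps0 epscvg NE.
pose A k := \sum_j `|y k j|.
have yA k j : `|y k j| <= A k by rewrite /A (bigD1 j) //= lerDl sumr_ge0.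
have A0 k : 0 <= A k by exact: sumr_ge0.
have tau0 k : 0 <= tau k.
  by have := ler0n R (N 0%N k); rewrite NE pmulr_lge0 // invr_gt0.
pose s k := \sum_j p k j * y k j ^+ 2.
have s0 k : 0 <= s k by apply: sumr_ge0 => j _; rewrite mulr_ge0 // sqr_ge0.
pose b n k : R[i] := \sum_j (p k j)%:C%C * cis (Num.sqrt (eps n) * y k j).
pose a n k : R[i] := (expR (- (eps n * s k / 2)))%:C%C.
pose Q := expR (- ((\sum_k tau k * s k) / 2)).
(* As N_k eps = tau_k, the product of the approximating exponentials is exactly the Gaussian limit,
   for every n. *)
have aQ n : \prod_k a n k ^+ N n k = Q%:C%C.
  rewrite /a; under eq_bigr do rewrite -rmorphXn -expRM_natl.
  rewrite -rmorph_prod -expR_sum; congr ((expR _)%:C%C).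
  rewrite mulr_suml -sumrN; apply: eq_bigr => k _; rewrite NE mulrN; congr (- _).
  by field; rewrite gt_eqF.
have b1 n k : `|b n k| <= 1.
  apply: le_trans (ler_norm_sum _ _ _) _.
  have -> : (1 : R[i]) = \sum_j (p k j)%:C%C by rewrite -rmorph_sum p1.
  apply: ler_sum => j _; rewrite normrM norm_cis mulr1 ger0_norm //.
  by rewrite -[0]/(0%:C%C) lecR.
have a1 n k : `|a n k| <= 1.
  rewrite ger0_norm; last by rewrite -[0]/(0%:C%C) lecR expR_ge0.
  rewrite -[1]/(1%:C%C) lecR -expR0 ler_expR oppr_le0 divr_ge0 // mulr_ge0 // ltW //.
pose C := \sum_k tau k * (A k ^+ 4 + A k ^+ 3).
(* N_k = tau_k / eps factors, each with error of order eps^2 + eps sqrt eps, leave eps + sqrt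
   eps. *)
have bnd n : `|\prod_k b n k ^+ N n k - Q%:C%C| <= (C * (eps n + Num.sqrt (eps n)))%:C%C.
  rewrite -(aQ n).
  apply: le_trans (norm_prodB (index_enum _) _ _) _.
  - by move=> k; rewrite normrX exprn_ile1.
  - by move=> k; rewrite normrX exprn_ile1.
  rewrite /C mulr_suml rmorph_sum; apply: ler_sum => k _.
  apply: le_trans (norm_exprB _ (b1 n k) (a1 n k)) _.
  have := cis_sum_taylor (p0 k) (p1 k) (py k) (yA k) (ltW (eps0 n)).
  have Nn : 0 <= (N n k)%:R :> R[i] by exact: ler0n.
  move/(ler_wpM2l Nn); rewrite -/(s k) -/(a n k) -/(b n k) => /le_trans; apply.
  rewrite -(rmorph_nat (real_complex R)) -rmorphM lecR NE.
  rewrite le_eqVlt; apply/orP; left; apply/eqP; field; rewrite gt_eqF //.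
have dist n : `|complex.Re (cis theta * \prod_k b n k ^+ N n k) - Q * cos theta|
    <= C * (eps n + Num.sqrt (eps n)).
  rewrite -lecR; apply: le_trans (bnd n).
  have -> : Q * cos theta = complex.Re (cis theta * Q%:C%C) by rewrite /= mulr0 subr0 mulrC.
  rewrite -raddfB /= -mulrBr; apply: le_trans (normc_ge_Re _) _.
  by rewrite normrM norm_cis mul1r.
have lim : C * (eps n + Num.sqrt (eps n)) @[n --> \oo] --> (0 : R).
  rewrite -(mulr0 C); apply: cvgMl_tmp; rewrite -(addr0 0); apply: cvgD => //.
  rewrite -[X in _ --> X](@sqrtr0 R).
  by apply: (continuous_cvg _ _ epscvg); exact: sqrt_continuous.
apply/cvgrPdist_le => e e0; move/cvgr0Pnorm_le : lim => /(_ _ e0); apply: filterS => n le_e.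
by rewrite distrC; apply: le_trans (dist n) _; apply: le_trans le_e; exact: ler_norm.
Qed.

End CharacteristicFunction.

(** * Uniform exponential moments *)

Section ExponentialMoments.
Variable R : realType.
Implicit Types (x s : R).

Lemma sqr_le_expR x : x ^+ 2 <= 4 * expR `|x|.
Proof.
have -> : expR `|x| = expR (`|x| / 2) ^+ 2 by rewrite -expRM_natl; congr expR; field.
have := expR_ge1Dx (`|x| / 2); have := normr_ge0 x; rewrite -(real_normK (num_real x)).
set y := `|x|; set z := expR _ => y0 yz; nra.
Qed.

Lemma norm_expR x : expR `|x| <= expR x + expR (- x).
Proof.
by case: ger0P => _; [rewrite lerDl|rewrite lerDr]; exact: expR_ge0.
Qed.

Lemma expR_quadratic s : expR s <= 1 + s + s ^+ 2 * expR `|s|.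
Proof.
have [s0|s0] := leP 0 s.
  rewrite (ger0_norm s0); have := expR_ge1Dx (- s); have e0 := expR_gt0 s.
  have : expR s * expR (- s) = 1 by rewrite -expRD subrr expR0.
  set a := expR s; set b := expR (- s) => ab sb.
  have h1 : a * (1 - s) <= a * b by rewrite ler_wpM2l // ltW.
  rewrite ab in h1.
  have h2 : s * (a * (1 - s)) <= s * 1 by rewrite ler_wpM2l.
  lra.
have := expR_taylor (ltW (_ : 0 < - s)); rewrite oppr_gt0 opprK sqrrN => /(_ s0).
rewrite ler_norml => /andP[_].
have : 1 <= expR `|s| by rewrite -expR0 ler_expR.
have := sqr_ge0 s; nra.
Qed.

(** The mean being 0, each factor is at most 1 + eps B <= e^(eps B); raised to the power N = tau /
    eps this is e^(tau B). *)
Lemma exp_moment_bound m (d : 'I_m -> nat) (p y : forall k, 'I_(d k) -> R) (tau : 'I_m -> R)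
    (eps : nat -> R) (N : nat -> 'I_m -> nat) E :
  (forall k j, 0 <= p k j) -> (forall k, \sum_j p k j = 1) ->
  (forall k, \sum_j p k j * y k j = 0) ->
  (forall n, 0 < eps n <= E) -> (forall n k, (N n k)%:R = tau k / eps n) ->
  exists S, forall n, \prod_k (\sum_j p k j * expR (Num.sqrt (eps n) * y k j)) ^+ N n k <= S.
Proof.
move=> p0 p1 py epsE NE; pose A k := \sum_j `|y k j|.
have yA k j : `|y k j| <= A k by rewrite /A (bigD1 j) //= lerDl sumr_ge0.
pose B k := A k ^+ 2 * expR (Num.sqrt E * A k).
exists (\prod_k expR (tau k * B k)) => n; have /andP[e0 eE] := epsE n.
set q := Num.sqrt (eps n); have qq : q ^+ 2 = eps n by rewrite sqr_sqrtr // ltW.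
have q0 : 0 <= q by exact: sqrtr_ge0.
have qE : q <= Num.sqrt E by exact: ler_wsqrtr.
apply: ler_prod => k _; apply/andP; split.
  by rewrite exprn_ge0 // sumr_ge0 // => j _; rewrite mulr_ge0 // expR_ge0.
have -> : tau k * B k = (N n k)%:R * (eps n * B k) by rewrite NE; field; rewrite gt_eqF.
rewrite expRM_natl lerXn2r ?nnegrE ?expR_ge0 //.
  by rewrite sumr_ge0 // => j _; rewrite mulr_ge0 // expR_ge0.
apply: le_trans (expR_ge1Dx _).
have -> : 1 + eps n * B k = \sum_j p k j * (1 + q * y k j + eps n * B k).
  under eq_bigr do rewrite !mulrDr mulr1 (mulrCA _ q).
  by rewrite !big_split /= -mulr_sumr py mulr0 addr0 -mulr_suml p1 mul1r.
apply: ler_sum => j _; rewrite ler_wpM2l //; apply: le_trans (expR_quadratic _) _.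
rewrite lerD2l exprMn qq -mulrA ler_wpM2l ?(ltW e0) // /B.
have A0 : 0 <= A k by exact: le_trans (normr_ge0 _) (yA k j).
apply: ler_pM; rewrite ?sqr_ge0 ?expR_ge0 //.
  by rewrite -real_normK ?num_real // lerXn2r ?nnegrE.
by rewrite ler_expR normrM (ger0_norm q0) ler_pM.
Qed.

End ExponentialMoments.

(** * Derivatives of the log-partition function *)

Section LogPartition.
Variables (R : realType) (r m : nat) (d : 'I_m -> nat).
Variable l : forall k, 'I_(d k) -> 'rV[R]_r -> R.
Hypothesis l_linear : forall k (j : 'I_(d k)) c v y, l j (c *: v + y) = c * l j v + l j y.
Implicit Types (u v y : 'rV[R]_r) (s : R).

Lemma derive_line (f : 'rV[R]_r -> R) y v a :
  is_derive (0 : R) 1 (fun s : R => f (s *: v + y)) a -> 'D_v f y = a.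
Proof.
case=> _ <-; rewrite /derive.
have -> // : (fun h : R => h^-1 *: ((f \o shift y) (h *: v) - f y))
  = (fun h : R => h^-1 *: (((fun s : R => f (s *: v + y)) \o shift 0) (h *: (1 : R)) - f (0 *: v + y))).
by apply/funext => h; rewrite /shift /= scale0r add0r addr0 [h *: 1]mulr1.
Qed.

Definition partition k y : R := \sum_j expR (@l k j y).

Definition gibbs k (j : 'I_(d k)) y : R := expR (l j y) / partition k y.

Lemma is_derive_sum_line n (F : 'I_n -> R -> R) (dF : 'I_n -> R) s :
  (forall i, is_derive s 1 (F i) (dF i)) -> is_derive s 1 (fun s => \sum_i F i s) (\sum_i dF i).
Proof.
move=> dFi; have := is_derive_sum dFi.
by rewrite (_ : \sum_i F i = fun s => \sum_i F i s) //; apply/funext => z; rewrite fct_sumE.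
Qed.

Lemma is_derive_exp_line k (j : 'I_(d k)) c v y s :
  is_derive s 1 (fun s => c * expR (l j (s *: v + y))) (c * l j v * expR (l j (s *: v + y))).
Proof.
have dq : is_derive s 1 (fun s => l j (s *: v + y)) (l j v).
  apply: (@is_derive_quadratic _ _ _ _ 0) => h.
  rewrite !l_linear; have -> : (s + h) * l j v + l j y - (s * l j v + l j y) - l j v * h = 0 by ring.
  by rewrite normr0 mul0r.
have dc := is_deriveZ c (@is_derive1_comp R expR _ s _ _ (is_derive_expR _) dq).
by apply: (is_derive_eq dc); rewrite /GRing.scale /=; ring.
Qed.

Hypothesis d_gt0 : forall k, (0 < d k)%N.

Lemma partition_gt0 k y : 0 < partition k y.
Proof.
rewrite /partition (bigD1 (Ordinal (d_gt0 k))) //= ltr_wpDr ?expR_gt0 //.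
by apply: sumr_ge0 => j _; exact: expR_ge0.
Qed.

Lemma is_derive_partition k v y s :
  is_derive s 1 (fun s => partition k (s *: v + y))
    (\sum_j l j v * expR (@l k j (s *: v + y))).
Proof.
apply: is_derive_sum_line => j; have := is_derive_exp_line j 1 v y s.
by under eq_fun do rewrite mul1r; rewrite mul1r.
Qed.

Variable tau : 'I_m -> R.

Definition log_partition y := \sum_k tau k * ln (partition k y).

Lemma derive_log_partition v y :
  'D_v log_partition y = \sum_k tau k * \sum_j gibbs j y * @l k j v.
Proof.
apply: derive_line; apply: is_derive_sum_line => k.
have dl := @is_derive1_comp R _ _ 0 _ _ (is_derive1_ln (partition_gt0 k (0 *: v + y))) (is_derive_partition k v y 0).
have dt := is_deriveZ (tau k) dl.
apply: (is_derive_eq dt); rewrite scale0r add0r /GRing.scale /=; congr (_ * _).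
rewrite mulr_sumr; apply: eq_bigr => j _; rewrite /gibbs; ring.
Qed.

Lemma derive2_log_partition u v y :
  'D_u (fun y => 'D_v log_partition y) y
  = \sum_k tau k * (\sum_j gibbs j y * (@l k j u * @l k j v)
                   - (\sum_j gibbs j y * @l k j u) * (\sum_j gibbs j y * @l k j v)).
Proof.
have -> : (fun y => 'D_v log_partition y)
    = (fun y => \sum_k tau k * ((\sum_j l j v * expR (@l k j y)) * (partition k y)^-1)).
  apply/funext => z; rewrite derive_log_partition; apply: eq_bigr => k _; congr (_ * _).
  by rewrite mulr_suml; apply: eq_bigr => j _; rewrite /gibbs; ring.
apply: derive_line; apply: is_derive_sum_line => k.
have p0 : partition k (0 *: u + y) != 0 by rewrite gt_eqF ?partition_gt0.
have dV := @is_deriveV R _ 0 _ _ p0 (is_derive_partition k u y 0).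
have dN : is_derive (0 : R) 1 (fun s => \sum_j l j v * expR (@l k j (s *: u + y)))
    (\sum_j l j v * l j u * expR (@l k j (0 *: u + y))).
  by apply: is_derive_sum_line => j; exact: is_derive_exp_line.
have dt := is_deriveZ (tau k) (is_deriveM dN dV).
apply: (is_derive_eq dt); rewrite scale0r add0r /GRing.scale /=; congr (_ * _).
rewrite scale0r add0r in p0.
have -> : \sum_j gibbs j y * (@l k j u * @l k j v) = (\sum_j l j v * l j u * expR (@l k j y)) / partition k y.
  by rewrite mulr_suml; apply: eq_bigr => j _; rewrite /gibbs; ring.
have gE w : \sum_j gibbs j y * @l k j w = (\sum_j l j w * expR (@l k j y)) / partition k y.
  by rewrite mulr_suml; apply: eq_bigr => j _; rewrite /gibbs; ring.
by rewrite !gE; field.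
Qed.

End LogPartition.

(** * The character measure *)

Section CharacterMeasure.
Variables (R : realType) (r m : nat) (g : lieAlgebra R[i]) (gR hR : set g).
Variables (alpha : 'I_r -> g) (V : 'rV[R]_r -> lieModule g) (nu : 'I_m -> 'rV[R]_r).
Hypothesis simple_g : is_simple g.
Hypothesis split_g : split_real_form gR hR.
Hypothesis simple_alpha : simple_roots alpha hR.
Hypothesis hV : highest_weight_modules alpha V.
Hypothesis nu_dominant : forall k, dominant_integral alpha (nu k).
Hypothesis r_gt0 : exists x : 'rV[R]_r, x <> 0.
Variables (tau : 'I_m -> R) (t : 'rV[R]_r).

Local Notation "<| x , y |>" := (pairing alpha x y) (at level 0).
Local Notation "''e_' a" := (delta_mx 0 a : 'rV[R]_r) (at level 8, a at level 2).

(** If (alpha_a, t) = 0, the reflection in alpha_a fixes t, so by regularity it is the identity; yet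
    it sends alpha_a to its negative. *)
Lemma regular_dominant_gt0 a : regular alpha t -> dominant_chamber alpha t -> 0 < <|'e_a, t|>.
Proof.
move=> reg dom; rewrite lt0r dom andbT; apply/eqP => ta.
have [_ _ ra _] := simple_alpha.
have e0 : 'e_a <> 0 by case: (ra a).
have /(_ 'e_a) : reflection alpha 'e_a \o id =1 id.
  apply: (reg); first by apply: weyl_reflection; [exact: ra|exact: weyl_id].
  by rewrite /= /reflection pairingC ta mulr0 mul0r scale0r subr0.
rewrite /= /reflection mulfK; last by rewrite gt_eqF // (pairing_gt0 simple_g split_g simple_alpha).
move=> /eqP; rewrite -subr_eq0 addrAC subrr add0r oppr_eq0 scaler_eq0 pnatr_eq0 /= => /eqP.
exact: e0.
Qed.

Local Notation w k j := (@weights R r g alpha (V (nu k)) j).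
Local Notation p k j := (expR <|w k j, t|> / character alpha (V (nu k)) t).

Let wP k := weightsP simple_g split_g simple_alpha r_gt0 hV (nu_dominant k).

Lemma character_sum k y : character alpha (V (nu k)) y = \sum_j expR <|w k j, y|>.
Proof. exact (characterE simple_g split_g simple_alpha y (wP k)). Qed.

Lemma character_gt0 lambda y : dominant_integral alpha lambda -> 0 < character alpha (V lambda) y.
Proof.
by move=> dl; apply: lt_le_trans (character_ge simple_g split_g simple_alpha r_gt0 hV y dl); exact: expR_gt0.
Qed.

Lemma weight_prob_ge0 k j : 0 <= p k j.
Proof. by rewrite divr_ge0 ?expR_ge0 // ltW // character_gt0. Qed.

Lemma weight_prob_gt0 k j : 0 < p k j.
Proof. by rewrite divr_gt0 ?expR_gt0 // character_gt0. Qed.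

Lemma weight_prob_sum k : \sum_j p k j = 1.
Proof. by rewrite -mulr_suml -character_sum divff // gt_eqF // character_gt0. Qed.

Definition weight_mean k : 'rV[R]_r := \sum_j p k j *: w k j.

Definition weight_covariance : 'M[R]_r :=
  \matrix_(a, b) \sum_k tau k * \sum_j p k j * ((w k j - weight_mean k) 0 a * (w k j - weight_mean k) 0 b).

Lemma bilin_covariance u v : bilin weight_covariance u v
  = \sum_k tau k * \sum_j p k j * (dot u (w k j - weight_mean k) * dot v (w k j - weight_mean k)).
Proof.
rewrite bilinE.
under eq_bigr do under eq_bigr do rewrite mxE mulr_sumr mulr_suml.
under eq_bigr do rewrite exchange_big.
rewrite exchange_big; apply: eq_bigr => k _ /=.
under eq_bigr do under eq_bigr do rewrite mulrCA -mulrA mulr_sumr mulr_suml.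
under eq_bigr do rewrite -mulr_sumr exchange_big.
rewrite -mulr_sumr exchange_big; congr (_ * _); apply: eq_bigr => j _ /=.
rewrite !dotE mulr_suml mulr_sumr; apply: eq_bigr => a _.
rewrite !mulr_sumr; apply: eq_bigr => b _; ring.
Qed.

Lemma dot_mean0 u k : \sum_j p k j * dot u (w k j - weight_mean k) = 0.
Proof.
under eq_bigr do rewrite dotBr mulrBr.
rewrite sumrB -mulr_suml weight_prob_sum mul1r /weight_mean dotC.
apply/eqP; rewrite subr_eq0; apply/eqP; rewrite {2}/dot mulmx_suml summxE.
by apply: eq_bigr => j _; rewrite -scalemxAl [RHS]mxE dotC.
Qed.

(** If the form vanishes at u, every term vanishes; for the k with tau_k > 0 and nu_k <> 0 all
    probabilities are positive, so u is constant on the weights of V_(nu_k), and [weights_separate]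
    applies. *)
Lemma posdef_covariance : (forall k, 0 <= tau k) -> (exists k, 0 < tau k /\ nu k <> 0) ->
  posdef weight_covariance.
Proof.
move=> tau0 [k [tk nk]]; split=> [|u u0].
  apply/matrixP => a b; rewrite !mxE; apply: eq_bigr => k' _; congr (_ * _).
  by apply: eq_bigr => j _; rewrite [_ 0 b * _]mulrC.
have term0 k' j : 0 <= p k' j * (dot u (w k' j - weight_mean k') * dot u (w k' j - weight_mean k')).
  by rewrite mulr_ge0 ?weight_prob_ge0 // -expr2 sqr_ge0.
have sum0 k' : 0 <= tau k' * \sum_j p k' j * (dot u (w k' j - weight_mean k') * dot u (w k' j - weight_mean k')).
  by rewrite mulr_ge0 // sumr_ge0.
rewrite bilin_covariance lt0r sumr_ge0 // andbT; apply: contra_neq u0 => /eqP.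
rewrite psumr_eq0 // => /allP /(_ k (mem_index_enum _)) /= /eqP/eqP.
rewrite mulf_eq0 gt_eqF //= psumr_eq0 // => /allP w0.
have uB := gram_unit simple_g split_g simple_alpha.
have dw j : dot u (w k j - weight_mean k) = 0.
  have /eqP/eqP := w0 j (mem_index_enum _).
  by rewrite mulf_eq0 gt_eqF ?weight_prob_gt0 //= mulf_eq0 orbb => /eqP.
(* Turns the Euclidean product with u into the pairing with [u']. *)
pose u' := u *m invmx (gram alpha).
have wE x : <|x, u'|> = dot u x.
  rewrite pairingC /pairing dotE exchange_big /=; apply: eq_bigr => b _.
  by rewrite -mulr_suml -[in RHS](mulmxKV uB u) mxE.
have : u' = 0.
  apply: (@weights_separate R r g gR hR alpha simple_g split_g simple_alpha r_gt0 V hV (nu k) u' (dot u (weight_mean k))) => // j.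
  by rewrite wE; apply/eqP; rewrite -subr_eq0 -dotBr dw.
by move=> u'0; rewrite -(mulmxKV uB u) -/u' u'0 mul0mx.
Qed.

Let l k (j : 'I_(mdim (V (nu k)))) (y : 'rV[R]_r) : R := <|w k j, y|>.

Let l_linear k (j : 'I_(mdim (V (nu k)))) c v y : l j (c *: v + y) = c * l j v + l j y.
Proof. by rewrite /l linearP. Qed.

Let mdim_gt0 k : (0 < mdim (V (nu k)))%N.
Proof. by have [[]] := hV (nu_dominant k). Qed.

Lemma free_energyE : free_energy alpha V nu tau = log_partition l tau.
Proof.
by apply/funext => y; apply: eq_bigr => k _; rewrite character_sum.
Qed.

Let gibbsE k j : gibbs l j t = p k j.
Proof. by rewrite /gibbs /partition character_sum. Qed.

Lemma legendre_image (eta : 'rV[R]_r) :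
  (forall a, \sum_b gram alpha a b * eta 0 b = partial a (free_energy alpha V nu tau) t) ->
  eta = \sum_k tau k *: weight_mean k.
Proof.
move=> etaE; have uB := gram_unit simple_g split_g simple_alpha.
rewrite -(mulmxK uB eta) -(mulmxK uB (\sum_k _)); congr (_ *m _); apply/rowP => a.
transitivity (\sum_b gram alpha a b * eta 0 b).
  by rewrite mxE; apply: eq_bigr => b _; rewrite mulrC gram_sym.
rewrite etaE /partial free_energyE (derive_log_partition l_linear mdim_gt0).
rewrite -pairing_deltar pairing_suml; apply: eq_bigr => k _.
rewrite pairingZl; congr (_ * _); rewrite /weight_mean pairing_suml.
by apply: eq_bigr => j _; rewrite pairingZl gibbsE.
Qed.

Lemma hessian_free_energy :
  hessian (free_energy alpha V nu tau) t = gram alpha *m weight_covariance *m gram alpha.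
Proof.
have gT : (gram alpha)^T = gram alpha by apply/matrixP => a b; rewrite mxE gram_sym.
have dotg a x : dot ('e_a *m gram alpha) x = <|x, 'e_a|>.
  by rewrite pairing_deltar dotC /dot trmx_mul mulmxA gT trmx_delta -colE mxE.
apply/matrixP => a b.
have -> : (gram alpha *m weight_covariance *m gram alpha) a b
    = bilin weight_covariance ('e_a *m gram alpha) ('e_b *m gram alpha).
  rewrite /bilin /dot trmx_mul gT trmx_delta !mulmxA -colE [RHS]mxE -!mulmxA -rowE [RHS]mxE.
  by rewrite !mulmxA.
rewrite bilin_covariance mxE /partial free_energyE (derive2_log_partition l_linear mdim_gt0).
apply: eq_bigr => k _; congr (_ * _).
under eq_bigr do rewrite !gibbsE.
under [X in X * _]eq_bigr do rewrite gibbsE.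
under [X in _ * X]eq_bigr do rewrite gibbsE.
have mE c : \sum_j p k j * l j 'e_c = <|weight_mean k, 'e_c|>.
  by rewrite pairing_suml; apply: eq_bigr => j _; rewrite pairingZl.
under [RHS]eq_bigr do rewrite !dotg !pairingBl.
rewrite !mE -/l.
set A := <|weight_mean k, 'e_a|>; set B := <|weight_mean k, 'e_b|>.
(* Written with the sum of the probabilities, equal to 1, so that the four sums merge into the
   centred covariance term by term. *)
transitivity (\sum_j p k j * (l j 'e_a * l j 'e_b) - A * (\sum_j p k j * l j 'e_b)
   - B * (\sum_j p k j * l j 'e_a) + A * B * \sum_j p k j).
  by rewrite !mE weight_prob_sum -/A -/B; ring.
clearbody A B.
rewrite !mulr_sumr -!sumrB -big_split; apply: eq_bigr => j _ /=; rewrite /l; ring.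
Qed.

Hypothesis t_gt0 : forall a, 0 < <|'e_a, t|>.

(** * The joint law of a component and one of its weights *)

Section FixedTensor.
Variables (N : 'I_m -> nat) (e : R).
Hypothesis e_gt0 : 0 < e.

Let comps := components alpha V (big_tensor V nu N).
Let Z := \prod_k character alpha (V (nu k)) t ^+ N k.

(** Centred at the sum of the N_k (mean)_k, which is eta / eps when N_k = tau_k / eps. *)
Definition rescale (x : 'rV[R]_r) : 'rV[R]_r :=
  Num.sqrt e *: (x - \sum_k (N k)%:R *: weight_mean k).

(* The joint law of an irreducible component [lambda] and one of its weights
   [mu], drawn with probability proportional to [expR <|mu, t|>]. *)
Definition joint_expectation (F : 'rV[R]_r -> 'rV[R]_r -> R) : R :=
  \sum_(lambda <- comps) \sum_j
    F lambda (@weights R r g alpha (V lambda) j) * (expR <|weights alpha j, t|> / Z).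

Let comps_dominant lambda : lambda \in comps -> dominant_integral alpha lambda.
Proof.
move=> lc; have [dom _] := components_weights simple_g split_g simple_alpha r_gt0 hV N nu_dominant.
exact: dom.
Qed.

Lemma tensor_character_gt0 : 0 < Z.
Proof. by apply: prodr_gt0 => k _; rewrite exprn_gt0 // character_gt0. Qed.

Let Z0 := tensor_character_gt0.

Lemma le_joint_expectation F G :
  (forall lambda j, dominant_integral alpha lambda ->
     F lambda (@weights R r g alpha (V lambda) j) <= G lambda (weights alpha j)) ->
  joint_expectation F <= joint_expectation G.
Proof.
move=> FG; rewrite /joint_expectation !big_seq; apply: ler_sum => lambda /comps_dominant dl.
by apply: ler_sum => j _; rewrite ler_wpM2r ?divr_ge0 ?expR_ge0 ?(ltW Z0) // FG.
Qed.

Lemma joint_expectation_linear a F G :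
  joint_expectation (fun x y => a * F x y + G x y) = a * joint_expectation F + joint_expectation G.
Proof.
rewrite /joint_expectation mulr_sumr -big_split; apply: eq_bigr => lambda _ /=.
rewrite mulr_sumr -big_split; apply: eq_bigr => j _ /=.
by move: (_ / Z) => q; ring.
Qed.

(** The function c times e^(., t) is multiplicative, so its sum over the weights factors. The ring
    [A] is R for exponential moments and R[i] for characteristic functions, with [iota] the
    embedding of R. *)
Lemma joint_expectation_law (A : comNzRingType) (iota : {rmorphism R -> A}) (c : 'rV[R]_r -> A) :
  c 0 = 1 -> (forall x y, c (x + y) = c x * c y) ->
  \sum_(lambda <- comps) \sum_j
    c (@weights R r g alpha (V lambda) j - \sum_k (N k)%:R *: weight_mean k)
      * iota (expR <|weights alpha j, t|> / Z)
  = \prod_k (\sum_j iota (p k j) * c (w k j - weight_mean k)) ^+ N k.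
Proof.
move=> c0 cD; have [_ [d [mu [muE psiE]]]] :=
  components_weights simple_g split_g simple_alpha r_gt0 hV N nu_dominant.
pose M := \sum_k (N k)%:R *: weight_mean k.
rewrite (muE A (fun x => c (x - M) * iota (expR <|x, t|> / Z))).
pose psi x := c x * iota (expR <|x, t|>).
transitivity (c (- M) * iota Z^-1 * \sum_i psi (mu i)).
  rewrite mulr_sumr; apply: eq_bigr => i _; rewrite cD rmorphM /psi; ring.
rewrite psiE; last 2 first.
- by rewrite /psi c0 pairing0l expR0 rmorph1 mulr1.
- by move=> x y; rewrite /psi cD pairingDl expRD rmorphM; ring.
have cM : c (- M) = \prod_k c (- weight_mean k) ^+ N k.
  rewrite /M -sumrN (big_morph c cD c0); apply: eq_bigr => k _.
  rewrite -scalerN; elim: (N k) => [|n IH]; first by rewrite scale0r c0 expr0.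
  by rewrite -natr1 scalerDl scale1r cD IH exprSr.
have iZ : iota Z^-1 = \prod_k iota (character alpha (V (nu k)) t)^-1 ^+ N k.
  rewrite /Z -prodfV rmorph_prod; apply: eq_bigr => k _; by rewrite -exprVn rmorphXn.
rewrite cM iZ -!big_split; apply: eq_bigr => k _ /=; rewrite -!exprMn; congr (_ ^+ _).
rewrite mulr_sumr; apply: eq_bigr => j _; rewrite /psi cD rmorphM; ring.
Qed.

Lemma joint_expectation_weight_law (c : 'rV[R]_r -> R) :
  c 0 = 1 -> (forall x y, c (x + y) = c x * c y) ->
  joint_expectation (fun _ mu => c (mu - \sum_k (N k)%:R *: weight_mean k))
  = \prod_k (\sum_j p k j * c (w k j - weight_mean k)) ^+ N k.
Proof. exact: (joint_expectation_law idfun). Qed.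

Lemma joint_expectation1 : joint_expectation (fun _ _ => 1) = 1.
Proof.
rewrite (joint_expectation_weight_law (c := fun=> 1)) ?mulr1 //.
rewrite big1 // => k _; under eq_bigr do rewrite mulr1.
by rewrite weight_prob_sum expr1n.
Qed.

Definition component_expectation (F : 'rV[R]_r -> R) : R :=
  joint_expectation (fun lambda _ => F (rescale lambda)).

(** Multiplicities turn the sum without repetitions into a sum over [comps], and summing over the
    weights mu restores the character of each component. *)
Lemma character_measure_expectation (h : 'rV[R]_r -> R) :
  \sum_(lambda <- highest_weights alpha V nu N)
     h (rescale lambda) * character_measure alpha V nu N t lambda = component_expectation h.
Proof.
rewrite /component_expectation /joint_expectation -/comps /highest_weights -/comps.
transitivity (\sum_(lambda <- undup comps) (h (rescale lambda) * (character alpha (V lambda) t / Z)) *+ count_mem lambda comps).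
  apply: eq_bigr => lambda _; rewrite /character_measure /multiplicity -/comps -/Z -mulr_natl.
  ring.
transitivity (\sum_(lambda <- comps) h (rescale lambda) * (character alpha (V lambda) t / Z)).
  exact: big_undup_iterop_count.
rewrite !big_seq; apply: eq_bigr => lambda /comps_dominant dl.
rewrite (characterE simple_g split_g simple_alpha t (weightsP simple_g split_g simple_alpha r_gt0 hV dl)).
by rewrite mulr_suml mulr_sumr.
Qed.

(** With the factor 1/2 the product with e^(mu, t) is e^(lambda, t) e^(mu - lambda, t/2): it stays
    summable uniformly in lambda, while [gap] dominates the coordinates of lambda - mu and their
    squares. *)
Definition gap (lambda mu : 'rV[R]_r) : R := expR (<|lambda - mu, t|> / 2).

Lemma gap_coord lambda j a : dominant_integral alpha lambda ->
  0 <= (lambda - @weights R r g alpha (V lambda) j) 0 a <= <|lambda - weights alpha j, t|> / <|'e_a, t|>.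
Proof.
move=> dl; set x := lambda - _.
have x0 b : 0 <= x 0 b.
  have := weights_le simple_g split_g simple_alpha r_gt0 hV j b dl.
  by rewrite -oppr_ge0 !mxE opprB.
rewrite x0 ler_pdivlMr // [in X in _ <= X](row_sum_delta x) pairing_suml (bigD1 a) //= pairingZl.
by rewrite lerDl sumr_ge0 // => b _; rewrite pairingZl mulr_ge0 // ltW.
Qed.

(** Each coordinate of lambda - mu lies between 0 and y / (alpha_a, t), where y = (lambda - mu, t).
    The constants 2 and 16 come from y <= 2 e^(y/2) and y^2 <= 16 e^(y/2). *)
Lemma gap_bounds : exists2 C : R, 0 <= C & forall lambda j, dominant_integral alpha lambda ->
  (forall a, `|(lambda - @weights R r g alpha (V lambda) j) 0 a| <= C * gap lambda (weights alpha j)) /\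
  sqnorm (lambda - weights alpha j) <= C * gap lambda (weights alpha j).
Proof.
pose C1 := \sum_a 2 / <|'e_a, t|>; pose C2 := \sum_a 16 / <|'e_a, t|> ^+ 2.
have C10 : 0 <= C1 by apply: sumr_ge0 => a _; rewrite divr_ge0 // ltW.
have C20 : 0 <= C2 by apply: sumr_ge0 => a _; rewrite divr_ge0 // sqr_ge0.
exists (C1 + C2) => [|lambda j dl]; first exact: addr_ge0.
have coord a := gap_coord j a dl; set x := lambda - _ in coord *.
set y := <|x, t|> in coord *.
have gE : gap lambda (weights alpha j) = expR (y / 2) by [].
have e0 : 0 <= expR (y / 2) by exact: expR_ge0.
have y2 : y <= 2 * expR (y / 2) by have := expR_ge1Dx (y / 2); lra.
rewrite gE; clearbody y; split=> [a|].
  have /andP[x0 xy] := coord a; rewrite ger0_norm //; apply: le_trans xy _.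
  rewrite mulrDl -[X in X <= _]addr0; apply: lerD; last by rewrite mulr_ge0.
  rewrite /C1 mulr_suml (bigD1 a) //=.
  rewrite -[X in X <= _]addr0; apply: lerD.
    by rewrite mulrAC ler_pM2r ?invr_gt0.
  by apply: sumr_ge0 => b _; rewrite mulr_ge0 // divr_ge0 // ltW.
rewrite mulrDl -[X in X <= _]add0r; apply: lerD; first by rewrite mulr_ge0.
rewrite /sqnorm /C2 mulr_suml; apply: ler_sum => a _.
have /andP[x0 xy] := coord a.
have y0 : 0 <= y by have := le_trans x0 xy; rewrite pmulr_lge0 // invr_gt0.
have yy : y ^+ 2 <= 16 * expR (y / 2).
  have := sqr_le_expR (y / 2); rewrite (@ger0_norm _ (y / 2)) ?divr_ge0 //; lra.
apply: (@le_trans _ _ ((y / <|'e_a, t|>) ^+ 2)); first by rewrite lerXn2r ?nnegrE ?(le_trans x0 xy).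
by rewrite expr_div_n [X in _ <= X]mulrAC ler_pM2r // invr_gt0 exprn_gt0.
Qed.

(** For each component the sum over mu is at most C e^(lambda, t), which is at most C
    chi_lambda(e^t); the total mass is 1. *)
Lemma joint_expectation_gap C :
  (forall lambda, dominant_integral alpha lambda ->
     \sum_i expR <|@weights R r g alpha (V lambda) i - lambda, 2^-1 *: t|> <= C) ->
  joint_expectation gap <= C.
Proof.
move=> hC; have J1 := joint_expectation1.
rewrite -[C]mulr1 -J1 /joint_expectation mulr_sumr !big_seq; apply: ler_sum => lambda /comps_dominant dl.
have C0 : 0 <= C by apply: le_trans (hC _ dl); apply: sumr_ge0 => j _; exact: expR_ge0.
have l0 : 0 <= expR <|lambda, t|> / Z by rewrite divr_ge0 ?expR_ge0 ?(ltW Z0).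
apply: (@le_trans _ _ (expR <|lambda, t|> / Z * C)).
  apply: le_trans (ler_wpM2l l0 (hC _ dl)); rewrite mulr_sumr; apply: ler_sum => j _.
  rewrite /gap mulrA -expRD [X in _ <= X]mulrAC -expRD ler_pM2r ?invr_gt0 // ler_expR.
  rewrite linearZ /= !pairingBl; lra.
rewrite mulrC ler_wpM2l //.
have -> : \sum_j 1 * (expR <|@weights R r g alpha (V lambda) j, t|> / Z) = character alpha (V lambda) t / Z.
  rewrite (characterE simple_g split_g simple_alpha t (weightsP simple_g split_g simple_alpha r_gt0 hV dl)).
  by rewrite mulr_suml; apply: eq_bigr => j _; rewrite mul1r.
rewrite ler_pM2r ?invr_gt0 //.
exact: (character_ge simple_g split_g simple_alpha r_gt0 hV t dl).
Qed.

End FixedTensor.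

Lemma joint_expectationZ N a F :
  joint_expectation N (fun x y => a * F x y) = a * joint_expectation N F.
Proof.
rewrite /joint_expectation mulr_sumr; apply: eq_bigr => lambda _.
by rewrite mulr_sumr; apply: eq_bigr => j _; rewrite [RHS]mulrA.
Qed.

Lemma le_joint_expectation_dist N F G H :
  (forall lambda j, dominant_integral alpha lambda ->
     `|F lambda (@weights R r g alpha (V lambda) j) - G lambda (weights alpha j)|
       <= H lambda (weights alpha j)) ->
  `|joint_expectation N F - joint_expectation N G| <= joint_expectation N H.
Proof.
move=> FGH.
have -> : joint_expectation N F - joint_expectation N G
    = joint_expectation N (fun x y => -1 * G x y + F x y).
  by rewrite joint_expectation_linear; ring.
rewrite ler_norml; apply/andP; split.
  have -> : - joint_expectation N H = joint_expectation N (fun x y => -1 * H x y).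
    by rewrite joint_expectationZ mulN1r.
  apply: le_joint_expectation => x j dx.
  by have := FGH x j dx; rewrite ler_norml => /andP[+ _]; lra.
by apply: le_joint_expectation => x j dx; have := FGH x j dx; rewrite ler_norml => /andP[_]; lra.
Qed.

Lemma joint_expectation_sum N (I : finType) (F : I -> 'rV[R]_r -> 'rV[R]_r -> R) :
  joint_expectation N (fun x y => \sum_i F i x y) = \sum_i joint_expectation N (F i).
Proof.
rewrite /joint_expectation exchange_big; apply: eq_bigr => lambda _ /=.
by rewrite exchange_big; apply: eq_bigr => j _; rewrite mulr_suml.
Qed.

Lemma rescaleE N e lambda mu :
  rescale N e lambda = rescale N e mu + Num.sqrt e *: (lambda - mu).
Proof. by rewrite /rescale -scalerDr [in RHS]addrC addrA subrK. Qed.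

Lemma sqnormD_le (x y : 'rV[R]_r) : sqnorm (x + y) <= 2 * sqnorm x + 2 * sqnorm y.
Proof.
rewrite /sqnorm !mulr_sumr -big_split; apply: ler_sum => a _ /=; rewrite mxE.
by have := sqr_ge0 (x 0 a - y 0 a); lra.
Qed.

Lemma cos_lipschitz (a b : R) : `|cos a - cos b| <= `|a - b|.
Proof.
have -> : cos a - cos b = - (2 * (sin ((a + b) / 2) * sin ((a - b) / 2))).
  have -> : cos a = cos ((a + b) / 2 + (a - b) / 2) by congr cos; field.
  have -> : cos b = cos ((a + b) / 2 - (a - b) / 2) by congr cos; field.
  by rewrite cosD cosB; ring.
rewrite normrN !normrM (ger0_norm (ler0n R 2)).
have s1 : `|sin ((a + b) / 2)| <= 1 by rewrite ler_norml sin_geN1 sin_le1.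
have := ler_wpM2r (normr_ge0 (sin ((a - b) / 2))) s1; rewrite mul1r.
have := sin_norm_le ((a - b) / 2); rewrite (normrM (a - b)) normfV (ger0_norm (ler0n R 2)); lra.
Qed.

Let half_t_gt0 a : 0 < <|'e_a, 2^-1 *: t|>.
Proof. by rewrite linearZ /= mulr_gt0. Qed.

Let expectation_gap : exists2 C : R, 0 <= C & forall N, joint_expectation N gap <= C.
Proof.
have [C hC] := weights_bound simple_g split_g simple_alpha r_gt0 hV half_t_gt0.
exists `|C| => // N; apply: le_trans (ler_norm C); exact: joint_expectation_gap.
Qed.

Section Sequence.
Variables (eps : nat -> R) (N : nat -> 'I_m -> nat).
Hypothesis eps_gt0 : forall n, 0 < eps n.
Hypothesis eps_cvg : eps n @[n --> \oo] --> (0 : R).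
Hypothesis N_eps : forall n k, (N n k)%:R = tau k / eps n.

(** The rescaled lambda is the rescaled mu plus sqrt eps (lambda - mu). The squares of the first are
    bounded through x^2 <= 4 (e^x + e^-x) by exponential moments, those of the second by [gap]. *)
Lemma second_moment_bound :
  exists S, forall n, component_expectation (N n) (eps n) (@sqnorm R r) <= S.
Proof.
have [E hE] : exists E, forall n, eps n <= E.
  have [E [_ EP]] := cvg_seq_bounded (cvgP _ eps_cvg).
  by exists (E + 1) => n; apply: le_trans (ler_norm _) _; apply: EP => //; rewrite ltrDl.
have E0 : 0 <= E by apply: le_trans (hE 0%N); exact: ltW.
have [Cg Cg0 hg] := gap_bounds; have [Ce Ce0 he] := expectation_gap.
have exp_moment (u : 'rV[R]_r) : exists S, forall n,
    joint_expectation (N n) (fun _ mu => expR (dot u (rescale (N n) (eps n) mu))) <= S.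
  have epsE n : 0 < eps n <= E by rewrite eps_gt0 hE.
  have [S hS] := @exp_moment_bound R m _ (fun k j => p k j) (fun k j => dot u (w k j - weight_mean k))
    tau eps N E weight_prob_ge0 weight_prob_sum (dot_mean0 u) epsE N_eps.
  exists S => n; apply: le_trans (hS n).
  have := @joint_expectation_weight_law (N n) (fun x => expR (Num.sqrt (eps n) * dot u x)).
  have -> : expR (Num.sqrt (eps n) * dot u 0) = 1 by rewrite dotC dot0l mulr0 expR0.
  move=> /(_ erefl) <-.
    rewrite le_eqVlt; apply/orP; left; apply/eqP; congr joint_expectation.
    by apply/funext => x; apply/funext => y; rewrite /rescale dotZr.
  by move=> x y; rewrite dotDr mulrDr expRD.
have /boolp.choice [Sp hSp] := fun a : 'I_r => exp_moment 'e_a.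
have /boolp.choice [Sm hSm] := fun a : 'I_r => exp_moment (- 'e_a).
exists (\sum_a 8 * (Sp a + Sm a) + 2 * E * Cg * Ce) => n.
pose X mu a := expR (dot 'e_a (rescale (N n) (eps n) mu)) + expR (dot (- 'e_a) (rescale (N n) (eps n) mu)).
apply: (@le_trans _ _ (joint_expectation (N n)
    (fun lambda mu => 2 * E * Cg * gap lambda mu + \sum_a 8 * X mu a))).
  apply: le_joint_expectation => lambda j dl; rewrite (rescaleE _ _ _ (weights alpha j)).
  apply: le_trans (sqnormD_le _ _) _; rewrite addrC; apply: lerD.
    have [_ sq] := hg lambda j dl.
    have -> : sqnorm (Num.sqrt (eps n) *: (lambda - weights alpha j)) = eps n * sqnorm (lambda - weights alpha j).
      rewrite /sqnorm mulr_sumr; apply: eq_bigr => a _.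
      by rewrite mxE exprMn sqr_sqrtr // ltW.
    rewrite -!mulrA ler_wpM2l //; apply: ler_pM => //; [exact: ltW|exact: sqnorm_ge0].
  rewrite /sqnorm mulr_sumr; apply: ler_sum => a _.
  rewrite /X dotNl dot_delta; have := sqr_le_expR (rescale (N n) (eps n) (weights alpha j) 0 a).
  have := norm_expR (rescale (N n) (eps n) (weights alpha j) 0 a); lra.
rewrite joint_expectation_linear joint_expectation_sum addrC; apply: lerD.
  apply: ler_sum => a _; rewrite joint_expectationZ ler_wpM2l //.
  have -> : joint_expectation (N n) (fun _ mu => X mu a)
    = joint_expectation (N n) (fun _ mu => 1 * expR (dot 'e_a (rescale (N n) (eps n) mu)) + expR (dot (- 'e_a) (rescale (N n) (eps n) mu))).
    by congr joint_expectation; apply/funext => x; apply/funext => y; rewrite mul1r.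
  by rewrite joint_expectation_linear mul1r lerD.
by rewrite ler_wpM2l // !mulr_ge0.
Qed.

Lemma joint_cos_cvg (u : 'rV[R]_r) theta :
  joint_expectation (N n) (fun _ mu => cos (dot u (rescale (N n) (eps n) mu) + theta)) @[n --> \oo]
  --> expR (- (bilin weight_covariance u u / 2)) * cos theta.
Proof.
have -> : bilin weight_covariance u u
    = \sum_k tau k * \sum_j p k j * dot u (w k j - weight_mean k) ^+ 2.
  rewrite bilin_covariance; exact: eq_bigr.
have lim := @cis_clt R m _ (fun k j => p k j) (fun k j => dot u (w k j - weight_mean k))
  tau eps N theta weight_prob_ge0 weight_prob_sum (dot_mean0 u) eps_gt0 eps_cvg N_eps.
have <- : (fun n => complex.Re (cis theta * \prod_k (\sum_j (p k j)%:C%C *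
     cis (Num.sqrt (eps n) * dot u (w k j - weight_mean k))) ^+ N n k))
  = (fun n => joint_expectation (N n) (fun _ mu => cos (dot u (rescale (N n) (eps n) mu) + theta))); last exact: lim.
apply/funext => n.
have := @joint_expectation_law (N n) R[i] (real_complex R) (fun x => cis (Num.sqrt (eps n) * dot u x)).
have -> : cis (Num.sqrt (eps n) * dot u 0) = 1 by rewrite dotC dot0l mulr0 cis0.
move=> /(_ erefl) <-; last by move=> x y; rewrite dotDr mulrDr cisD.
rewrite mulr_sumr raddf_sum; apply: eq_bigr => lambda _.
rewrite mulr_sumr raddf_sum; apply: eq_bigr => j _ /=.
rewrite /rescale dotZr cosD; ring.
Qed.

(** The cosine is 1-Lipschitz and the coordinates of lambda - mu are bounded by a multiple of [gap],
    so exchanging mu for lambda costs a constant times sqrt eps. *)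
Lemma component_cos_cvg (u : 'rV[R]_r) theta :
  component_expectation (N n) (eps n) (fun x => cos (dot u x + theta)) @[n --> \oo]
  --> expR (- (bilin weight_covariance u u / 2)) * cos theta.
Proof.
have [Cg Cg0 hg] := gap_bounds; have [Ce Ce0 he] := expectation_gap.
pose U := \sum_a `|u 0 a|; have U0 : 0 <= U by exact: sumr_ge0.
have close n : `|component_expectation (N n) (eps n) (fun x => cos (dot u x + theta))
   - joint_expectation (N n) (fun _ mu => cos (dot u (rescale (N n) (eps n) mu) + theta))|
   <= U * Cg * Ce * Num.sqrt (eps n).
  apply: (@le_trans _ _ (joint_expectation (N n) (fun lambda mu => Num.sqrt (eps n) * (U * Cg) * gap lambda mu))).
    apply: le_joint_expectation_dist => lambda j dl; apply: le_trans (cos_lipschitz _ _) _.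
    rewrite (rescaleE _ _ lambda (weights alpha j)) dotDr.
    have -> : forall a b c : R, a + b + c - (a + c) = b by move=> *; ring.
    rewrite dotZr normrM (ger0_norm (sqrtr_ge0 _)) -!mulrA ler_wpM2l ?sqrtr_ge0 //.
    rewrite dotE /U mulr_suml; apply: le_trans (ler_norm_sum _ _ _) _; apply: ler_sum => a _.
    by rewrite normrM ler_wpM2l //; exact: (hg lambda j dl).1.
  rewrite joint_expectationZ.
  have -> : U * Cg * Ce * Num.sqrt (eps n) = Num.sqrt (eps n) * (U * Cg) * Ce by ring.
  by rewrite ler_wpM2l // mulr_ge0 ?sqrtr_ge0 // mulr_ge0.
have sqrt0 : Num.sqrt (eps n) @[n --> \oo] --> (0 : R).
  rewrite -[X in _ --> X](@sqrtr0 R).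
  by apply: (continuous_cvg _ _ eps_cvg); exact: sqrt_continuous.
have lim0 : U * Cg * Ce * Num.sqrt (eps n) @[n --> \oo] --> (0 : R).
  by rewrite -[X in _ --> X](mulr0 (U * Cg * Ce)); exact: cvgMl_tmp.
have diff0 : component_expectation (N n) (eps n) (fun x => cos (dot u x + theta))
   - joint_expectation (N n) (fun _ mu => cos (dot u (rescale (N n) (eps n) mu) + theta))
   @[n --> \oo] --> (0 : R).
  apply/cvgr0Pnorm_le => x x0; move/cvgr0Pnorm_le : lim0 => /(_ _ x0); apply: filterS => n le_x.
  by apply: le_trans (close n) _; apply: le_trans le_x; exact: ler_norm.
rewrite -[X in _ --> X]add0r.
under eq_fun => n do rewrite -(subrK (joint_expectation (N n)
  (fun _ mu => cos (dot u (rescale (N n) (eps n) mu) + theta))) (component_expectation _ _ _)).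
by apply: cvgD; [exact: diff0|exact: joint_cos_cvg].
Qed.

Lemma component_expectation_cvg (h : 'rV[R]_r -> R) M : posdef weight_covariance ->
  continuous h -> (forall x, `|h x| <= M) ->
  component_expectation (N n) (eps n) h @[n --> \oo]
  --> integral_rV (fun x => h x * gaussian_density (invmx weight_covariance) x).
Proof.
move=> pS ch hM; have [S hS] := second_moment_bound.
apply: (gaussian_convergence (posdef_inv pS) (E := fun n => component_expectation (N n) (eps n)) (S := S)) ch hM => //.
- by move=> n a F G; exact: joint_expectation_linear.
- by move=> n F G FG; apply: le_joint_expectation => lambda j _; exact: FG.
- by move=> n; exact: joint_expectation1.
- by move=> u theta; rewrite invmxK; exact: component_cos_cvg.
Qed.

End Sequence.

End CharacterMeasure.

Theorem theorem2 (R : realType) (r m : nat) (g : lieAlgebra R[i])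
    (gR hR : set g) (alpha : 'I_r -> g)
    (simple_g : is_simple g)
    (split_g : split_real_form gR hR)
    (simple_alpha : simple_roots alpha hR)
    (V : 'rV[R]_r -> lieModule g)
    (hV : highest_weight_modules alpha V)
    (nu : 'I_m -> 'rV[R]_r)
    (nu_dominant : forall k, dominant_integral alpha (nu k))
    (tau : 'I_m -> R)
    (tau_ge0 : forall k, 0 <= tau k)
    (tau_nu : exists k, 0 < tau k /\ nu k <> 0)
    (t : 'rV[R]_r)
    (t_regular : regular alpha t)
    (t_dominant : dominant_chamber alpha t)
    (eta : 'rV[R]_r)
    (eta_legendre : forall a : 'I_r,
       \sum_b gram alpha a b * eta 0 b
       = partial a (free_energy alpha V nu tau) t) :
  let B := gram alpha in
  let D := hessian (free_energy alpha V nu tau) t in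
  let K := B *m invmx D *m B in
  forall h : 'rV[R]_r -> R,
    continuous h -> (exists M : R, forall x, `|h x| <= M) ->
  forall (eps : nat -> R) (N : nat -> 'I_m -> nat),
    (forall n, 0 < eps n) -> eps n @[n --> \oo] --> (0 : R) ->
    (forall n k, (N n k)%:R = tau k / eps n) ->
  (\sum_(lambda <- highest_weights alpha V nu (N n))
      h (Num.sqrt (eps n) *: (lambda - (eps n)^-1 *: eta))
      * character_measure alpha V nu (N n) t lambda) @[n --> \oo]
    --> integral_rV (fun a : 'rV[R]_r => h a * gaussian_density K a).
Proof.
move=> B D K h ch [M hM] eps N eps0 epscvg NE.
(* The nonzero weight nu_k provides the positive rank on which nondegeneracy of the Killing form
   rests. *)
have r_gt0 : exists x : 'rV[R]_r, x <> 0 by have [k [_ nk]] := tau_nu; exists (nu k).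
have t0 a := regular_dominant_gt0 simple_g split_g simple_alpha a t_regular t_dominant.
have etaE := legendre_image simple_g split_g simple_alpha hV nu_dominant r_gt0 eta_legendre.
pose S := weight_covariance alpha V nu tau t.
have pS : posdef S := posdef_covariance simple_g split_g simple_alpha hV nu_dominant r_gt0 t tau_ge0 tau_nu.
have uB : B \in unitmx := gram_unit simple_g split_g simple_alpha.
have uS := posdef_unit pS.
(* With D = B S B the matrix K is B (B S B)^-1 B, an inverse of S. *)
have -> : K = invmx S.
  rewrite /K /D (hessian_free_energy simple_g split_g simple_alpha hV nu_dominant r_gt0) -/B -/S.
  have uM : B *m S *m B \in unitmx by rewrite !unitmx_mul uB uS.
  rewrite -[LHS](mulmxK uS); have -> // : B *m invmx (B *m S *m B) *m B *m S = 1%:M.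
    rewrite -[LHS](mulmxK uB); have -> : B *m invmx (B *m S *m B) *m B *m S *m B = B.
      by have := mulVmx uM; rewrite -!mulmxA => ->; rewrite mulmx1.
    exact: mulmxV.
  by rewrite mul1mx.
have := component_expectation_cvg simple_g split_g simple_alpha hV nu_dominant r_gt0 t0 eps0 epscvg NE pS ch hM.
rewrite -/S; under eq_fun => n.
  rewrite -(character_measure_expectation simple_g split_g simple_alpha hV nu_dominant r_gt0 t (N n) (eps n) h).
  under eq_bigr => lambda _.
    have -> : rescale alpha V nu t (N n) (eps n) lambda = Num.sqrt (eps n) *: (lambda - (eps n)^-1 *: eta).
      rewrite /rescale etaE scaler_sumr; congr (_ *: (_ - _)); apply: eq_bigr => k _.
      by rewrite scalerA NE mulrC.
    over.
  over.
exact.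
Qed.
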